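(* Let $n\ge 1$ be an integer and $0<\alpha<n$. For $\mu>0$ consider the equation $$u(x)=\int_{\mathbb{R}^n}\frac{u(y)^\mu}{|x-y|^{n-\alpha}}\,dy\qquad\text{for all }x\in\mathbb{R}^n.\qquad( * )$$ (i) For $0<\mu<\frac{n}{n-\alpha}$, equation $( * )$ does not have any positive Lebesgue measurable solution $u$, unless $u\equiv\infty$. (ii) For $\frac{n}{n-\alpha}\le\mu<\frac{n+\alpha}{n-\alpha}$, equation $( * )$ does not have any positive solution $u\in L^{\frac{n(\mu-1)}{\alpha}}_{loc}(\mathbb{R}^n)$.
   Context: A positive solution is a Lebesgue measurable function $u$ defined on all of $\mathbb{R}^n$, with values in $(0,\infty]$ (with $\infty^\mu=\infty$), satisfying the integral equation pointwise everywhere. *)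

(* Defs.v *)
From HB Require Import structures.
From mathcomp Require Import all_boot all_order all_algebra.
From mathcomp Require Import all_classical all_reals all_analysis.
From mathcomp Require Import measurable_realfun.

Set Implicit Arguments.
Unset Strict Implicit.
Unset Printing Implicit Defensive.
Import Order.TTheory GRing.Theory Num.Theory.
Import numFieldNormedType.Exports.

Local Open Scope classical_set_scope.
Local Open Scope ring_scope.

Definition measure_rV_display : measure_display.
Proof. exact: default_measure_display. Qed.

(* The sigma-algebra on row vectors generated by the coordinate functions, as
   for [n.-tuple T] in the library: the Borel sets of R^n. *)
Section measurable_rV.
Context (R : realType) (n : nat).

Definition rV_coor (i : 'I_n) (x : 'rV[R]_n) : measurableTypeR R := x ord0 i.

Let rV_set0 : g_sigma_preimage rV_coor set0.
Proof. exact: sigma_algebra0. Qed.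

Let rV_setC A : g_sigma_preimage rV_coor A -> g_sigma_preimage rV_coor (~` A).
Proof. exact: sigma_algebraC. Qed.

Let rV_bigcup (F : (set 'rV[R]_n)^nat) :
  (forall i, g_sigma_preimage rV_coor (F i)) ->
  g_sigma_preimage rV_coor (\bigcup_i (F i)).
Proof. exact: sigma_algebra_bigcup. Qed.

HB.instance Definition _ := @isMeasurable.Build measure_rV_display 'rV[R]_n
  (g_sigma_preimage rV_coor) rV_set0 rV_setC rV_bigcup.

Lemma measurable_rV_coor i : measurable_fun setT (@rV_coor i).
Proof.
move=> _ Y mY; rewrite setTI; apply: sub_sigma_algebra => /=.
rewrite -bigcup_seq/=; exists i => /=; first by rewrite mem_index_enum.
by exists Y => //; rewrite setTI.
Qed.

Lemma measurable_fun_rVP d (T : measurableType d) (f : T -> 'rV[R]_n) :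
  measurable_fun setT f <-> forall i, measurable_fun setT (rV_coor i \o f).
Proof.
split=> [mf i|mf]; first exact: measurableT_comp (@measurable_rV_coor i) mf.
move=> _ A; rewrite setTI => mA.
suff : g_sigma_preimage rV_coor `<=` [set B | measurable (f @^-1` B)] by exact.
apply: smallest_sub.
- split=> [|B mB|F mF] /=; first by rewrite preimage_set0.
  + by rewrite setTD preimage_setC; exact: measurableC.
  + by rewrite preimage_bigcup; apply: bigcupT_measurable => k; exact: mF.
- rewrite -bigcup_seq => B [i _ [C mC <-]] /=; rewrite setTI.
  by have := mf i measurableT C mC; rewrite setTI.
Qed.
End measurable_rV.

Section product_rV.
Context (R : realType) (n : nat).
Variable m : {sigma_finite_measure set 'rV[R]_n -> \bar R}.

Definition cons_rV (p : measurableTypeR R * 'rV[R]_n) : 'rV[R]_n.+1 :=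
  row_mx (p.1 : R)%:M p.2.

Lemma cons_rV0 p : cons_rV p ord0 ord0 = p.1.
Proof.
rewrite /cons_rV.
have -> : ord0 = lshift n (ord0 : 'I_1) :> 'I_(1 + n) by exact/val_inj.
by rewrite [LHS]row_mxEl mxE eqxx mulr1n.
Qed.

Lemma cons_rVS p i : cons_rV p ord0 (lift ord0 i) = p.2 ord0 i.
Proof.
rewrite /cons_rV.
have -> : lift ord0 i = rshift 1 i :> 'I_(1 + n) by exact/val_inj.
by rewrite [LHS]row_mxEr.
Qed.

Lemma measurable_cons_rV : measurable_fun setT cons_rV.
Proof.
apply/measurable_fun_rVP => i; have [j ->|->] := unliftP ord0 i.
- rewrite (_ : _ \o _ = rV_coor j \o snd); last first.
    by apply/funext => p /=; rewrite /rV_coor cons_rVS.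
  exact: measurableT_comp (@measurable_rV_coor _ _ j) measurable_snd.
- rewrite (_ : _ \o _ = fst); last first.
    by apply/funext => p /=; rewrite /rV_coor cons_rV0.
  exact: measurable_fst.
Qed.

Definition uncons_rV (x : 'rV[R]_n.+1) : measurableTypeR R * 'rV[R]_n :=
  (x ord0 ord0, \row_i x ord0 (lift ord0 i)).

Lemma cons_rVK : cancel cons_rV uncons_rV.
Proof.
move=> [a x]; rewrite /uncons_rV cons_rV0; congr pair.
by apply/rowP => i; rewrite mxE cons_rVS.
Qed.

Lemma measurable_uncons_rV : measurable_fun setT uncons_rV.
Proof.
apply: measurable_fun_pair => /=; first exact: (@measurable_rV_coor _ _ ord0).
apply/measurable_fun_rVP => i.
rewrite (_ : _ \o _ = rV_coor (lift ord0 i)); last first.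
  by apply/funext => x /=; rewrite /rV_coor mxE.
exact: measurable_rV_coor.
Qed.

Definition product_rV : set 'rV[R]_n.+1 -> \bar R :=
  pushforward (lebesgue_measure \x m)%E cons_rV.

Let product_rV0 : product_rV set0 = 0%E.
Proof. by rewrite /product_rV /pushforward preimage_set0 measure0. Qed.

Let product_rV_ge0 A : (0 <= product_rV A)%E.
Proof. by rewrite /product_rV /pushforward; exact: measure_ge0. Qed.

Let mcons A : measurable A -> measurable (cons_rV @^-1` A).
Proof.
by move=> mA; rewrite -[X in measurable X]setTI; exact: measurable_cons_rV.
Qed.

Let product_rV_sigma_additive : semi_sigma_additive product_rV.
Proof.
move=> F mF tF mUF; rewrite /product_rV /pushforward preimage_bigcup.
apply: measure_semi_sigma_additive => [k| |].
- exact: mcons.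
- apply/trivIsetP => i j _ _ ij; rewrite -preimage_setI.
  by move/trivIsetP : tF => /(_ _ _ _ _ ij) ->//; rewrite preimage_set0.
- by rewrite -preimage_bigcup; exact: mcons.
Qed.

HB.instance Definition _ := isMeasure.Build _ _ _ product_rV
  product_rV0 product_rV_ge0 product_rV_sigma_additive.

Let product_rV_sigma_finite : sigma_finite setT product_rV.
Proof.
have /sigma_finiteP[F [TF ndF Foo]] := sigma_finiteT (@lebesgue_measure R).
have /sigma_finiteP[G [TG ndG Goo]] := sigma_finiteT m.
exists (fun k => uncons_rV @^-1` (F k `*` G k)).
  rewrite -preimage_bigcup (_ : \bigcup_k (F k `*` G k) = setT)//.
  rewrite -setXTT TF TG predeqE => -[a x]; split.
    by move=> [k _ []]; split; exists k.
  move=> [/= [i _ Fia] [j _ Gjx]]; exists (maxn i j) => //; split.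
  - by move: a Fia; exact/subsetPset/ndF/leq_maxl.
  - by move: x Gjx; exact/subsetPset/ndG/leq_maxr.
move=> k; have [mF Fk] := Foo k; have [mG Gk] := Goo k; split.
  rewrite -[X in measurable X]setTI; apply: measurable_uncons_rV => //.
  exact: measurableX.
rewrite /product_rV /pushforward -comp_preimage.
rewrite (_ : uncons_rV \o cons_rV = id); last exact/funext/cons_rVK.
rewrite preimage_id.
by rewrite product_measure1E// lte_mul_pinfty// ge0_fin_numE.
Qed.

HB.instance Definition _ := Measure_isSigmaFinite.Build _ _ _ product_rV
  product_rV_sigma_finite.
End product_rV.

Section lebesgue_rV.
Context (R : realType).

(* Lebesgue measure on the Borel sets of R^n, as an iterated product. *)
Fixpoint lebesgue_rV (n : nat) :
    {sigma_finite_measure set 'rV[R]_n -> \bar R} :=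
  match n with
  | 0 => \d_(0 : 'rV[R]_0)
  | n'.+1 => product_rV (lebesgue_rV n')
  end.

Lemma measurable_rV_box n (A : 'I_n -> set (measurableTypeR R)) :
  (forall i, measurable (A i)) ->
  measurable [set x : 'rV[R]_n | forall i, A i (x ord0 i)].
Proof.
move=> mA; rewrite (_ : mkset _ = \bigcap_(i in [set` index_enum 'I_n])
    (@rV_coor R n i @^-1` A i)); last first.
  apply/seteqP; split=> x xA i; first by move=> _; exact: xA.
  by apply: (xA i); rewrite /= mem_index_enum.
rewrite bigcap_seq; apply: bigsetI_measurable => i _.
by rewrite -[X in measurable X]setTI; exact: measurable_rV_coor.
Qed.

(* Together with sigma-finiteness, this characterizes Lebesgue measure. *)
Lemma lebesgue_rV_box n (A : 'I_n -> set (measurableTypeR R)) :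
  (forall i, measurable (A i)) ->
  lebesgue_rV n [set x | forall i, A i (x ord0 i)] =
  (\prod_(i < n) lebesgue_measure (A i))%E.
Proof.
elim: n A => [|n IHn] A mA.
  by rewrite big_ord0 /= diracE mem_set// => -[].
rewrite big_ord_recl -(IHn (fun i => A (lift ord0 i)))//.
rewrite [LHS]/= /product_rV /pushforward -product_measure1E//; last first.
  by apply: (@measurable_rV_box n (fun i => A (lift ord0 i))) => i.
congr (_ _ _ _); apply/seteqP; split=> p /=.
  move=> Ap; split=> [|i]; first by rewrite -cons_rV0; exact: Ap.
  by rewrite -cons_rVS; exact: Ap.
move=> [A0 AS] i; have [j ->|->] := unliftP ord0 i.
  by rewrite cons_rVS; exact: AS.
by rewrite cons_rV0.
Qed.
End lebesgue_rV.

Section integral_equation.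
Context (R : realType) (n : nat).

(* 'rV[R]_n equipped with the sigma-algebra of Lebesgue measurable sets: the
   Caratheodory measurable sets of the outer measure induced by Lebesgue
   measure on Borel sets. *)
Definition lebesgue_space := caratheodory_type ((lebesgue_rV R n)^*)%mu.
HB.instance Definition _ := Measurable.on lebesgue_space.

Definition completed_lebesgue_rV : set lebesgue_space -> \bar R :=
  @completed_measure_extension _ _ _ (lebesgue_rV R n).

HB.instance Definition _ := Measure.on completed_lebesgue_rV.

Definition lebesgue_measurable (u : 'rV[R]_n -> \bar R) : Prop :=
  measurable_fun [set: lebesgue_space] (u : lebesgue_space -> \bar R).

(* The norm `|x| provided by the library on 'rV[R]_n is the sup norm. *)
Definition enorm (x : 'rV[R]_n) : R := Num.sqrt (\sum_i x ord0 i ^+ 2).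

Local Open Scope ereal_scope.

(* With the conventions of \bar R, the integrand is +oo at y = x and wherever
   u y = +oo. *)
Definition solves_integral_equation (alpha mu : R) (u : 'rV[R]_n -> \bar R) :=
  forall x : 'rV[R]_n,
    u x = \int[completed_lebesgue_rV]_y
            (u y `^ mu / (enorm (x - y) `^ (n%:R - alpha))%:E).

Definition positive_solution (alpha mu : R) (u : 'rV[R]_n -> \bar R) : Prop :=
  [/\ lebesgue_measurable u, forall x, 0 < u x &
      solves_integral_equation alpha mu u].

Definition Lp_loc (p : R) (u : 'rV[R]_n -> \bar R) : Prop :=
  lebesgue_measurable u /\
  forall K : set 'rV[R]_n, compact K ->
    \int[completed_lebesgue_rV]_(x in (K : set lebesgue_space))
      (`|u x| `^ p) < +oo.

End integral_equation.

(* Main.v *)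
Require Import Defs.
From HB Require Import structures.
From mathcomp Require Import all_boot all_order all_algebra.
From mathcomp Require Import all_classical all_reals all_analysis.
From mathcomp Require Import measurable_realfun.
From mathcomp Require Import ring lra.

(* A solution is lower semicontinuous by Fatou's lemma, hence Borel, and if it
   is finite at one point it is finite almost everywhere. Put g = n - alpha and
   let M(r) be the integral of u^mu over the cube of half-side r. Bounding the
   kernel from below on the cube gives u >= c r^-g M(r) there, hence
     M(r) >= c r^(n - g mu) M(r)^mu   and   M(r) <= C r^g,
   which is impossible for mu < n/g; for mu = n/g, M is bounded, whereas the
   mass of each dyadic shell is bounded below.

   For n/g < mu < (2n - g)/g, compare u in the punctured ball of radius l with
   its Kelvin transform u_l(x) = (l/|x|)^g u(l^2 x/|x|^2). Splitting the integral
   along the sphere |y| = l and inverting the exterior writes u and u_l as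
   integrals over the ball with the kernels exchanged. By the
   Hardy-Littlewood-Sobolev inequality, u <= u_l in the ball as soon as the
   integral of u^(n(mu-1)/alpha) over the set where u > u_l is small. This set
   is small for small l, and, by the strong maximum principle and lower
   semicontinuity, for l slightly larger than a radius with u <= u_l; so
   u <= u_l for all l. Taking l^2 = |x| gives u(x) >= c |x|^(-g/2) for
   |x| >= 1, which contradicts the growth inequality for M. *)

Set Implicit Arguments.
Unset Strict Implicit.
Unset Printing Implicit Defensive.
Import Order.TTheory GRing.Theory Num.Theory.
Import numFieldNormedType.Exports.

Local Open Scope classical_set_scope.
Local Open Scope ring_scope.

(** * The Euclidean norm, Lebesgue measure and the Riesz kernel *)

(** The solution is only lower semicontinuous and may be [+oo] on a null set. Comparisons are
    therefore stated in [\bar R], proved almost everywhere, and made pointwise by the equation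
    itself. Inverting [u^mu] leaves the weight [(l/|y|)^(2n - g - g mu)]; subcriticality makes its
    exponent positive, which favours [u_l] inside the ball. The exponent [q = n(mu-1)/alpha] is the
    one for which [u^(mu-1)] lies locally in [L^(n/alpha)], so that the [q]-norm of the positive
    part of [u - u_l] is bounded by a small multiple of itself. The resulting exponents are interior
    to the Hardy-Littlewood-Sobolev range only for [mu > n/g], which is why [mu = n/g] is settled by
    the growth of [M]. Inversion and radial integration go through the dilation invariant measure
    [|x|^-n dx]: in logarithmic polar coordinates inversion is a reflection of the line, so no
    Jacobian is computed. Spheres centred at the origin suffice, since only a decay rate at infinity
    is wanted. *)

Section enorm.
Context (R : realType) (n : nat).
Implicit Types x y : 'rV[R]_n.

Lemma enorm_ge0 x : 0 <= enorm x.
Proof. exact: sqrtr_ge0. Qed.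

Lemma sqr_enorm x : enorm x ^+ 2 = \sum_i x ord0 i ^+ 2.
Proof. by rewrite sqr_sqrtr// sumr_ge0// => i _; exact: sqr_ge0. Qed.

Lemma enorm_coord x i : `|x ord0 i| <= enorm x.
Proof.
rewrite -(ler_pXn2r (n := 2))// ?nnegrE ?enorm_ge0//.
rewrite sqr_enorm real_normK ?num_real// (bigD1 i)//= lerDl.
by rewrite sumr_ge0// => j _; exact: sqr_ge0.
Qed.

Lemma enorm_eq0 x : (enorm x == 0) = (x == 0).
Proof.
apply/eqP/eqP => [x0|->].
  apply/rowP => i; rewrite mxE; apply/eqP; rewrite -normr_le0 -x0.
  exact: enorm_coord.
by rewrite /enorm big1 ?sqrtr0// => i _; rewrite mxE expr0n.
Qed.

Lemma enorm_gt0 x : (0 < enorm x) = (x != 0).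
Proof. by rewrite lt_def enorm_ge0 andbT enorm_eq0. Qed.

Lemma enormZ (a : R) x : enorm (a *: x) = `|a| * enorm x.
Proof.
rewrite /enorm -sqrtr_sqr -sqrtrM ?sqr_ge0// mulr_sumr; congr Num.sqrt.
by apply: eq_bigr => i _; rewrite mxE exprMn.
Qed.

Lemma enormB x y : enorm (x - y) = enorm (y - x).
Proof. by rewrite -opprB -scaleN1r enormZ normrN1 mul1r. Qed.

Lemma enorm_le x (r : R) : 0 <= r -> (forall i, `|x ord0 i| <= r) ->
  enorm x <= Num.sqrt n%:R * r.
Proof.
move=> r0 xr; rewrite -[r in leRHS]ger0_norm// -sqrtr_sqr -sqrtrM ?ler0n//.
apply: ler_wsqrtr; rewrite mulr_natl -[n in X in _ <= X]card_ord -sumr_const.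
by apply: ler_sum => i _; rewrite -real_normK ?num_real// lerXn2r// nnegrE.
Qed.

Lemma continuous_enorm_sub y : continuous (fun x => enorm (x - y)).
Proof.
move=> x; apply: (@continuous_comp _ _ _
  (fun x : 'rV[R]_n => \sum_i (x - y) ord0 i ^+ 2) Num.sqrt); last first.
  exact: sqrt_continuous.
apply: (@continuous_big _ _ +%R) => [|i _]; first exact: add_continuous.
move=> z; apply: (@continuous_comp _ _ _ (fun x : 'rV[R]_n => (x - y) ord0 i)
  (fun t : R => t ^+ 2)); last exact: exprn_continuous.
rewrite (_ : (fun _ => _) = (fun x => x ord0 i - y ord0 i)); last first.
  by apply/funext => w; rewrite !mxE.
apply: (@cvgB _ _ _ (nbhs z) _ (fun x : 'rV[R]_n => x ord0 i)
  (cst (y ord0 i)) (z ord0 i)); first exact: coord_continuous.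
exact: cvg_cst.
Qed.

Lemma measurable_enorm : measurable_fun setT (@enorm R n).
Proof.
rewrite (_ : @enorm R n = Num.sqrt \o (fun x => \sum_i x ord0 i ^+ 2))//.
apply: measurableT_comp.
  by apply: continuous_measurable_fun; exact: sqrt_continuous.
apply: (@measurable_sum _ _ _ _ _ _ (fun i (x : 'rV[R]_n) => x ord0 i ^+ 2)).
by move=> i; apply: measurable_funX; exact: (@measurable_rV_coor R n i).
Qed.

End enorm.

(** * Lower semicontinuity of integrals depending on a parameter *)

Section lsc_integral.
Context d (T : measurableType d) (R : realType) (X : pseudoMetricType R).
Variable mu : {measure set T -> \bar R}.
Local Open Scope ereal_scope.

(** Otherwise some points [x_ k] tend to [x] with integrals at most [a], and Fatou's lemma along
    them bounds the integral at [x] by [a]. Convergence is asked for almost every [y] only, because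
    the Riesz kernel is discontinuous at [y = x]. *)
Lemma lower_semicontinuous_integral (F : X -> T -> \bar R) :
  (forall x, measurable_fun setT (F x)) -> (forall x y, 0 <= F x y) ->
  (forall x, {ae mu, forall y, F z y @[z --> x] --> F x y}) ->
  lower_semicontinuous (fun x => \int[mu]_y F x y).
Proof.
move=> mF F0 cF; apply/lower_semicontinuousP => a; rewrite openE => x /= ax.
apply: contrapT => nx.
have /choice[x_ x_P] : forall k, exists z : X,
    ball x (k.+1%:R^-1)%R z /\ \int[mu]_y F z y <= a%:E.
  move=> k; apply: contrapT => xk; apply: nx.
  apply/nbhs_ballP; exists (k.+1%:R^-1)%R => /=; first by rewrite invr_gt0.
  move=> z xz; rewrite /= ltNge; apply/negP => za; apply: xk.
  by exists z.
have x_x : x_ k @[k --> \oo] --> x.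
  apply/cvg_ballP => e e0; near=> k.
  have [+ _] := x_P k; apply: le_ball.
  apply/ltW; near: k; exact: (near_infty_natSinv_lt (PosNum e0)).
suff : \int[mu]_y F x y <= a%:E by rewrite leNgt ax.
have mL : measurable_fun setT (fun y => limn_einf (fun k => F (x_ k) y)).
  have : measurable_fun setT (fun y => - limn_esup (fun k => - F (x_ k) y)).
    apply: measurableT_comp => //.
    apply: measurable_fun_limn_esup => k.
    by apply: measurableT_comp => //.
  by [].
have L0 y : 0 <= limn_einf (fun k => F (x_ k) y).
  rewrite limn_einf_lim; apply: lime_ge; first exact: is_cvg_einfs.
  apply: nearW => k; apply: le_ereal_inf_tmp => _ [j _ <-]; exact: F0.
have -> : \int[mu]_y F x y = \int[mu]_y limn_einf (fun k => F (x_ k) y).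
  apply: ge0_ae_eq_integral => //.
  apply: filterS (cF x) => y Fy _.
  apply/esym; apply: (cvg_limn_einf_sup _).1.
  exact: cvg_comp x_x Fy.
apply: le_trans (fatou _ _ _ _) _ => //.
rewrite limn_einf_lim; apply: lime_le; first exact: is_cvg_einfs.
apply: nearW => k; apply: ge_ereal_inf; exists (\int[mu]_y F (x_ k) y).
  by exists k => //=.
exact: (x_P k).2.
Unshelve. all: by end_near. Qed.

End lsc_integral.

Section measurable_powers.
Context d (T : measurableType d) (R : realType) (D : set T).

Lemma measurable_fun_poweR (f : T -> \bar R) (r : R) :
  measurable_fun D f -> measurable_fun D (fun x => f x `^ r)%E.
Proof. exact: (measurableT_comp (measurable_poweR r)). Qed.

Lemma measurable_fun_powR_base (f : T -> R) (r : R) :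
  measurable_fun D f -> measurable_fun D (fun x => f x `^ r).
Proof. exact: (measurableT_comp (measurable_powR r)). Qed.

End measurable_powers.

Lemma continuous_powR_gt0 (R : realType) (p s : R) : 0 < s ->
  t `^ p @[t --> s] --> s `^ p.
Proof.
move=> s0; apply: (@cvg_trans _ (expR (p * ln t) @[t --> s])).
  apply: near_eq_cvg; near=> t.
  rewrite /powR gt_eqF//; near: t.
  exact: lt_nbhsr.
rewrite /powR gt_eqF//.
apply: (@cvg_comp _ _ _ (fun t : R => p * ln t) expR); last exact: continuous_expR.
by apply: cvgZr; exact: continuous_ln.
Unshelve. all: by end_near. Qed.

(** * Borel sets of R^n and the completed measure *)

Section borel.
Context (R : realType) (n : nat).
Local Notation m := (lebesgue_rV R n).

(* Open sets of R^n are countable unions of boxes with rational centres. *)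
Lemma open_measurable_rV (O : set 'rV[R]_n) : open O -> measurable O.
Proof.
move=> oO.
pose B (p : 'rV[rat]_n * nat) : set 'rV[R]_n :=
  [set x | forall i, `]ratr (p.1 ord0 i) - p.2.+1%:R^-1,
                       ratr (p.1 ord0 i) + p.2.+1%:R^-1[%classic (x ord0 i)].
have mB p : measurable (B p).
  apply: (@measurable_rV_box R n (fun i => `]ratr (p.1 ord0 i) - p.2.+1%:R^-1,
                       ratr (p.1 ord0 i) + p.2.+1%:R^-1[%classic)) => i.
  exact: measurable_itv.
rewrite (_ : O = \bigcup_p (if `[< B p `<=` O >] then B p else set0)).
  apply: countable_bigcupT_measurable; first exact: countableP.
  by move=> p; case: ifP.
apply/seteqP; split=> [x Ox|x [p _]]; last first.
  by case: ifPn => // /asboolP; exact.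
have /nbhs_ballP[e /= e0 xeO] : nbhs x O by exact: open_nbhs_nbhs.
have e2 : 0 < e / 2 by rewrite divr_gt0.
have [k _ /(_ k (leqnn k))/= ke] := near_infty_natSinv_lt (PosNum e2).
have dist2 (c y z t : R) : c - t < y < c + t -> z < c < z + t -> t < e / 2 ->
    `|z - y| < e.
  by move=> /andP[? ?] /andP[? ?] ?; rewrite ltr_norml; apply/andP; split; lra.
have near1 (c z t : R) : z < c < z + t -> c - t < z < c + t.
  by move=> /andP[? ?]; apply/andP; split; lra.
have /choice[q xq] : forall i, exists q : rat,
    ratr q \in `]x ord0 i, x ord0 i + k.+1%:R^-1[.
  by move=> i; apply: rat_in_itvoo; rewrite ltrDl invr_gt0.
exists (\row_i q i, k) => //.
rewrite asboolT; last first.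
  move=> y By; apply: xeO; split=> // i j; rewrite (_ : i = ord0) /ball/=; last exact: ord1.
  move: (By j) (xq j); rewrite /= !in_itv/= mxE => yq xqj.
  exact: dist2 yq xqj ke.
by move=> i; rewrite /= in_itv/= mxE near1//; exact: (xq i).
Qed.

Lemma completed_lebesgue_rVE (A : set 'rV[R]_n) : measurable A ->
  @completed_lebesgue_rV R n A = m A.
Proof. by move=> mA; rewrite /completed_lebesgue_rV /completed_measure_extension /= measurable_mu_extE. Qed.

Lemma measurable_lebesgue_space d (U : measurableType d) (f : 'rV[R]_n -> U) :
  measurable_fun setT f -> measurable_fun [set: lebesgue_space R n] (f : lebesgue_space R n -> U).
Proof.
move=> mf _ Y mY; rewrite setTI; apply: caratheodory_measurable_mu_ext.
by rewrite -[X in measurable X]setTI; exact: mf.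
Qed.

(** The identity from the completed space to the Borel space is measurable and pushes the completed
    measure forward to [m]. Once [u] is known to be Borel, everything takes place in [m], an
    iterated product to which Tonelli's theorem applies. *)
Lemma integral_completed_lebesgue_rV (D : set 'rV[R]_n) (f : 'rV[R]_n -> \bar R) :
  measurable D -> measurable_fun D f -> (forall x, D x -> 0 <= f x)%E ->
  (\int[@completed_lebesgue_rV R n]_(x in (D : set (lebesgue_space R n))) f x = \int[m]_(x in D) f x)%E.
Proof.
move=> mD mf f0.
have mid : measurable_fun [set: lebesgue_space R n] (id : lebesgue_space R n -> 'rV[R]_n).
  exact: measurable_lebesgue_space.
rewrite -[LHS](@ge0_integral_pushforward _ _ _ _ _ _ mid (@completed_lebesgue_rV R n) D f)//; last first.
  by move=> x /[!inE]; exact: f0.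
by apply: eq_measure_integral => A mA _; exact: completed_lebesgue_rVE.
Qed.

Lemma measurable_rV_set1 (x : 'rV[R]_n) : measurable [set x].
Proof.
rewrite (_ : [set x] = [set y | forall i, [set x ord0 i] (y ord0 i)]).
  exact: (@measurable_rV_box R n (fun i => [set x ord0 i])).
by apply/seteqP; split => [y ->//|y /= yx]; exact/rowP.
Qed.

Lemma lebesgue_rV_set1 (x : 'rV[R]_n) : (0 < n)%N -> m [set x] = 0%E.
Proof.
move=> n0; rewrite (_ : [set x] = [set y | forall i, [set x ord0 i] (y ord0 i)]).
  rewrite (@lebesgue_rV_box R n (fun i => [set x ord0 i]))//.
  rewrite (bigD1 (Ordinal n0))//= lebesgue_measure_set1 mul0e//.
apply/seteqP; split => [y ->//|y /= yx]; exact/rowP.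
Qed.

End borel.

Section kernel.
Context (R : realType) (n : nat).
Implicit Types x y : 'rV[R]_n.
Local Open Scope ereal_scope.

Lemma measurable_subl x : measurable_fun setT (fun y => x - y)%R.
Proof.
apply/measurable_fun_rVP => i.
rewrite (_ : _ \o _ = (fun y => x ord0 i - @rV_coor R n i y)%R); last first.
  by apply/funext => y; rewrite /rV_coor/= !mxE.
by apply: measurable_funB => //; exact: measurable_rV_coor.
Qed.

(* [riesz g x x = 0] for [g != 0], as [0 `^ p = 0] for [p != 0]. *)
Definition riesz (g : R) x y : R := (enorm (x - y) `^ (- g))%R.

Lemma riesz_ge0 g x y : (0 <= riesz g x y)%R.
Proof. exact: powR_ge0. Qed.

Lemma measurable_riesz g x : measurable_fun setT (riesz g x).
Proof.
apply: measurable_fun_powR_base.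
by apply: measurableT_comp; [exact: measurable_enorm|exact: measurable_subl].
Qed.

Lemma cvg_riesz g x y : x <> y -> riesz g z y @[z --> x] --> riesz g x y.
Proof.
move=> xy; rewrite /riesz.
have h0 : (0 < enorm (x - y))%R by rewrite enorm_gt0 subr_eq0; exact/eqP.
have ze : enorm (z - y) @[z --> x] --> enorm (x - y).
  exact: continuous_enorm_sub.
have EF : (fun z => (enorm (z - y) `^ (- g)))%R =
    (fun t : R => t `^ (- g))%R \o (fun z => enorm (z - y)) by [].
by rewrite EF; apply: (cvg_comp _ _ ze); exact: continuous_powR_gt0.
Qed.

Lemma cvg_riesz_EFin g x y : x <> y ->
  (riesz g z y)%:E @[z --> x] --> (riesz g x y)%:E.
Proof.
move=> xy; apply: (@cvg_comp _ _ _ (fun z => riesz g z y) EFin).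
  exact: cvg_riesz.
by apply: cvg_EFin => //; exact: nearW.
Qed.

(** Multiplication by [+oo] is not continuous; in that case the kernel is positive near [x], so the
    product is constantly [+oo] there. *)
Lemma cvg_mul_riesz (h : \bar R) g x y : 0 <= h -> x <> y ->
  h * (riesz g z y)%:E @[z --> x] --> h * (riesz g x y)%:E.
Proof.
move=> h0 xy; have [->|hy] := eqVneq h +oo; last first.
  apply: cvgeZl; first by rewrite ge0_fin_numE// ltey.
  exact: cvg_riesz_EFin.
have hz z : z <> y -> +oo * (riesz g z y)%:E = +oo.
  move=> zy; rewrite gt0_mulye// lte_fin powR_gt0// enorm_gt0 subr_eq0.
  exact/eqP.
have hx : (0 < enorm (x - y))%R by rewrite enorm_gt0 subr_eq0; exact/eqP.
have nz : \forall z \near x, (0 < enorm (z - y))%R.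
  exact: (cvgr_gt _ (@continuous_enorm_sub R n y x)).
rewrite (hz x)//; apply: (@cvg_near_cst _ _ +oo _ (nbhs x)).
by apply: filterS nz => z; rewrite enorm_gt0 subr_eq0 => /eqP/hz ->.
Qed.

End kernel.

(** * From the equation to a Borel, almost everywhere finite solution *)

Section reduction.
Context (R : realType) (n : nat) (alpha mu : R) (u : 'rV[R]_n -> \bar R).
Hypotheses (n0 : (0 < n)%N) (mu0 : 0 < mu).
Hypothesis su : positive_solution alpha mu u.
Local Notation m := (lebesgue_rV R n).
Local Notation g := (n%:R - alpha).
Local Open Scope ereal_scope.

Let F (x : 'rV[R]_n) (y : lebesgue_space R n) := u y `^ mu * (riesz g x y)%:E.

Let F0 x y : 0 <= F x y.
Proof. by rewrite mule_ge0 ?poweR_ge0// lee_fin riesz_ge0. Qed.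

Let mF x : measurable_fun setT (F x).
Proof.
have [mu_ _ _] := su.
apply: emeasurable_funM; first exact: measurable_fun_poweR.
apply: (@measurable_lebesgue_space R n _ _ (fun y => (riesz g x y)%:E)).
by apply/measurable_EFinP; exact: measurable_riesz.
Qed.

Let ae_neq x : {ae @completed_lebesgue_rV R n, forall y : lebesgue_space R n, x <> y}.
Proof.
exists [set x]; split.
- apply: caratheodory_measurable_mu_ext; exact: (@measurable_rV_set1 R n x).
- rewrite [LHS]completed_lebesgue_rVE; first exact: lebesgue_rV_set1.
  exact: measurable_rV_set1.
- by move=> y /contrapT ->.
Qed.

(** Quotient and product agree except possibly at [y = x], and a point is null because [0 < n]. *)
Let uE x : u x = \int[@completed_lebesgue_rV R n]_y F x y.
Proof.
have [mu_ _ ->] := su.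
apply: ge0_ae_eq_integral;
  [exact: measurableT| |exact: mF| |by move=> y _; exact: F0|].
- apply: emeasurable_funM; first exact: measurable_fun_poweR.
  apply: (@measurable_lebesgue_space R n _ _ (fun y => (enorm (x - y) `^ g)%:E^-1)).
  rewrite (_ : (fun y => _) = (fun y => if (enorm (x - y) `^ g == 0)%R
    then +oo else (riesz g x y)%:E)).
    apply: measurable_fun_ifT; [|exact: measurable_cst|apply/measurable_EFinP; exact: measurable_riesz].
    apply: measurable_fun_eqr; last exact: measurable_cst.
    apply: measurable_fun_powR_base.
    by apply: measurableT_comp; [exact: measurable_enorm|exact: measurable_subl].
  apply/funext => y; rewrite inver; case: ifPn => // _.
  by rewrite /riesz powRN.
- by move=> y _; rewrite mule_ge0 ?poweR_ge0// inve_ge0 lee_fin powR_ge0.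
apply: filterS (ae_neq x) => y xy _.
rewrite /F /riesz powRN inver powR_eq0 enorm_eq0 subr_eq0.
by case: eqP.
Qed.

Lemma solution_lsc : lower_semicontinuous u.
Proof.
rewrite (_ : u = (fun x => \int[@completed_lebesgue_rV R n]_y F x y)); last exact/funext/uE.
apply: lower_semicontinuous_integral => // x.
apply: filterS (ae_neq x) => y xy.
by apply: cvg_mul_riesz => //; exact: poweR_ge0.
Qed.

Lemma solution_measurable : measurable_fun setT u.
Proof.
apply: (measurability _ (ErealGenOInfty.measurableE R)).
move=> /= _ [_ [a ->]] <-; apply: measurableI => //; apply: open_measurable_rV.
by rewrite preimage_itvoy; move/lower_semicontinuousP : solution_lsc; exact.
Qed.

Let mFr x : measurable_fun [set: 'rV[R]_n] (F x).
Proof.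
apply: emeasurable_funM; last by apply/measurable_EFinP; exact: measurable_riesz.
exact: (measurable_fun_poweR _ solution_measurable).
Qed.

Let uEr x : u x = \int[m]_y F x y.
Proof.
by rewrite uE; exact: (integral_completed_lebesgue_rV measurableT).
Qed.

(** The integrand at [x0] is integrable, hence finite almost everywhere; off [x0] the kernel is
    positive, so a value [u y = +oo] would make the integrand infinite. *)
Lemma solution_ae_fin x0 : u x0 < +oo -> {ae m, forall y, u y \is a fin_num}.
Proof.
move=> ux0.
have iF : m.-integrable setT (F x0).
  apply/integrableP; split=> //.
  by under eq_integral do rewrite gee0_abs//; rewrite -uEr.
have := integrable_ae measurableT iF.
have : {ae m, forall y, x0 <> y}.
  exists [set x0]; split; [exact: measurable_rV_set1|exact: lebesgue_rV_set1|].
  by move=> y /contrapT ->.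
apply: filterS2 => y xy /(_ Logic.I).
have [_ u0 _] := su.
rewrite ge0_fin_numE// => Fy; rewrite ge0_fin_numE; last exact/ltW.
apply: (@lty_poweRy _ _ mu); first by rewrite gt_eqF.
rewrite ltey; apply/eqP => uy; move: Fy; rewrite /F uy gt0_mulye// lte_fin.
rewrite powR_gt0// enorm_gt0 subr_eq0; exact/eqP.
Qed.

Lemma solutionE x0 : u x0 < +oo ->
  forall x, u x = \int[m]_y (fine (u y) `^ mu * riesz g x y)%:E.
Proof.
move=> /solution_ae_fin ufin x; rewrite uEr.
apply: ge0_ae_eq_integral => //.
- apply/measurable_EFinP; apply: measurable_funM; last exact: measurable_riesz.
  apply: measurable_fun_powR_base.
  exact: (measurableT_comp (fine_measurable measurableT) solution_measurable).
- by move=> y _; rewrite lee_fin mulr_ge0// ?powR_ge0// riesz_ge0.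
by apply: filterS ufin => y uy _; rewrite /F -[in LHS](fineK uy).
Qed.

End reduction.

(** * Dilations, polar coordinates and inversion *)

Section affine.
Context (R : realType).
Local Notation leb := (@lebesgue_measure R).
Local Open Scope ereal_scope.

Let measurable_affine (s c : R) :
  measurable_fun setT (fun x : measurableTypeR R => s * x + c : measurableTypeR R)%R.
Proof.
by apply: measurable_funD; [apply: measurable_funM|].
Qed.

(** By uniqueness of Lebesgue measure: [s] times the pushforward along the affine map gives each
    half-open interval its length. *)
Lemma ge0_integral_affine (s c : R) (f : R -> \bar R) : (0 < s)%R ->
  measurable_fun setT f -> (forall x, 0 <= f x) ->
  \int[leb]_x f (s * x + c)%R = (s^-1)%:E * \int[leb]_x f x.
Proof.
move=> s0 mf f0.
have snng : (0 <= s)%R by exact: ltW.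
rewrite [in RHS](@eq_measure_integral _ _ _ _ (mscale (NngNum snng)
  (pushforward leb (fun x : measurableTypeR R => s * x + c : measurableTypeR R)%R)) leb); last first.
  move=> A mA _; apply: lebesgue_measure_unique => //= X [[a b] _ <-].
  rewrite /mscale/= /pushforward.
  rewrite (_ : _ @^-1` _ = `]((a - c) / s)%R, ((b - c) / s)%R]%classic); last first.
    apply/seteqP; split=> x /=; rewrite !in_itv/= => /andP[? ?]; apply/andP; split.
    - by rewrite ltr_pdivrMr// mulrC ltrBlDr.
    - by rewrite ler_pdivlMr// mulrC lerBrDr.
    - by rewrite -ltrBlDr mulrC -ltr_pdivrMr.
    - by rewrite -lerBrDr mulrC -ler_pdivlMr.
  rewrite !lebesgue_measure_itv/= !lte_fin ltr_pM2r ?invr_gt0// ltrD2r.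
  case: ifPn => _; last by rewrite mule0.
  rewrite -!EFinD -EFinM; congr EFin; by field; rewrite gt_eqF.
have ma := measurable_affine s c.
rewrite ge0_integral_mscale//= (ge0_integral_pushforward ma)// preimage_setT.
by rewrite muleA -EFinM mulVf ?gt_eqF// mul1e.
Qed.

Lemma ge0_integral_opp (f : R -> \bar R) :
  measurable_fun setT f -> (forall x, 0 <= f x) ->
  \int[leb]_x f (- x)%R = \int[leb]_x f x.
Proof.
move=> mf f0.
rewrite -[in RHS](@eq_measure_integral _ _ _ _ _
  (pushforward leb (-%R : _ -> measurableTypeR R))).
  by rewrite ge0_integral_pushforward.
by move=> A mA _; exact: lebesgue_measureN.
Qed.

End affine.

Section scale.
Context (R : realType).
Local Notation leb := (@lebesgue_measure R).
Local Open Scope ereal_scope.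

Lemma ge0_integral_rVS n (f : 'rV[R]_n.+1 -> \bar R) :
  measurable_fun setT f -> (forall x, 0 <= f x) ->
  \int[lebesgue_rV R n.+1]_x f x =
  \int[leb]_a \int[lebesgue_rV R n]_y f (cons_rV (a, y)).
Proof.
move=> mf f0.
rewrite -[LHS]/(\int[pushforward (leb \x lebesgue_rV R n)%E (@cons_rV R n)]_x f x).
have mc := @measurable_cons_rV R n.
rewrite ge0_integral_pushforward// preimage_setT.
rewrite (fubini_tonelli1 (f \o @cons_rV R n))//.
  exact: measurableT_comp mf mc.
by move=> x; exact: f0.
Qed.

Lemma measurable_scale_rV n (s : R) : measurable_fun setT (fun x : 'rV[R]_n => s *: x)%R.
Proof.
apply/measurable_fun_rVP => i.
rewrite (_ : _ \o _ = (fun y => s * @rV_coor R n i y)%R); last first.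
  by apply/funext => y; rewrite /rV_coor/= !mxE.
by apply: measurable_funM => //; exact: measurable_rV_coor.
Qed.

Lemma ge0_integral_scale n (s : R) (f : 'rV[R]_n -> \bar R) : (0 < s)%R ->
  measurable_fun setT f -> (forall x, 0 <= f x) ->
  \int[lebesgue_rV R n]_x f (s *: x)%R =
  (s^-1 ^+ n)%:E * \int[lebesgue_rV R n]_x f x.
Proof.
move=> s0; elim: n f => [|n IHn] f mf f0.
  rewrite expr0 mul1e; apply: eq_integral => x _.
  by rewrite (_ : (s *: x = x)%R)//; apply/rowP => -[].
have mfs : measurable_fun setT (fun x : 'rV_n.+1 => f (s *: x)%R).
  exact: measurableT_comp mf (@measurable_scale_rV n.+1 s).
rewrite !ge0_integral_rVS//.
have mfc := measurableT_comp mf (@measurable_cons_rV R n).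
have cE a (y : 'rV[R]_n) : (s *: cons_rV (a, y) = cons_rV (s * a, s *: y))%R.
  apply/rowP => i; rewrite mxE; have [j ->|->] := unliftP ord0 i.
    by rewrite !cons_rVS mxE.
  by rewrite !cons_rV0.
pose G (a : R) := \int[lebesgue_rV R n]_y f (cons_rV (a, y)).
have mG : measurable_fun setT G.
  exact: (measurable_fun_fubini_tonelli_F (f \o @cons_rV R n) mfc (fun x => f0 _)).
have G0 a : 0 <= G a by exact: integral_ge0.
transitivity (\int[leb]_a ((s^-1 ^+ n)%:E * G (s * a + 0)%R)).
  apply: eq_integral => a _; rewrite addr0 /G.
  rewrite -(IHn (fun y => f (cons_rV (s * a, y)%R))); last 2 first.
  - exact: (measurableT_comp mfc (pair1_measurable _)).
  - by [].
  by apply: eq_integral => y _; rewrite cE.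
rewrite ge0_integralZl.
- by rewrite ge0_integral_affine// muleA -EFinM -exprSr.
- exact: measurableT.
- apply: (measurableT_comp mG); exact: measurable_funD.
- by [].
- by rewrite lee_fin exprn_ge0// invr_ge0 ltW.
Qed.

End scale.

(** * Integration along rays, and inversion *)

Section polar.
Context (R : realType) (n : nat).
Hypothesis n0 : (0 < n)%N.
Local Notation leb := (@lebesgue_measure R).
Local Notation m := (lebesgue_rV R n).
Implicit Types x y : 'rV[R]_n.
Local Open Scope ereal_scope.

Let w x : R := (enorm x `^ (- n%:R))%R.

Let w0 x : (0 <= w x)%R. Proof. exact: powR_ge0. Qed.

Let wE0 : w 0%R = 0%R.
Proof.
rewrite /w (_ : enorm 0 = 0%R); last by apply/eqP; rewrite enorm_eq0.
by rewrite powR0// oppr_eq0 pnatr_eq0 -lt0n.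
Qed.

Let mw : measurable_fun setT w.
Proof. exact: (measurable_fun_powR_base _ (@measurable_enorm R n)). Qed.

Let wZ (s : R) x : (0 < s)%R -> w (s *: x)%R = (s^-1 ^+ n * w x)%R.
Proof.
move=> s0; rewrite /w enormZ gtr0_norm// powRM ?enorm_ge0//; last exact: ltW.
by rewrite powRN powR_mulrn ?exprVn// ltW.
Qed.

(** The weight [w] is homogeneous of degree [-n], which cancels the factor [s^-n] of the change of
    variables. *)
Lemma ge0_integral_scale_invariant (s : R) (f : 'rV[R]_n -> \bar R) : (0 < s)%R ->
  measurable_fun setT f -> (forall x, 0 <= f x) ->
  \int[m]_x (f (s *: x)%R * (w x)%:E) = \int[m]_x (f x * (w x)%:E).
Proof.
move=> s0 mf f0.
have sn0 : (0 < s^-1 ^+ n)%R by rewrite exprn_gt0// invr_gt0.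
have mfw : measurable_fun setT (fun x => f x * (w x)%:E).
  by apply: emeasurable_funM => //; apply/measurable_EFinP.
have := @ge0_integral_scale R n s (fun x => f x * (w x)%:E) s0 mfw.
move=> /(_ (fun x => mule_ge0 (f0 x) _))H.
have {}H : \int[m]_x (f (s *: x)%R * (w (s *: x)%R)%:E) =
    (s^-1 ^+ n)%:E * \int[m]_x (f x * (w x)%:E).
  by apply: H => x; rewrite lee_fin.
have {H} : (s^-1 ^+ n)%:E * \int[m]_x (f (s *: x)%R * (w x)%:E) =
    (s^-1 ^+ n)%:E * \int[m]_x (f x * (w x)%:E).
  rewrite -H -ge0_integralZl//.
  - by apply: eq_integral => x _; rewrite wZ// EFinM muleCA.
  - apply: emeasurable_funM; last by apply/measurable_EFinP.
    exact: (measurableT_comp mf (@measurable_scale_rV _ n s)).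
  - by move=> x _; rewrite mule_ge0// lee_fin.
  - by rewrite lee_fin ltW.
move=> /(congr1 (fun z => ((s^-1 ^+ n)^-1)%:E * z)).
by rewrite !muleA -EFinM mulVf ?gt_eqF// !mul1e.
Qed.

Let phi (t : R) : R := \1_(`[0%R, 1%R[ : set R) t.

Let mphi : measurable_fun setT phi.
Proof. exact: measurable_indic. Qed.

Let phi0 t : (0 <= phi t)%R. Proof. by rewrite /phi indicE. Qed.

Let int_phi (c : R) : \int[leb]_t (phi (c + t))%:E = 1.
Proof.
have := @ge0_integral_affine R 1 c (fun t => (phi t)%:E) ltr01.
rewrite invr1 mul1e => H.
transitivity (\int[leb]_t (phi t)%:E).
  rewrite -H//; last by apply/measurable_EFinP.
  by apply: eq_integral => t _; rewrite mul1r addrC.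
transitivity (leb (`[0%R, 1%R[%classic `&` setT)).
  by rewrite -integral_indic.
rewrite setIT lebesgue_measure_itv/= lte_fin ltr01.
by rewrite oppr0 adde0.
Qed.

Lemma measurable_scale_rV2 :
  measurable_fun setT (fun z : 'rV[R]_n * measurableTypeR R => expR (- z.2) *: z.1)%R.
Proof.
apply/measurable_fun_rVP => i.
rewrite (_ : _ \o _ = (fun z => expR (- z.2) * (@rV_coor R n i \o fst) z)%R); last first.
  by apply/funext => y; rewrite /rV_coor/= !mxE.
apply: measurable_funM.
  apply: (measurableT_comp (f := fun t : R => expR (- t)) _ measurable_snd).
  exact: (measurableT_comp (@measurable_expR R) (@oppr_measurable R setT)).
exact: (measurableT_comp (@measurable_rV_coor R n i) measurable_fst).
Qed.

(* The radial average of [f] along rays; [w x] dx is invariant under dilations. *)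
Lemma ge0_integral_polar (f : 'rV[R]_n -> \bar R) :
  measurable_fun setT f -> (forall x, 0 <= f x) ->
  \int[m]_x (f x * (w x)%:E) =
  \int[m]_x ((phi (ln (enorm x)) * w x)%:E * \int[leb]_t f (expR (- t) *: x)%R).
Proof.
move=> mf f0.
have mln : measurable_fun setT (fun x : 'rV[R]_n => ln (enorm x)).
  exact: (measurableT_comp (@measurable_ln R) (@measurable_enorm R n)).
(* [H] inserts the factor [1 = \int phi (ln |x| + t) dt]. After exchanging the integrals, the
   dilation of [x] by [exp (- t)] removes [t] from [phi] and moves it into [f], which gives [K].
   Only the shell [1 <= |x| < e] then remains in the outer integral. *)
pose H (z : 'rV[R]_n * measurableTypeR R) :=
  f z.1 * (w z.1)%:E * (phi (ln (enorm z.1) + z.2))%:E.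
pose K (z : 'rV[R]_n * measurableTypeR R) :=
  f (expR (- z.2) *: z.1)%R * (w z.1)%:E * (phi (ln (enorm z.1)))%:E.
have H0 z : 0 <= H z by rewrite !mule_ge0// lee_fin.
have K0 z : 0 <= K z by rewrite !mule_ge0// lee_fin.
have mH : measurable_fun setT H.
  apply: emeasurable_funM; first apply: emeasurable_funM.
  - exact: (measurableT_comp mf measurable_fst).
  - by apply/measurable_EFinP; exact: (measurableT_comp mw measurable_fst).
  - apply/measurable_EFinP; apply: (measurableT_comp mphi).
    apply: measurable_funD; last exact: measurable_snd.
    exact: (measurableT_comp mln measurable_fst).
have mK : measurable_fun setT K.
  apply: emeasurable_funM; first apply: emeasurable_funM.
  - exact: (measurableT_comp mf measurable_scale_rV2).
  - by apply/measurable_EFinP; exact: (measurableT_comp mw measurable_fst).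
  - apply/measurable_EFinP; apply: (measurableT_comp mphi).
    exact: (measurableT_comp mln measurable_fst).
transitivity (\int[m]_x \int[leb]_t H (x, t)).
  apply: eq_integral => x _; rewrite /H/= ge0_integralZl//.
  - by rewrite int_phi mule1.
  - apply/measurable_EFinP; apply: (measurableT_comp mphi).
    exact: measurable_funD.
  - by move=> t _; rewrite lee_fin.
  - by rewrite mule_ge0// lee_fin.
transitivity (\int[leb]_t \int[m]_x H (x, t)).
  exact: (fubini_tonelli H).
transitivity (\int[leb]_t \int[m]_x K (x, t)).
  apply: eq_integral => t _.
  have mHt : measurable_fun setT (fun x => f x * (phi (ln (enorm x) + t))%:E).
    apply: emeasurable_funM => //; apply/measurable_EFinP.
    by apply: (measurableT_comp mphi); exact: measurable_funD.
  transitivity (\int[m]_x (f x * (phi (ln (enorm x) + t))%:E * (w x)%:E)).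
    by apply: eq_integral => x _; rewrite /H/= muleAC.
  rewrite -(@ge0_integral_scale_invariant (expR (- t)))//.
  - apply: eq_integral => x _; rewrite /K/= muleAC.
    have [->|x0] := eqVneq x 0%R; first by rewrite wE0 !mule0 !mul0e.
    congr (_ * (phi _)%:E).
    rewrite enormZ gtr0_norm ?expR_gt0// lnM ?posrE ?expR_gt0 ?enorm_gt0//.
    by rewrite expRK; ring.
  - exact: expR_gt0.
  - by move=> x; rewrite mule_ge0// lee_fin.
transitivity (\int[m]_x \int[leb]_t K (x, t)).
  exact/esym/(fubini_tonelli K).
apply: eq_integral => x _; rewrite /K/=.
rewrite -ge0_integralZl//.
- by apply: eq_integral => t _; rewrite EFinM -muleA [RHS]muleC (muleC (w x)%:E).
- exact: (measurableT_comp mf (measurableT_comp measurable_scale_rV2 (pair1_measurable _))).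
- by rewrite lee_fin mulr_ge0.
Qed.

Definition inversion (l : R) y : 'rV[R]_n := ((l ^+ 2 / enorm y ^+ 2) *: y)%R.

Lemma measurable_inversion l : measurable_fun setT (inversion l).
Proof.
apply/measurable_fun_rVP => i.
rewrite (_ : _ \o _ = (fun y => l ^+ 2 * (enorm y) `^ (- 2%:R) * @rV_coor R n i y)%R); last first.
  apply/funext => y; rewrite /rV_coor/= !mxE powRN powR_mulrn//; exact: enorm_ge0.
apply: measurable_funM; last exact: measurable_rV_coor.
apply: measurable_funM => //.
exact: (measurable_fun_powR_base _ (@measurable_enorm R n)).
Qed.

(** On the ray of points [exp (- t) x], inversion is the map [t -> - t - ln (l^2 / |x|^2)], which
    preserves Lebesgue measure on the line; the ray averages of both sides therefore agree. *)
Lemma ge0_integral_inversion (l : R) (f : 'rV[R]_n -> \bar R) : (0 < l)%R ->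
  measurable_fun setT f -> (forall x, 0 <= f x) ->
  \int[m]_x (f (inversion l x) * (enorm x `^ (- n%:R))%:E) =
  \int[m]_x (f x * (enorm x `^ (- n%:R))%:E).
Proof.
move=> l0 mf f0.
rewrite (ge0_integral_polar (measurableT_comp mf (measurable_inversion l)))//=.
rewrite (ge0_integral_polar mf f0).
apply: eq_integral => x _.
have [->|x0] := eqVneq x 0%R; first by rewrite wE0 mulr0 !mul0e.
congr (_ * _).
have e0 : (0 < enorm x)%R by rewrite enorm_gt0.
have c0 : (0 < l ^+ 2 / enorm x ^+ 2)%R by rewrite divr_gt0 ?exprn_gt0.
pose h (t : R) := f (expR (- t) *: x)%R.
have mh : measurable_fun setT h.
  exact: (measurableT_comp mf (measurableT_comp measurable_scale_rV2 (pair1_measurable _))).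
have h0 t : 0 <= h t by exact: f0.
transitivity (\int[leb]_t h (- t - ln (l ^+ 2 / enorm x ^+ 2))%R).
  apply: eq_integral => t _; rewrite /h /inversion; congr f.
  rewrite scalerA; congr (_ *: _)%R.
  rewrite opprB opprK expRD lnK// enormZ gtr0_norm ?expR_gt0//.
  rewrite expRN; field.
  by rewrite !gt_eqF ?expR_gt0.
rewrite (@ge0_integral_opp _ (fun t => h (t - ln (l ^+ 2 / enorm x ^+ 2))%R))//.
  have := @ge0_integral_affine R 1 (- ln (l ^+ 2 / enorm x ^+ 2)) h ltr01 mh h0.
  rewrite invr1 mul1e => <-; apply: eq_integral => t _; by rewrite mul1r.
apply: (measurableT_comp mh); exact: measurable_funB.
Qed.

(** Each ray meets the sphere for a single [t], so all ray integrals of its indicator vanish; on the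
    sphere the weight [w] is the positive constant [r^-n]. *)
Lemma lebesgue_rV_sphere (r : R) : (0 < r)%R -> m [set x | enorm x = r] = 0.
Proof.
move=> r0.
have mS : measurable [set x : 'rV[R]_n | enorm x = r].
  rewrite -[X in measurable X]setTI.
  exact: (@measurable_enorm R n measurableT [set r] (measurable_set1 r)).
have rn0 : (0 < r `^ (- n%:R))%R by rewrite powR_gt0.
pose f x : \bar R := (\1_[set x : 'rV[R]_n | enorm x = r] x)%:E.
have mf : measurable_fun setT f by apply/measurable_EFinP; exact: measurable_indic.
have f0 x : 0 <= f x by rewrite lee_fin indicE.
have : \int[m]_x (f x * (w x)%:E) = 0.
  rewrite ge0_integral_polar//.
  apply: integral0_eq => x _.
  have [->|x0] := eqVneq x 0%R; first by rewrite wE0 mulr0 mul0e.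
  have e0 : (0 < enorm x)%R by rewrite enorm_gt0.
  rewrite (@ge0_ae_eq_integral _ _ _ _ _ _ (cst 0))//.
  - by rewrite integral0 mule0.
  - exact: (measurableT_comp mf (measurableT_comp measurable_scale_rV2 (pair1_measurable _))).
  exists [set ln (enorm x / r)]; split => //; first exact: lebesgue_measure_set1.
  move=> t /= ft; apply: contrapT => tx; apply: ft => _.
  rewrite /f indicE memNset//= enormZ gtr0_norm ?expR_gt0// => ex.
  apply: tx; rewrite -ex invfM mulrCA divff ?gt_eqF// mulr1 -expRN opprK.
  by rewrite expRK.
have -> : \int[m]_x (f x * (w x)%:E) = \int[m]_x ((r `^ (- n%:R))%:E * f x).
  apply: eq_integral => x _; rewrite /f /w indicE muleC.
  have [/[!inE] /= ->//|_] := boolP (x \in _).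
  by rewrite !mule0.
rewrite ge0_integralZl//; last by rewrite lee_fin ltW.
rewrite /f integral_indic// setIT => /eqP.
rewrite mule_eq0 eqe gt_eqF//= => /eqP; exact.
Qed.

End polar.

Section translation.
Context (R : realType).
Local Notation leb := (@lebesgue_measure R).
Local Open Scope ereal_scope.

Lemma ge0_integral_subl k (x : 'rV[R]_k) (f : 'rV[R]_k -> \bar R) :
  measurable_fun setT f -> (forall y, 0 <= f y) ->
  \int[lebesgue_rV R k]_y f (x - y)%R = \int[lebesgue_rV R k]_y f y.
Proof.
elim: k x f => [|k IHk] x f mf f0.
  by apply: eq_integral => y _; congr f; apply/rowP => -[].
have mfs : measurable_fun setT (fun y : 'rV_k.+1 => f (x - y)%R).
  exact: (measurableT_comp mf (measurable_subl x)).
rewrite !ge0_integral_rVS//.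
have mfc := measurableT_comp mf (@measurable_cons_rV R k).
pose x' : 'rV[R]_k := \row_i x ord0 (lift ord0 i).
have cE a (y : 'rV[R]_k) : (x - cons_rV (a, y) = cons_rV (x ord0 ord0 - a, x' - y))%R.
  have subE l (M N : 'rV[R]_l) i : ((M - N) ord0 i = M ord0 i - N ord0 i)%R.
    by rewrite !mxE.
  apply/rowP => i; rewrite subE; have [j ->|->] := unliftP ord0 i.
    by rewrite !cons_rVS subE mxE.
  by rewrite !cons_rV0.
pose G (a : R) := \int[lebesgue_rV R k]_y f (cons_rV (a, y)).
have mG : measurable_fun setT G.
  exact: (measurable_fun_fubini_tonelli_F (f \o @cons_rV R k) mfc (fun z => f0 _)).
have G0 a : 0 <= G a by exact: integral_ge0.
transitivity (\int[leb]_a (G (- a + x ord0 ord0)%R)).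
  apply: eq_integral => a _; rewrite /G addrC.
  rewrite -(IHk x' (fun y => f (cons_rV (x ord0 ord0 - a, y)%R))); last 2 first.
  - exact: (measurableT_comp mfc (pair1_measurable _)).
  - by [].
  by apply: eq_integral => y _; rewrite cE.
rewrite (@ge0_integral_opp _ (fun a => G (a + x ord0 ord0)%R)); last 2 first.
- by apply: (measurableT_comp mG); exact: measurable_funD.
- by move=> a; exact: G0.
have := @ge0_integral_affine R 1 (x ord0 ord0) G ltr01 mG G0.
rewrite invr1 mul1e => <-; apply: eq_integral => a _; by rewrite mul1r.
Qed.

End translation.

Section cube.
Context (R : realType) (n : nat).
Implicit Types x y : 'rV[R]_n.

(** Cubes replace balls throughout the mass estimates: their measure follows from the box formula,
    and the Euclidean norm differs from the sup norm by a factor [sqrt n] at most. *)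
Definition cube (r : R) : set 'rV[R]_n :=
  [set x | forall i, `[(- r), r]%classic (x ord0 i)].

Lemma cubeP (r : R) x : cube r x <-> forall i, (`|x ord0 i| <= r).
Proof.
by split=> xr i; have := xr i; rewrite /= in_itv/= ler_norml.
Qed.

Lemma sub_cube (r s : R) : (r <= s) -> cube r `<=` cube s.
Proof. by move=> rs x /cubeP xr; apply/cubeP => i; exact: le_trans (xr i) rs. Qed.

Lemma cube_dist (r s : R) x y : (0 <= r) -> (0 <= s) -> cube r x -> cube s y ->
  (enorm (x - y) <= Num.sqrt n%:R * (r + s)).
Proof.
move=> r0 s0 /cubeP xr /cubeP ys; apply: enorm_le; first exact: addr_ge0.
move=> i; rewrite !mxE; apply: le_trans (ler_normB _ _) _; exact: lerD.
Qed.

Local Open Scope ereal_scope.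

Lemma lebesgue_rV_cube (r : R) : (0 <= r)%R ->
  lebesgue_rV R n (cube r) = ((2 * r) ^+ n)%:E.
Proof.
move=> r0; rewrite /cube (@lebesgue_rV_box R n (fun=> `[(- r)%R, r]%classic))//.
under eq_bigr => i _.
  rewrite lebesgue_measure_itv/= lte_fin.
  rewrite (_ : (if _ then _ else _) = (2 * r)%:E); last first.
    case: ltP => [_|]; first by rewrite -EFinB; congr EFin; ring.
    move=> rr; have -> : r = 0%R by apply/eqP; rewrite eq_le r0 andbT; lra.
    by rewrite mulr0.
  over.
by rewrite prodEFin prodr_const card_ord.
Qed.

Lemma measurable_cube (r : R) :
  measurable (cube r : set 'rV[R]_n).
Proof. exact: (@measurable_rV_box R n (fun=> `[(- r)%R, r]%classic)). Qed.

End cube.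

(** * Radial integrals *)

Section radial.
Context (R : realType) (n : nat).
Hypothesis n0 : (0 < n)%N.
Local Notation leb := (@lebesgue_measure R).
Local Notation m := (lebesgue_rV R n).
Implicit Types x y : 'rV[R]_n.
Local Open Scope ereal_scope.

(* [c] is the area of the unit sphere. *)
Lemma ge0_integral_radial : exists2 c : R, (0 <= c)%R &
  forall psi : R -> R, measurable_fun setT psi -> (forall t, 0 <= psi t)%R ->
  \int[m]_x (psi (ln (enorm x)) * enorm x `^ (- n%:R))%:E =
  c%:E * \int[leb]_t (psi t)%:E.
Proof.
pose F (x : 'rV[R]_n) := ((\1_(`[0%R, 1%R[ : set R) (ln (enorm x)) : R) * enorm x `^ (- n%:R))%R.
have mln : measurable_fun setT (fun x : 'rV[R]_n => ln (enorm x)).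
  exact: (measurableT_comp (@measurable_ln R) (@measurable_enorm R n)).
have mF : measurable_fun setT F.
  apply: measurable_funM; first exact: (measurableT_comp (@measurable_indic _ _ _ _ _ (measurable_itv _)) mln).
  exact: (measurable_fun_powR_base _ (@measurable_enorm R n)).
have F0 x : (0 <= F x)%R by rewrite mulr_ge0// ?powR_ge0// indicE.
pose E : set 'rV[R]_n := cube (expR 1).
have mE : measurable E by exact: measurable_cube.
have Ffin : \int[m]_x (F x)%:E < +oo.
  apply: (@le_lt_trans _ _ (\int[m]_x (\1_E x)%:E)).
    apply: ge0_le_integral => //.
    - by move=> x _; rewrite lee_fin.
    - exact/measurable_EFinP.
    - by apply/measurable_EFinP; exact: measurable_indic.
    move=> x _; rewrite lee_fin /F indicE.
    case: (boolP (_ \in _)) => [|_]; last by rewrite mul0r indicE.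
    rewrite inE/= in_itv/= mul1r => /andP[l0 l1].
    (* The origin passes the test [ln |x| \in [0, 1[] since [ln 0 = 0], but its weight is [0].
       Elsewhere the test means [1 <= |x| < e], so the integrand is at most [1] and is supported in
       [E]; this makes the constant finite. *)
    have [x0|x0] := eqVneq (enorm x) 0%R.
      by rewrite x0 powR0 ?indicE// oppr_eq0 pnatr_eq0 -lt0n.
    have {}x0 : (0 < enorm x)%R by rewrite lt_def x0 enorm_ge0.
    have x1 : (1 <= enorm x)%R by rewrite -(lnK x0) -[leLHS]expR0 ler_expR.
    have xe : (enorm x <= expR 1)%R by rewrite -[leLHS](lnK x0) ler_expR ltW.
    rewrite indicE mem_set; last first.
      by apply/cubeP => i; exact: le_trans (enorm_coord x i) xe.
    rewrite powRN invf_le1 ?powR_gt0//.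
    by rewrite powR_mulrn ?enorm_ge0// exprn_ege1.
  have -> : \int[m]_x (\1_E x)%:E = m (E `&` setT) by rewrite -integral_indic.
  by rewrite setIT lebesgue_rV_cube ?expR_ge0// ltry.
have Fint0 : 0 <= \int[m]_x (F x)%:E by apply: integral_ge0 => x _; rewrite lee_fin.
exists (fine (\int[m]_x (F x)%:E)); first exact: fine_ge0.
move=> psi mpsi psi0.
rewrite fineK ?ge0_fin_numE//.
have mf : measurable_fun setT (fun x : 'rV[R]_n => (psi (ln (enorm x)))%:E).
  by apply/measurable_EFinP; exact: (measurableT_comp mpsi mln).
under eq_integral do rewrite EFinM.
rewrite (ge0_integral_polar n0 mf); last by move=> x; rewrite lee_fin.
rewrite -ge0_integralZr//; last 3 first.
- exact/measurable_EFinP.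
- by move=> x _; rewrite lee_fin.
- by apply: integral_ge0 => t _; rewrite lee_fin.
apply: eq_integral => x _; rewrite -/(F x).
have [x0|x0] := eqVneq x 0%R.
  rewrite /F x0 (_ : enorm 0 = 0%R); last by apply/eqP; rewrite enorm_eq0.
  by rewrite powR0 ?mulr0 ?mul0e// oppr_eq0 pnatr_eq0 -lt0n.
congr (_ * _).
pose c := ln (enorm x).
transitivity (\int[leb]_t (psi (- t + c)%R)%:E).
  apply: eq_integral => t _; rewrite enormZ gtr0_norm ?expR_gt0//.
  by rewrite lnM ?posrE ?expR_gt0 ?enorm_gt0// expRK.
rewrite (@ge0_integral_opp _ (fun t => (psi (t + c))%:E)); last 2 first.
- apply/measurable_EFinP; apply: (measurableT_comp mpsi).
  exact: measurable_funD.
- by move=> t; rewrite lee_fin.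
have := @ge0_integral_affine R 1 c (fun t => (psi t)%:E) ltr01.
rewrite invr1 mul1e => <-; last 2 first.
- exact/measurable_EFinP.
- by move=> t; rewrite lee_fin.
by apply: eq_integral => t _; rewrite mul1r.
Qed.

Lemma measurable_expR_norm (b : R) :
  measurable_fun setT (fun t : R => expR (- (b * `|t|))).
Proof.
apply: (measurableT_comp (@measurable_expR R)).
apply: (measurableT_comp (@oppr_measurable R setT)).
by apply: measurable_funM => //; exact: measurable_normr.
Qed.

Lemma measurable_fun_expR_norm d (T : measurableType d) (f : T -> R) (b : R) :
  measurable_fun setT f -> measurable_fun setT (fun t => expR (- (b * `|f t|))).
Proof. exact: (measurableT_comp (measurable_expR_norm b)). Qed.

(** The integrand is dominated by [b^-1] times the sum of the exponential density of rate [b] and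
    its reflection, each of integral [1]. *)
Lemma integral_expR_norm (b : R) : (0 < b)%R ->
  \int[leb]_t (expR (- (b * `|t|)))%:E < +oo.
Proof.
move=> b0.
pose p : R -> R := exponential_pdf b.
have mp : measurable_fun setT p by exact: measurable_exponential_pdf.
have p0 t : (0 <= p t)%R by apply: exponential_pdf_ge0; exact: ltW.
have mpN : measurable_fun setT (fun t : R => p (- t)%R).
  exact: (measurableT_comp mp (@oppr_measurable R setT)).
apply: (@le_lt_trans _ _ (\int[leb]_t ((b^-1)%:E * ((p t)%:E + (p (- t)%R)%:E)))).
  apply: ge0_le_integral => //.
  - by apply/measurable_EFinP; exact: measurable_expR_norm.
  - by apply: measurable_funeM; apply: emeasurable_funD; apply/measurable_EFinP.
  move=> t _; rewrite -EFinD -EFinM lee_fin.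
  have pE s : (0 <= s)%R -> (expR (- (b * s)) = b^-1 * p s)%R.
    move=> s0; rewrite /p exponential_pdfE// mulrA mulVf ?gt_eqF//.
    by rewrite mul1r mulNr.
  rewrite mulrDr; have [t0|t0] := leP 0%R t.
    by rewrite ger0_norm// pE// lerDl mulr_ge0// invr_ge0 ltW.
  rewrite ltr0_norm// pE; last by rewrite oppr_ge0 ltW.
  by rewrite lerDr mulr_ge0// invr_ge0 ltW.
rewrite ge0_integralZl//; last 3 first.
- by apply: emeasurable_funD; apply/measurable_EFinP.
- by move=> t _; rewrite adde_ge0// lee_fin.
- by rewrite lee_fin invr_ge0 ltW.
rewrite ge0_integralD//; last 4 first.
- by move=> t _; rewrite lee_fin.
- exact/measurable_EFinP.
- by move=> t _; rewrite lee_fin.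
- exact/measurable_EFinP.
rewrite (@ge0_integral_opp _ (fun t => (p t)%:E))//; last exact/measurable_EFinP.
by rewrite integral_exponential_pdf// -EFinD -EFinM ltry.
Qed.

End radial.

(* The two largest of the three exponents have weight [1] minus a defect, and
   the defects bound the decay factor [eps * |p - s|]. *)
Lemma exponents_cases (R : realFieldType) (a b c eps p q s : R) :
  0 <= a <= 1 -> 0 <= b <= 1 -> a + b + c = 2 ->
  eps <= 1 - a -> eps <= 1 - b -> eps <= 1 - c ->
  [\/ a * p + b * q + c * s <= p + q,
  a * p + b * q + c * s <= p + s - eps * `|p - s| |
  a * p + b * q + c * s <= q + s - eps * `|q - s| ].
Proof.
rewrite -(subr_ge0 a) -(subr_ge0 b) => /andP[a0 a1] /andP[b0 b1] abc ea eb ec.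
have cE : c = 2 - a - b by rewrite -abc; ring.
have [sp|ps] := leP s p; have [sq|qs] := leP s q.
- apply: Or31; have : 0 <= (1 - a) * (p - s) by rewrite mulr_ge0// subr_ge0 // ltW.
  have : 0 <= (1 - b) * (q - s) by rewrite mulr_ge0// subr_ge0 // ltW.
  by rewrite cE => h1 h2; lra.
- apply: Or32; rewrite ger0_norm ?subr_ge0//.
  have := ler_wpM2r (_ : 0 <= p - s) ea; rewrite subr_ge0 => /(_ sp).
  have : 0 <= b * (s - q) by rewrite mulr_ge0// subr_ge0 // ltW.
  by rewrite cE => h1 h2; lra.
- apply: Or33; rewrite ger0_norm ?subr_ge0//.
  have := ler_wpM2r (_ : 0 <= q - s) eb; rewrite subr_ge0 => /(_ sq).
  have : 0 <= a * (s - p) by rewrite mulr_ge0// subr_ge0 // ltW.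
  by rewrite cE => h1 h2; lra.
- have [qp|pq] := leP q p.
    apply: Or32; rewrite ltr0_norm ?subr_lt0// opprB.
    have := ler_wpM2r (_ : 0 <= s - p) ec; rewrite subr_ge0 => /(_ (ltW ps)).
    have : 0 <= b * (p - q) by rewrite mulr_ge0// subr_ge0 // ltW.
    by rewrite cE => h1 h2; lra.
  apply: Or33; rewrite ltr0_norm ?subr_lt0// opprB.
  have := ler_wpM2r (_ : 0 <= s - q) ec; rewrite subr_ge0 => /(_ (ltW qs)).
  have : 0 <= a * (q - p) by rewrite mulr_ge0// subr_ge0 // ltW.
  by rewrite cE => h1 h2; lra.
Qed.

(** * The Hardy-Littlewood-Sobolev inequality *)

Section hls.
Context (R : realType) (n : nat) (a b c : R).
Hypotheses (n0 : (0 < n)%N) (a0 : 0 < a) (a1 : a < 1) (b0 : 0 < b) (b1 : b < 1).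
Hypotheses (c0 : 0 < c) (c1 : c < 1) (abc : a + b + c = 2).
Local Notation leb := (@lebesgue_measure R).
Local Notation m := (lebesgue_rV R n).
Implicit Types x y : 'rV[R]_n.

Let eps := Num.min (1 - a) (Num.min (1 - b) (1 - c)).

Let eps0 : 0 < eps. Proof. by rewrite !lt_min !subr_gt0 a1 b1. Qed.

Let eps_le : [/\ eps <= 1 - a, eps <= 1 - b & eps <= 1 - c].
Proof. by rewrite /eps; split; rewrite !ge_min lexx ?orbT. Qed.

(** A two-sided exponential in [ln (A r^n)], times [r^-n]. In the variable [ln r] the weight becomes
    Lebesgue measure and [A] a mere shift, so the integral over R^n does not depend on [A]. *)
Let kap (A r : R) := expR (- (eps * `|ln A + n%:R * ln r|)) * r `^ (- n%:R).

Let kap0 A r : 0 <= kap A r.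
Proof. by rewrite mulr_ge0 ?powR_ge0 ?expR_ge0. Qed.

(** With [s = - n ln r] both sides are sums of exponentials, and [exponents_cases] bounds the
    exponent on the left by one of the three on the right. If [A], [B] or [r] is zero the left side
    vanishes, all exponents being nonzero. *)
Let pointwise (A B r : R) : 0 <= A -> 0 <= B -> 0 <= r ->
  A `^ a * B `^ b * r `^ (- (n%:R * c)) <= A * B + A * kap A r + B * kap B r.
Proof.
move=> A0 B0 r0.
have pos : 0 <= A * B + A * kap A r + B * kap B r.
  by rewrite !addr_ge0// mulr_ge0.
have [A_0|A_0] := eqVneq A 0.
  by rewrite {1}A_0 powR0 ?gt_eqF// !mul0r.
have [B_0|B_0] := eqVneq B 0.
  by rewrite {1}B_0 powR0 ?gt_eqF// mulr0 mul0r.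
have [r_0|r_0] := eqVneq r 0.
  rewrite {1}r_0 (@powR0 _ (- (n%:R * c))) ?mulr0//.
  by rewrite oppr_eq0 mulf_eq0 pnatr_eq0 gt_eqF//= gt_eqF.
have {}A_0 : 0 < A by rewrite lt_def A_0.
have {}B_0 : 0 < B by rewrite lt_def B_0.
have {}r_0 : 0 < r by rewrite lt_def r_0.
have kapE D : 0 < D -> kap D r = expR (- (n%:R * ln r) - eps * `|ln D - - (n%:R * ln r)|).
  by move=> D0; rewrite /kap opprK /powR gt_eqF// mulNr -expRD addrC.
set s := - (n%:R * ln r) in kapE.
have -> : A `^ a * B `^ b * r `^ (- (n%:R * c)) = expR (a * ln A + b * ln B + c * s).
  rewrite !expRD /powR !gt_eqF//; congr (_ * expR _).
  by rewrite /s; ring.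
have -> : A * B = expR (ln A + ln B) by rewrite expRD !lnK.
have -> : A * kap A r = expR (ln A + s - eps * `|ln A - s|).
  by rewrite kapE// -[in LHS](lnK A_0) -expRD lnK// addrA.
have -> : B * kap B r = expR (ln B + s - eps * `|ln B - s|).
  by rewrite kapE// -[in LHS](lnK B_0) -expRD lnK// addrA.
have [ea eb ec] := eps_le.
have a1' : 0 <= a <= 1 by rewrite !ltW.
have b1' : 0 <= b <= 1 by rewrite !ltW.
case: (@exponents_cases _ _ _ _ _ (ln A) (ln B) s a1' b1' abc ea eb ec) => h.
- have {}h := h; rewrite -ler_expR in h; apply: (le_trans h).
  by rewrite -[leRHS]addrA lerDl addr_ge0 ?expR_ge0.
- have {}h := h; rewrite -ler_expR in h; apply: (le_trans h).
  by rewrite [leRHS]addrAC lerDr addr_ge0 ?expR_ge0.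
- have {}h := h; rewrite -ler_expR in h; apply: (le_trans h).
  by rewrite lerDr addr_ge0 ?expR_ge0.
Qed.

Local Open Scope ereal_scope.

Lemma measurable_enorm_sub2 :
  measurable_fun setT (fun z : 'rV[R]_n * 'rV[R]_n => enorm (z.1 - z.2)%R).
Proof.
apply: (measurableT_comp (@measurable_enorm R n)); apply/measurable_fun_rVP => i.
rewrite (_ : _ \o _ = (fun z => (@rV_coor R n i \o fst) z - (@rV_coor R n i \o snd) z)%R); last first.
  by apply/funext => y; rewrite /rV_coor/= !mxE.
by apply: measurable_funB;
  exact: (measurableT_comp (@measurable_rV_coor R n i)).
Qed.

Let mkap d (T : measurableType d) (f g : T -> R) : measurable_fun setT f ->
  measurable_fun setT g -> measurable_fun setT (fun t => kap (f t) (g t)).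
Proof.
move=> mf mg; apply: measurable_funM; last exact: measurable_fun_powR_base.
have ml (h : T -> R) : measurable_fun setT h -> measurable_fun setT (fun t : T => ln (h t)).
  exact: (measurableT_comp (@measurable_ln R)).
apply: measurable_fun_expR_norm.
apply: measurable_funD; first exact: ml.
by apply: measurable_funM => //; exact: ml.
Qed.

Let kap_int : exists2 C : R, (0 <= C)%R &
  forall A x, \int[m]_y (kap A (enorm (x - y)%R))%:E = C%:E.
Proof.
have [k k0 kE] := @ge0_integral_radial R n n0.
pose I := \int[leb]_t (expR (- (eps * `|t|)))%:E.
have I0 : 0 <= I by apply: integral_ge0 => t _; rewrite lee_fin expR_ge0.
have Ifin : I \is a fin_num by rewrite ge0_fin_numE// integral_expR_norm.
have nR0 : (0 < n%:R :> R)%R by rewrite ltr0n.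
exists (k * (n%:R^-1 * fine I))%R.
  by rewrite !mulr_ge0// ?invr_ge0 ?ler0n ?fine_ge0.
move=> A x.
rewrite (@ge0_integral_subl _ _ x (fun y => (kap A (enorm y))%:E)); last 2 first.
- apply/measurable_EFinP; apply: mkap => //; exact: measurable_enorm.
- by move=> y; rewrite lee_fin.
rewrite (kE (fun t => expR (- (eps * `|ln A + n%:R * t|))%R)); last 2 first.
- apply: measurable_fun_expR_norm.
  by apply: measurable_funD => //; exact: measurable_funM.
- by move=> t; exact: expR_ge0.
rewrite EFinM; congr (_ * _); rewrite EFinM fineK//.
rewrite -(@ge0_integral_affine _ _ (ln A) (fun t => (expR (- (eps * `|t|)))%:E))//.
- by apply: eq_integral => t _; rewrite addrC.
- by apply/measurable_EFinP; exact: measurable_expR_norm.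
Qed.

(* The kernel is split according to which of [F x], [H y] and [|x - y|^-n] is
   the smallest. *)
Lemma hardy_littlewood_sobolev : exists2 C : R, (0 <= C)%R &
  forall F H : 'rV[R]_n -> R, measurable_fun setT F -> measurable_fun setT H ->
  (forall x, 0 <= F x)%R -> (forall x, 0 <= H x)%R ->
  \int[m]_x \int[m]_y (F x `^ a * H y `^ b * riesz (n%:R * c) x y)%:E <=
  (\int[m]_x (F x)%:E) * (\int[m]_y (H y)%:E) +
  C%:E * (\int[m]_x (F x)%:E + \int[m]_y (H y)%:E).
Proof.
have [C C0 CE] := kap_int; exists C => // F H mF mH F0 H0.
have mF1 : measurable_fun setT (fun z : 'rV[R]_n * 'rV[R]_n => F z.1).
  exact: (measurableT_comp mF measurable_fst).
have mH2 : measurable_fun setT (fun z : 'rV[R]_n * 'rV[R]_n => H z.2).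
  exact: (measurableT_comp mH measurable_snd).
(* [G1] collects the two terms to be integrated in [y] first; in [G2] the factor [H y] does not
   depend on [x], so the order of integration is exchanged before [CE] applies. *)
pose G1 (z : 'rV[R]_n * 'rV[R]_n) := (F z.1 * H z.2 + F z.1 * kap (F z.1) (enorm (z.1 - z.2)))%R.
pose G2 (z : 'rV[R]_n * 'rV[R]_n) := (H z.2 * kap (H z.2) (enorm (z.1 - z.2)))%R.
have mG1 : measurable_fun setT G1.
  apply: measurable_funD; apply: measurable_funM => //.
  by apply: mkap => //; exact: measurable_enorm_sub2.
have mG2 : measurable_fun setT G2.
  by apply: measurable_funM => //; apply: mkap => //; exact: measurable_enorm_sub2.
have G10 z : (0 <= G1 z)%R by rewrite addr_ge0// mulr_ge0.
have G20 z : (0 <= G2 z)%R by rewrite mulr_ge0.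
have G20e z : 0 <= (G2 z)%:E by rewrite lee_fin.
have IF0 : 0 <= \int[m]_x (F x)%:E by apply: integral_ge0 => x _; rewrite lee_fin.
have IH0 : 0 <= \int[m]_x (H x)%:E by apply: integral_ge0 => x _; rewrite lee_fin.
pose J (z : 'rV[R]_n * 'rV[R]_n) := (F z.1 `^ a * H z.2 `^ b * riesz (n%:R * c) z.1 z.2)%:E.
have mJ : measurable_fun setT J.
  apply/measurable_EFinP; apply: measurable_funM; last first.
    exact: (measurable_fun_powR_base _ measurable_enorm_sub2).
  by apply: measurable_funM; exact: measurable_fun_powR_base.
have J0 z : 0 <= J z by rewrite lee_fin !mulr_ge0 ?powR_ge0 ?riesz_ge0.
have mG1e : measurable_fun setT (fun z => (G1 z)%:E) by exact/measurable_EFinP.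
have mG2e : measurable_fun setT (fun z => (G2 z)%:E) by exact/measurable_EFinP.
have I1 x : \int[m]_y (G1 (x, y))%:E = (F x)%:E * (\int[m]_y (H y)%:E + C%:E).
  have -> : \int[m]_y (G1 (x, y))%:E = \int[m]_y ((F x)%:E * ((H y)%:E + (kap (F x) (enorm (x - y)))%:E)).
    by apply: eq_integral => y _; rewrite /G1/= -mulrDr EFinM EFinD.
  have mk : measurable_fun setT (fun y => kap (F x) (enorm (x - y))).
    apply: mkap => //; exact: (measurableT_comp (@measurable_enorm R n) (measurable_subl x)).
  rewrite ge0_integralZl//; last 3 first.
  - by apply: emeasurable_funD; exact/measurable_EFinP.
  - by move=> y _; rewrite adde_ge0// lee_fin.
  - by rewrite lee_fin.
  rewrite ge0_integralD.
  - by rewrite CE.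
  - exact: measurableT.
  - by move=> y _; rewrite lee_fin.
  - exact/measurable_EFinP.
  - by move=> y _; rewrite lee_fin.
  - exact/measurable_EFinP.
apply: (@le_trans _ _ (\int[m]_x \int[m]_y ((G1 (x, y))%:E + (G2 (x, y))%:E))).
  apply: ge0_le_integral => //.
  - by move=> x _; apply: integral_ge0 => y _; exact: (J0 (x, y)).
  - exact: (measurable_fun_fubini_tonelli_F J mJ J0).
  - apply: (measurable_fun_fubini_tonelli_F (fun z => (G1 z)%:E + (G2 z)%:E)).
      exact: emeasurable_funD.
    by move=> z; rewrite adde_ge0// lee_fin.
  move=> x _; apply: ge0_le_integral.
  - exact: measurableT.
  - by move=> y _; exact: (J0 (x, y)).
  - exact: (measurableT_comp mJ (pair1_measurable x)).
  - apply: emeasurable_funD.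
      exact: (measurableT_comp mG1e (pair1_measurable x)).
    exact: (measurableT_comp mG2e (pair1_measurable x)).
  move=> y _; rewrite -EFinD lee_fin /G1 /G2/=.
  exact: (pointwise (F0 x) (H0 y) (enorm_ge0 _)).
under eq_integral => x _.
  rewrite ge0_integralD; last 5 first.
  - exact: measurableT.
  - by move=> y _; rewrite lee_fin.
  - exact: (measurableT_comp mG1e (pair1_measurable x)).
  - by move=> y _; rewrite lee_fin.
  - exact: (measurableT_comp mG2e (pair1_measurable x)).
  rewrite I1.
  over.
have mI2 : measurable_fun setT (fun x => \int[m]_y (G2 (x, y))%:E).
  exact: (measurable_fun_fubini_tonelli_F (fun z => (G2 z)%:E) mG2e G20e).
rewrite ge0_integralD; last 5 first.
- exact: measurableT.
- by move=> x _; rewrite mule_ge0 ?lee_fin// adde_ge0// lee_fin.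
- by apply: emeasurable_funM => //; exact/measurable_EFinP.
- by move=> x _; apply: integral_ge0 => y _; rewrite lee_fin.
- exact: mI2.
rewrite ge0_integralZr//; last 3 first.
- exact/measurable_EFinP.
- by move=> x _; rewrite lee_fin.
- by rewrite adde_ge0// lee_fin.
rewrite (fubini_tonelli (fun z => (G2 z)%:E) mG2e G20e).
have -> : \int[m]_y \int[m]_x (G2 (x, y))%:E = \int[m]_y ((H y)%:E * C%:E).
  apply: eq_integral => y _.
  transitivity (\int[m]_x ((H y)%:E * (kap (H y) (enorm (y - x)%R))%:E)).
    by apply: eq_integral => x _; rewrite /G2/= EFinM enormB.
  rewrite ge0_integralZl.
  - by rewrite CE.
  - exact: measurableT.
  - apply/measurable_EFinP; apply: mkap; first exact: measurable_cst.
    exact: (measurableT_comp (@measurable_enorm R n) (measurable_subl y)).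
  - by move=> x _; rewrite lee_fin.
  - by rewrite lee_fin.
rewrite ge0_integralZr; last 4 first.
- exact: measurableT.
- exact/measurable_EFinP.
- by move=> x _; rewrite lee_fin.
- by rewrite lee_fin.
rewrite ge0_muleDr// ?lee_fin// -addeA leeD2l//.
by rewrite ge0_muleDr// (muleC C%:E) (muleC C%:E).
Qed.

End hls.

(** * Growth of the mass on cubes *)

Section regular_solution.
Context (R : realType) (n : nat).
Local Notation m := (lebesgue_rV R n).
Local Open Scope ereal_scope.

(** The equation still holds at every [x], but its integrand is now real: [fine] sends the value
    [+oo] to [0], which only affects a null set of [y]. *)
Definition regular_solution (g mu : R) (u : 'rV[R]_n -> \bar R) : Prop :=
  [/\ measurable_fun setT u, lower_semicontinuous u, (forall x, 0 < u x),
      {ae m, forall y, u y \is a fin_num} &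
      forall x, u x = \int[m]_y (fine (u y) `^ mu * riesz g x y)%:E].

End regular_solution.

Lemma ler_powR2r (R : realType) (p a b : R) : 0 <= p -> 0 <= a -> a <= b ->
  a `^ p <= b `^ p.
Proof.
by move=> p0 a0 ab; apply: ge0_ler_powR; rewrite ?nnegrE ?(le_trans a0 ab).
Qed.

Lemma powRD_gt0 (R : realType) (x p q : R) : 0 < x ->
  x `^ (p + q) = x `^ p * x `^ q.
Proof. by move=> x0; rewrite powRD// (gt_eqF x0) implybT. Qed.

Lemma powRB_gt0 (R : realType) (x p q : R) : 0 < x ->
  x `^ (p - q) = x `^ p / x `^ q.
Proof. by move=> x0; rewrite powRD_gt0// powRN. Qed.

Lemma powR_unbounded (R : realType) (d K : R) : 0 < d ->
  (forall r, 1 <= r -> r `^ d <= K) -> False.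
Proof.
move=> d0 H; have K1 : 1 <= 1 + `|K| by rewrite lerDl.
have := H ((1 + `|K|) `^ d^-1) _; rewrite -powRrM mulVf ?gt_eqF// powRr1; last exact: le_trans K1.
have -> : 1 <= (1 + `|K|) `^ d^-1.
  by rewrite -[leLHS](powRr0 (1 + `|K|)) ler_powR// invr_ge0 ltW.
by move=> /(_ isT); have := ler_norm K; lra.
Qed.

(** * Real-variable consequences of the growth inequality *)

Section growth.
Context (R : realType) (n : nat) (g mu : R) (Mr : R -> R).
Hypotheses (n0 : (0 < n)%N) (g0 : 0 < g) (gn : g < n%:R) (mu0 : 0 < mu).
Let d := n%:R - g * mu.
Hypothesis Mr_gt0 : forall r, 0 < r -> 0 < Mr r.
Hypothesis Mr_le : forall r s, 0 < r -> r <= s -> Mr r <= Mr s.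
Hypothesis growth : exists2 c : R, 0 < c &
  forall r, 0 < r -> c * r `^ d * Mr r `^ mu <= Mr r.

Lemma growth_subcritical : (exists2 C : R, 0 < C &
    forall r, 1 <= r -> Mr r <= C * r `^ g) -> mu < n%:R / g -> False.
Proof.
move=> [C C0 H2].
rewrite ltr_pdivlMr// mulrC -subr_gt0 -/d => d0.
have [c c0 H] := growth.
have [mu1|mu1] := leP 1%R mu.
  apply: (@powR_unbounded _ d (c * Mr 1 `^ (mu - 1))^-1 d0) => r r1.
  have r0 : (0 < r)%R by exact: lt_le_trans r1.
  have M1 := Mr_gt0 ltr01.
  rewrite -[leRHS]mul1r ler_pdivlMr ?mulr_gt0 ?powR_gt0//.
  rewrite -(ler_pM2r (Mr_gt0 r0)) mul1r; apply: le_trans (H r r0).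
  have -> : (Mr r `^ mu = Mr r `^ (mu - 1) * Mr r)%R.
    by rewrite -{3}[Mr r]powRr1 ?ltW ?Mr_gt0// -powRD_gt0 ?subrK// Mr_gt0.
  have -> : (r `^ d * (c * Mr 1 `^ (mu - 1)) * Mr r =
    c * r `^ d * (Mr 1 `^ (mu - 1) * Mr r))%R by ring.
  rewrite ler_pM2l ?mulr_gt0 ?powR_gt0// ler_pM2r ?Mr_gt0//.
  apply: ler_powR2r; [by rewrite subr_ge0|exact: ltW|exact: Mr_le].
have ng : (0 < n%:R - g)%R by rewrite subr_gt0.
apply: (@powR_unbounded _ _ (C `^ (1 - mu) / c) ng) => r r1.
have r0 : (0 < r)%R by exact: lt_le_trans r1.
have Mp := Mr_gt0 r0.
rewrite ler_pdivlMr//.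
have H3 : c * r `^ d <= Mr r / Mr r `^ mu by rewrite ler_pdivlMr ?powR_gt0// H.
have : (c * r `^ d <= C `^ (1 - mu) * r `^ (g * (1 - mu)))%R.
  rewrite powRrM -powRM ?powR_ge0 ?(ltW C0)//; apply: le_trans H3 _.
  have -> : (Mr r / Mr r `^ mu = Mr r `^ (1 - mu))%R.
    by rewrite powRB_gt0// powRr1// ltW.
  apply: ler_powR2r; [by rewrite subr_ge0 ltW|exact: ltW|exact: H2].
have -> : d = (n%:R - g + g * (1 - mu))%R by rewrite /d; ring.
rewrite powRD_gt0//.
by rewrite mulrA ler_pM2r ?powR_gt0// mulrC.
Qed.

Lemma growth_critical : (exists2 c : R, 0 < c &
    forall r, 0 < r -> Mr r + c * r `^ d * Mr r `^ mu <= Mr (2 * r)) ->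
  mu = n%:R / g -> False.
Proof.
move=> [k k0 K] muE; have d0 : d = 0%R by rewrite /d muE mulrC divfK ?subrr// gt_eqF.
have mu1 : (0 < mu - 1)%R by rewrite subr_gt0 muE ltr_pdivlMr// mul1r.
have [c c0 H] := growth.
have M1 := Mr_gt0 ltr01.
have lin j : (j%:R * (k * Mr 1 `^ mu) <= Mr (2 ^+ j))%R.
  elim: j => [|j IHj]; first by rewrite mul0r expr0 ltW.
  have p0 : (0 < 2 ^+ j :> R)%R by rewrite exprn_gt0.
  rewrite exprS; apply: le_trans (K _ p0).
  rewrite d0 powRr0 mulr1 -natr1 mulrDl mul1r; apply: lerD => //.
  rewrite ler_pM2l//; apply: ler_powR2r; [exact: ltW|exact: ltW|].
  by rewrite Mr_le// exprn_ege1// ler1n.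
have bd r : (0 < r)%R -> (Mr r <= (c^-1) `^ (mu - 1)^-1)%R.
  move=> r0; have := H r r0; rewrite d0 powRr0 mulr1 => H1.
  have Mp := Mr_gt0 r0.
  have {}H1 : (Mr r `^ (mu - 1) <= c^-1)%R.
    rewrite -[leRHS]mul1r ler_pdivlMr// powRB_gt0// powRr1 ?(ltW Mp)//.
    by rewrite mulrAC ler_pdivrMr// mul1r [leLHS]mulrC.
  have -> : Mr r = (Mr r `^ (mu - 1)) `^ (mu - 1)^-1.
    by rewrite -powRrM divff ?gt_eqF// powRr1// ltW.
  by apply: ler_powR2r => //; [rewrite invr_ge0 ltW|exact: powR_ge0].
set B := ((c^-1) `^ _)%R in bd.
have kM : (0 < k * Mr 1 `^ mu)%R by rewrite mulr_gt0 ?powR_gt0.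
have B0 : 0 <= B / (k * Mr 1 `^ mu) by rewrite divr_ge0 ?powR_ge0// ltW.
have := archi_boundP B0; rewrite ltr_pdivrMr// ltNge => /negP; apply.
by apply: le_trans (lin _) (bd _ _); rewrite exprn_gt0.
Qed.

Lemma growth_supercritical (c : R) : 1 < mu -> mu * g < 2 * n%:R - g ->
  0 < c ->
  (forall r, 1 <= r -> (c * r `^ (- (g / 2))) `^ mu * (2 * r) ^+ n <= Mr r) ->
  False.
Proof.
move=> mu1 mug c0 uc.
have [k k0 H] := growth.
have n00 : (0 < n%:R :> R)%R by rewrite ltr0n.
pose e := ((n%:R - mu * (g / 2)) * (mu - 1) + d)%R.
have e0 : (0 < e)%R.
  have -> : e = (mu * ((2 * n%:R - g - mu * g) / 2))%R by rewrite /e /d; field.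
  by rewrite mulr_gt0// divr_gt0// subr_gt0.
apply: (@powR_unbounded _ e (k * (c `^ mu * 2 ^+ n) `^ (mu - 1))^-1 e0) => r r1.
have r0 : (0 < r)%R by exact: lt_le_trans r1.
have cp : (0 < c `^ mu * 2 ^+ n)%R by rewrite mulr_gt0 ?powR_gt0 ?exprn_gt0.
have low : (c `^ mu * 2 ^+ n * r `^ (n%:R - mu * (g / 2)) <= Mr r)%R.
  have -> : (c `^ mu * 2 ^+ n * r `^ (n%:R - mu * (g / 2)) =
      (c * r `^ (- (g / 2))) `^ mu * (2 * r) ^+ n)%R.
    rewrite powRM ?powR_ge0 ?ltW// -powRrM exprMn -[(r ^+ n)%R]powR_mulrn ?ltW//.
    rewrite powRD_gt0//.
    by rewrite mulNr (mulrC (g / 2)%R); ring.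
  exact: uc.
have Mp := Mr_gt0 r0.
have H1 : (k * r `^ d * Mr r `^ (mu - 1) <= 1)%R.
  rewrite (powRB_gt0 mu 1 Mp) powRr1 ?(ltW Mp)//.
  by rewrite mulrA ler_pdivrMr// mul1r H.
rewrite -[leRHS]mul1r ler_pdivlMr ?mulr_gt0 ?powR_gt0//.
apply: le_trans H1.
have -> : (r `^ e * (k * (c `^ mu * 2 ^+ n) `^ (mu - 1)) =
  k * r `^ d * ((c `^ mu * 2 ^+ n * r `^ (n%:R - mu * (g / 2))) `^ (mu - 1)))%R.
  rewrite (@powRM _ (c `^ mu * 2 ^+ n)%R) ?powR_ge0 ?ltW// -powRrM.
  rewrite /e (powRD_gt0 ((n%:R - mu * (g / 2)) * (mu - 1)) d r0).
  by ring.
rewrite ler_pM2l ?mulr_gt0 ?powR_gt0//.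
apply: ler_powR2r => //; first by rewrite subr_ge0 ltW.
by rewrite mulr_ge0 ?powR_ge0// ltW.
Qed.

End growth.

(** * Mass estimates for a solution finite at one point *)

Section serrin.
Context (R : realType) (n : nat) (g mu : R) (u : 'rV[R]_n -> \bar R).
Local Notation m := (lebesgue_rV R n).
Hypotheses (n0 : (0 < n)%N) (g0 : 0 < g) (gn : g < n%:R) (mu0 : 0 < mu).
Hypothesis su : regular_solution g mu u.
Variable x0 : 'rV[R]_n.
Hypothesis ux0 : (u x0 < +oo)%E.
Local Open Scope ereal_scope.

Let G y := fine (u y).

Let mG : measurable_fun setT G.
Proof.
by have [mu_ _ _ _ _] := su; exact: (measurableT_comp (fine_measurable measurableT) mu_).
Qed.

Let mGmu : measurable_fun setT (fun y => (G y `^ mu)%R).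
Proof. exact: (measurable_fun_powR_base _ mG). Qed.

Let M (r : R) := \int[m]_(y in cube r) (G y `^ mu)%:E.

Let mcube (r : R) : measurable (cube r : set 'rV[R]_n).
Proof. exact: measurable_cube. Qed.

Let mGmuD (D : set 'rV[R]_n) : measurable_fun D (fun y => (G y `^ mu)%:E).
Proof. by apply/measurable_EFinP; apply: measurable_funTS. Qed.

Let ae_neq x : {ae m, forall y, x <> y}.
Proof.
exists [set x]; split; [exact: measurable_rV_set1|exact: lebesgue_rV_set1|].
by move=> y /contrapT ->.
Qed.

Let M_ge0 r : 0 <= M r.
Proof. by apply: integral_ge0 => y _; rewrite lee_fin powR_ge0. Qed.

(** The kernel is at least [D^-g] on the cube, except at [y = x], where [riesz] takes the value [0];
    the integrands are therefore compared almost everywhere. *)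
Lemma solution_lower_bound (r D : R) x : (0 < D)%R ->
  (forall y, cube r y -> enorm (x - y) <= D)%R ->
  (D `^ (- g))%:E * M r <= u x.
Proof.
move=> D0 xD; have [_ _ _ _ ->] := su.
rewrite -ge0_integralZl; last 4 first.
- exact: mcube.
- exact: mGmuD.
- by move=> y _; rewrite lee_fin powR_ge0.
- by rewrite lee_fin powR_ge0.
have mGr : measurable_fun setT (fun y => (G y `^ mu * riesz g x y)%:E).
  by apply/measurable_EFinP; apply: measurable_funM => //; exact: measurable_riesz.
have G0 y : 0 <= (G y `^ mu * riesz g x y)%:E.
  by rewrite lee_fin mulr_ge0 ?powR_ge0.
apply: (@le_trans _ _ (\int[m]_(y in cube r) (G y `^ mu * riesz g x y)%:E)); last first.
  by apply: ge0_subset_integral => //; exact: measurableT.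
apply: ae_ge0_le_integral.
- exact: mcube.
- by move=> y _; rewrite -EFinM lee_fin mulr_ge0 ?powR_ge0.
- by apply: measurable_funeM; exact: mGmuD.
- by move=> y _; exact: G0.
- exact: measurable_funTS.
apply: filterS (ae_neq x) => y xy Qy.
rewrite -EFinM lee_fin mulrC ler_wpM2l ?powR_ge0//.
have {}xy : x != y by exact/eqP.
rewrite /riesz !powRN lef_pV2 ?posrE ?powR_gt0 ?enorm_gt0 ?subr_eq0//.
by apply: ler_powR2r; [exact: ltW|exact: enorm_ge0|exact: xD].
Qed.

Let sn0 : (0 < Num.sqrt n%:R :> R)%R.
Proof. by rewrite sqrtr_gt0 ltr0n. Qed.

Let M_fin r : (0 < r)%R -> M r \is a fin_num.
Proof.
move=> r0; rewrite ge0_fin_numE//.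
pose D := (Num.sqrt n%:R * (enorm x0 + r))%R.
have D0 : (0 < D)%R by rewrite mulr_gt0// ltr_wpDl ?enorm_ge0.
have /le_lt_trans/(_ ux0) : (D `^ (- g))%:E * M r <= u x0.
  apply: solution_lower_bound => // y yr; apply: cube_dist => //.
  - exact: enorm_ge0.
  - exact: ltW.
  - by apply/cubeP => i; exact: enorm_coord.
rewrite !ltey; apply: contra => /eqP ->.
by rewrite gt0_muley// lte_fin powR_gt0.
Qed.

Let Mr r := fine (M r).

Let MrE r : (0 < r)%R -> M r = (Mr r)%:E.
Proof. by move=> r0; rewrite /Mr fineK// M_fin. Qed.

Let m_cube r : (0 <= r)%R -> m (cube r) = ((2 * r) ^+ n)%:E.
Proof. exact: lebesgue_rV_cube. Qed.

(** Zero mass would force [fine (u y) = 0] for almost every [y] in the cube. As [fine +oo = 0],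
    positivity of [u] excludes this only together with finiteness almost everywhere. *)
Let Mr_gt0 r : (0 < r)%R -> (0 < Mr r)%R.
Proof.
move=> r0; rewrite -lte_fin -MrE// lt0e M_ge0 andbT; apply/eqP => M0.
have [_ _ upos ufin _] := su.
have : \int[m]_(y in cube r) `|(G y `^ mu)%:E| = 0.
  by rewrite -M0; apply: eq_integral => y _; rewrite gee0_abs// lee_fin powR_ge0.
move/(ae_eq_integral_abs m (mcube r) (@mGmuD _)) => G0.
have : {ae m, forall y, cube r y -> False}.
  apply: filterS2 ufin G0 => y uy /[apply] /= [[]] /eqP.
  rewrite powR_eq0 => /andP[/eqP Gy _].
  by have := upos y; rewrite -(fineK uy) -/(G y) Gy ltxx.
move=> [N [mN N0 cN]].
have : m (cube r) <= m N.
  apply: (@le_measure _ _ _ m); [by rewrite inE; exact: mcube|by rewrite inE|].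
  by move=> y yr; apply: cN => /(_ yr).
rewrite N0 (m_cube (ltW r0)) lee_fin leNgt exprn_gt0// mulr_gt0//.
Qed.

Let Mr_le r s : (0 < r)%R -> (r <= s)%R -> (Mr r <= Mr s)%R.
Proof.
move=> r0 rs; rewrite -lee_fin -!MrE//; last exact: lt_le_trans rs.
apply: ge0_subset_integral.
- exact: mcube.
- exact: mcube.
- exact: mGmuD.
- by move=> y _; rewrite lee_fin powR_ge0.
- exact: sub_cube.
Qed.

Lemma solution_bounded_below : exists2 c : R, (0 < c)%R &
  forall x, cube 1%R x -> c%:E <= u x.
Proof.
have D0 : (0 < Num.sqrt n%:R * (1 + 1) :> R)%R by rewrite mulr_gt0.
exists ((Num.sqrt n%:R * (1 + 1)) `^ (- g) * Mr 1)%R.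
  by rewrite mulr_gt0 ?powR_gt0// Mr_gt0.
move=> x x1; rewrite EFinM -MrE//; apply: solution_lower_bound => // y y1.
exact: cube_dist.
Qed.

Lemma integral_cst_le (D : set 'rV[R]_n) (k : R) : measurable D -> (0 <= k)%R ->
  (forall x, D x -> k%:E <= u x) ->
  (k `^ mu)%:E * m D <= \int[m]_(y in D) (G y `^ mu)%:E.
Proof.
move=> mD k0 kD; have [_ _ _ ufin _] := su.
rewrite -integral_cst//.
apply: ae_ge0_le_integral => //.
- by move=> y _; rewrite lee_fin powR_ge0.
- by move=> y _; rewrite lee_fin powR_ge0.
apply: filterS ufin => y uy Dy; rewrite lee_fin.
have kG : (k <= G y)%R by rewrite -lee_fin fineK// kD.
by apply: ler_powR2r => //; exact: ltW.
Qed.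

Let d := (n%:R - g * mu)%R.

Let scaling (k r t : R) : (0 < k)%R -> (0 < r)%R -> (0 <= t)%R ->
  (((k * r) `^ (- g) * t) `^ mu * (2 * r) ^+ n =
   k `^ (- (g * mu)) * 2 ^+ n * r `^ d * t `^ mu)%R.
Proof.
move=> k0 r0 t0; rewrite powRM ?powR_ge0// -powRrM mulNr powRM ?ltW//.
rewrite exprMn -[(r ^+ n)%R]powR_mulrn ?ltW// /d addrC powRD_gt0//.
by ring.
Qed.

(** Two points of the cube are at distance at most [2 sqrt n r], so [u >= (2 sqrt n r)^-g M(r)] on
    it; the power [mu] of this bound is integrated over the volume [(2r)^n]. *)
Lemma serrin_growth : exists2 c : R, (0 < c)%R &
  forall r, (0 < r)%R -> (c * r `^ d * Mr r `^ mu <= Mr r)%R.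
Proof.
exists ((2 * Num.sqrt n%:R) `^ (- (g * mu)) * 2 ^+ n)%R.
  by rewrite mulr_gt0 ?powR_gt0 ?mulr_gt0// exprn_gt0.
move=> r r0; rewrite -(scaling _ r0 (ltW (Mr_gt0 r0))); last by rewrite mulr_gt0.
rewrite -lee_fin -[leRHS]MrE// EFinM -(m_cube (ltW r0)).
apply: integral_cst_le; first exact: mcube.
  by rewrite mulr_ge0 ?powR_ge0// (ltW (Mr_gt0 r0)).
move=> x xr; rewrite EFinM -MrE//; apply: solution_lower_bound.
  by rewrite !mulr_gt0.
move=> y yr; apply: le_trans (cube_dist (ltW r0) (ltW r0) xr yr) _.
by rewrite le_eqVlt; apply/orP; left; apply/eqP; ring.
Qed.

(** The same bound for [x] in the shell between the cubes of half-sides [r] and [2r]: the distance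
    is now at most [3 sqrt n r], and the shell has volume at least [(2r)^n], because
    [(4r)^n >= 2 (2r)^n]. *)
Lemma serrin_growth_shell : exists2 c : R, (0 < c)%R &
  forall r, (0 < r)%R -> (Mr r + c * r `^ d * Mr r `^ mu <= Mr (2 * r))%R.
Proof.
exists ((3 * Num.sqrt n%:R) `^ (- (g * mu)) * 2 ^+ n)%R.
  by rewrite mulr_gt0 ?powR_gt0 ?mulr_gt0// exprn_gt0.
move=> r r0; rewrite -(scaling _ r0 (ltW (Mr_gt0 r0))); last by rewrite mulr_gt0.
have r20 : (0 < 2 * r)%R by rewrite mulr_gt0.
have rr : (cube r : set 'rV[R]_n) `<=` cube (2 * r)%R.
  by apply: sub_cube; rewrite ler_peMl ?ler1n// (ltW r0).
have mD : measurable (cube (2 * r)%R `\` cube r : set 'rV[R]_n).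
  by apply: measurableD; exact: mcube.
have UE : cube (2 * r)%R = cube r `|` (cube (2 * r)%R `\` cube r) :> set 'rV[R]_n by rewrite setDUK.
have dis : [disjoint (cube r : set 'rV[R]_n) & cube (2 * r)%R `\` cube r].
  by apply/disj_setPS => x [? []].
have mDge : ((2 * r) ^+ n)%:E <= m (cube (2 * r)%R `\` cube r).
  have : m (cube (2 * r)%R) = m (cube r) + m (cube (2 * r)%R `\` cube r).
    by rewrite {1}UE measureU//; exact/disj_set2P.
  rewrite (m_cube (ltW r20)) (m_cube (ltW r0)); case: (m _) => [s| |]; rewrite ?leey//.
  move=> /eqP; rewrite -EFinD eqe => /eqP E; rewrite lee_fin.
  have : (2 * (2 * r) ^+ n <= (2 * (2 * r)) ^+ n)%R.
    by rewrite [leRHS]exprMn ler_pM2r ?exprn_gt0// -[leLHS]expr1 ler_eXn2l// ltr1n.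
  by rewrite E mulr_natl mulr2n lerD2l.
rewrite -lee_fin EFinD -[leRHS]MrE// -MrE// /M UE.
rewrite ge0_integral_setU; last 5 first.
- exact: mcube.
- exact: mD.
- by rewrite -UE; exact: mGmuD.
- by move=> y _; rewrite lee_fin powR_ge0.
- exact: dis.
rewrite leeD2l//.
pose k := ((3 * Num.sqrt n%:R * r) `^ (- g) * Mr r)%R.
apply: (@le_trans _ _ ((k `^ mu)%:E * m (cube (2 * r)%R `\` cube r))).
  by rewrite EFinM lee_pmul2l// lte_fin powR_gt0// mulr_gt0 ?Mr_gt0// powR_gt0// !mulr_gt0.
apply: integral_cst_le => //.
  by rewrite mulr_ge0 ?powR_ge0// (ltW (Mr_gt0 r0)).
move=> x [xr _]; rewrite EFinM -MrE//; apply: solution_lower_bound.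
  by rewrite !mulr_gt0.
move=> y yr; apply: le_trans (cube_dist (ltW r20) (ltW r0) xr yr) _.
by rewrite le_eqVlt; apply/orP; left; apply/eqP; ring.
Qed.

(** This is the lower bound read at the point [x0], where [u] is finite; for [r >= 1] the distance
    is at most [sqrt n (|x0| + 1) r]. *)
Lemma serrin_upper : exists2 C : R, (0 < C)%R &
  forall r, (1 <= r)%R -> (Mr r <= C * r `^ g)%R.
Proof.
have [_ _ upos _ _] := su.
have [U uU] : exists U, u x0 = U%:E.
  by exists (fine (u x0)); rewrite fineK// ge0_fin_numE// ltW.
have U0 : (0 < U)%R by rewrite -lte_fin -uU.
have e0 := enorm_ge0 x0.
exists ((Num.sqrt n%:R * (enorm x0 + 1)) `^ g * U)%R.
  by rewrite mulr_gt0// powR_gt0// mulr_gt0// ltr_wpDl.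
move=> r r1; have r0 : (0 < r)%R by exact: lt_le_trans r1.
have D0 : (0 < Num.sqrt n%:R * (enorm x0 + 1) * r)%R.
  by rewrite !mulr_gt0// ltr_wpDl.
have : ((Num.sqrt n%:R * (enorm x0 + 1) * r) `^ (- g))%:E * M r <= u x0.
  apply: solution_lower_bound => // y yr.
  apply: (@le_trans _ _ (Num.sqrt n%:R * (enorm x0 + r))%R).
    apply: cube_dist => //; first exact: ltW.
    by apply/cubeP => i; exact: enorm_coord.
  by rewrite -mulrA ler_wpM2l ?sqrtr_ge0// mulrDl mul1r lerD2r ler_peMr.
rewrite MrE// uU -EFinM lee_fin powRN.
rewrite mulrC ler_pdivrMr ?powR_gt0// => /le_trans; apply.
rewrite [X in (_ * X <= _)%R]powRM ?mulr_ge0 ?sqrtr_ge0 ?addr_ge0 ?(ltW r0)//.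
by rewrite le_eqVlt; apply/orP; left; apply/eqP; ring.
Qed.

Lemma serrin_subcritical : (mu < n%:R / g)%R -> False.
Proof.
exact: (growth_subcritical g0 gn Mr_gt0 Mr_le serrin_growth serrin_upper).
Qed.

Lemma serrin_critical : mu = (n%:R / g)%R -> False.
Proof.
exact: (growth_critical g0 gn mu0 Mr_gt0 Mr_le serrin_growth serrin_growth_shell).
Qed.

Lemma serrin_supercritical (c : R) : (1 < mu)%R -> (mu * g < 2 * n%:R - g)%R ->
  (0 < c)%R ->
  (forall r x, (1 <= r)%R -> cube r x -> (c * r `^ (- (g / 2)))%:E <= u x) -> False.
Proof.
move=> mu1 mug c0 uc.
apply: (growth_supercritical n0 mu0 Mr_gt0 serrin_growth mu1 mug c0) => r r1.
have r0 : (0 < r)%R by exact: lt_le_trans r1.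
rewrite -lee_fin -[leRHS]MrE// EFinM -(m_cube (ltW r0)).
apply: integral_cst_le; first exact: mcube.
  by rewrite mulr_ge0 ?powR_ge0// ltW.
by move=> x xr; exact: uc.
Qed.

End serrin.

(** * The Kelvin transform *)

Section inversion_geometry.
Context (R : realType) (n : nat).
Implicit Types x y : 'rV[R]_n.

Let dot x y := \sum_i x ord0 i * y ord0 i.

Let sqr_enormB x y : enorm (x - y) ^+ 2 = enorm x ^+ 2 - 2 * dot x y + enorm y ^+ 2.
Proof.
rewrite !sqr_enorm /dot mulr_sumr -sumrN -!big_split/=.
by apply: eq_bigr => i _; rewrite !mxE; ring.
Qed.

Let dotZl a x y : dot (a *: x) y = a * dot x y.
Proof. by rewrite /dot mulr_sumr; apply: eq_bigr => i _; rewrite mxE mulrA. Qed.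

Let dotZr a x y : dot x (a *: y) = a * dot x y.
Proof. by rewrite /dot mulr_sumr; apply: eq_bigr => i _; rewrite mxE mulrCA. Qed.

Lemma enorm_inversion l x : 0 < l -> x != 0 -> enorm (inversion l x) = l ^+ 2 / enorm x.
Proof.
move=> l0 x0; rewrite /inversion enormZ ger0_norm; last first.
  by rewrite divr_ge0 ?exprn_ge0 ?enorm_ge0// ltW.
by field; rewrite gt_eqF ?enorm_gt0.
Qed.

(** The square of either side is [l^4 - 2 l^2 x.y + |x|^2 |y|^2], an expression symmetric in [x] and
    [y]. *)
Lemma inversion_distC l x y : 0 < l -> x != 0 -> y != 0 ->
  enorm x * enorm (inversion l x - y) = enorm y * enorm (x - inversion l y).
Proof.
move=> l0 x0 y0; apply/eqP; rewrite -(@eqrXn2 _ 2)// ?mulr_ge0 ?enorm_ge0//.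
rewrite !exprMn !sqr_enormB !enorm_inversion// /inversion !(dotZl, dotZr).
by apply/eqP; field; rewrite !gt_eqF ?enorm_gt0.
Qed.

Lemma inversion_dist l x y : 0 < l -> x != 0 -> y != 0 ->
  enorm x * enorm y * enorm (inversion l x - inversion l y) = l ^+ 2 * enorm (x - y).
Proof.
move=> l0 x0 y0; apply/eqP; rewrite -(@eqrXn2 _ 2)// ?mulr_ge0 ?exprn_ge0 ?enorm_ge0 ?(ltW l0)//.
rewrite !exprMn !sqr_enormB !enorm_inversion// /inversion !(dotZl, dotZr).
by apply/eqP; field; rewrite !gt_eqF ?enorm_gt0.
Qed.

(* [(|x| |x* - y|)^2 - (l |x - y|)^2 = (l^2 - |x|^2) (l^2 - |y|^2)] *)
Lemma inversion_dist_lt l x y : 0 < l -> x != 0 ->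
  enorm x < l -> enorm y < l -> l * enorm (x - y) < enorm x * enorm (inversion l x - y).
Proof.
move=> l0 x0 xl yl; rewrite -(@ltr_pXn2r _ 2)// ?nnegrE ?mulr_ge0 ?enorm_ge0 ?(ltW l0)//.
rewrite -subr_gt0.
have -> : (enorm x * enorm (inversion l x - y)) ^+ 2 - (l * enorm (x - y)) ^+ 2 =
    (l ^+ 2 - enorm x ^+ 2) * (l ^+ 2 - enorm y ^+ 2).
  rewrite !exprMn !sqr_enormB !enorm_inversion// /inversion !(dotZl, dotZr).
  by field; rewrite !gt_eqF ?enorm_gt0.
by rewrite mulr_gt0// subr_gt0 ltr_pXn2r// ?nnegrE ?enorm_ge0 ?(ltW l0).
Qed.

End inversion_geometry.

(** * Folding an integral over R^n into a ball *)

Section kelvin.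
Context (R : realType) (n : nat).
Hypothesis n0 : (0 < n)%N.
Local Notation m := (lebesgue_rV R n).
Implicit Types x y : 'rV[R]_n.
Local Open Scope ereal_scope.

Definition pball (l : R) : set 'rV[R]_n := [set x | (0 < enorm x < l)%R].

Lemma measurable_pball l : measurable (pball l).
Proof.
rewrite (_ : pball l = @enorm R n @^-1` `]0%R, l[%classic); last first.
  by apply/seteqP; split=> x /=; rewrite in_itv.
rewrite -[X in measurable X]setTI.
exact: (@measurable_enorm R n measurableT _ (measurable_itv _)).
Qed.

Lemma measurable_sphere (l : R) : measurable [set x : 'rV[R]_n | enorm x = l].
Proof.
rewrite -[X in measurable X]setTI.
exact: (@measurable_enorm R n measurableT [set l] (measurable_set1 l)).
Qed.

Lemma pball_neq0 l x : pball l x -> x != 0%R.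
Proof. by rewrite /pball/= enorm_gt0 => /andP[]. Qed.

(* The exterior of the ball is mapped by the inversion onto the punctured ball. *)
Lemma integral_kelvin (l : R) (f : 'rV[R]_n -> \bar R) : (0 < l)%R ->
  measurable_fun setT f -> (forall x, 0 <= f x) ->
  \int[m]_x f x = \int[m]_(x in pball l)
    (f x + f (inversion l x) * ((l / enorm x) `^ (2 * n%:R))%:E).
Proof.
move=> l0 mf f0.
have mP := measurable_pball l.
pose E : set 'rV[R]_n := [set x | (l < enorm x)%R].
have mE : measurable E.
  rewrite (_ : E = @enorm R n @^-1` `]l, +oo[%classic); last first.
    by apply/seteqP; split=> x /=; rewrite in_itv/= ?andbT.
  rewrite -[X in measurable X]setTI.
  exact: (@measurable_enorm R n measurableT _ (measurable_itv _)).
have mfi : measurable_fun setT (fun x => f (inversion l x)).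
  exact: (measurableT_comp mf (@measurable_inversion R n l)).
have mth : measurable_fun setT (fun x : 'rV[R]_n => ((l / enorm x) `^ (2 * n%:R))%R).
  apply: measurable_fun_powR_base.
  rewrite (_ : (fun x => _) = (fun x => l * enorm x `^ (-1))%R); last first.
    by apply/funext => x; rewrite powR_inv1// enorm_ge0.
  apply: measurable_funM => //.
  exact: (measurable_fun_powR_base _ (@measurable_enorm R n)).
have mg : measurable_fun setT (fun x => f (inversion l x) * ((l / enorm x) `^ (2 * n%:R))%:E).
  by apply: emeasurable_funM => //; exact/measurable_EFinP.
have g0 x : 0 <= f (inversion l x) * ((l / enorm x) `^ (2 * n%:R))%:E.
  by rewrite mule_ge0// lee_fin powR_ge0.
rewrite ge0_integralD; last 5 first.
- exact: mP.
- by move=> x _; exact: f0.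
- exact: measurable_funTS.
- by move=> x _; exact: g0.
- exact: measurable_funTS.
transitivity (\int[m]_(x in pball l) f x + \int[m]_(x in E) f x).
  rewrite -ge0_integral_setU; last 5 first.
  - exact: mP.
  - exact: mE.
  - exact: measurable_funTS.
  - by move=> x _; exact: f0.
  - apply/disj_setPS => x [] /= /andP[_ h1] h2.
    by have := lt_trans h1 h2; rewrite ltxx.
  have mPE : measurable (pball l `|` E) by exact: measurableU.
  rewrite (@ge0_negligible_integral _ _ _ m setT (~` (pball l `|` E))).
  - by rewrite setTD setCK.
  - exact: measurableC.
  - exact: measurableT.
  - exact: mf.
  - by move=> x _; exact: f0.
  apply/eqP; rewrite -measure_le0.
  have -> : 0 = m ([set x | enorm x = l] `|` [set 0%R]).
    rewrite (measureU0 (measurable_sphere l) (measurable_rV_set1 0%R) (lebesgue_rV_set1 0%R n0)).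
    exact: (esym (lebesgue_rV_sphere n0 l0)).
  apply: (@le_measure _ _ _ m); rewrite ?inE.
  - exact: measurableC.
  - by apply: measurableU; [exact: measurable_sphere|exact: measurable_rV_set1].
  move=> x /= nx; have [xl|xl|xl] := ltgtP (enorm x) l; last by left.
  - right => /=; apply/eqP; rewrite -enorm_eq0 eq_le enorm_ge0 andbT leNgt.
    by apply/negP => x0; apply: nx; left; rewrite /pball/= x0.
  - by exfalso; apply: nx; right.
congr (_ + _).
rewrite [LHS]integral_mkcond [RHS]integral_mkcond.
(* The factor [|x|^n] makes the invariant measure [|x|^-n dx] appear. Inversion turns it into
   [(l^2 / |x|)^n], which together with [|x|^-n] is the weight [(l / |x|)^(2n)]. *)
pose h x := (f \_ E) x * (enorm x `^ n%:R)%:E.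
have mh : measurable_fun setT h.
  apply: emeasurable_funM.
    by apply/(measurable_restrictT _ mE); exact: measurable_funTS.
  by apply/measurable_EFinP; exact: (measurable_fun_powR_base _ (@measurable_enorm R n)).
have h0 x : 0 <= h x by rewrite mule_ge0 ?lee_fin ?powR_ge0// erestrict_ge0.
transitivity (\int[m]_x (h x * (enorm x `^ (- n%:R))%:E)).
  apply: eq_integral => x _; rewrite /h -muleA -EFinM.
  have [xE|xE] := boolP (x \in E); last by rewrite /patch (negbTE xE) mul0e.
  have x0 : (0 < enorm x)%R by apply: lt_trans l0 _; move: xE; rewrite inE.
  by rewrite powRN mulfV ?mule1// gt_eqF// powR_gt0.
rewrite -(ge0_integral_inversion n0 l0 mh h0).
apply: eq_integral => x _.
have [->|x0] := eqVneq x 0%R.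
  rewrite (_ : enorm 0 = 0%R); last by apply/eqP; rewrite enorm_eq0.
  rewrite powR0 ?mule0; last by rewrite oppr_eq0 pnatr_eq0 -lt0n.
  rewrite /patch ifF//; apply/negbTE/negP; rewrite inE /pball/= => /andP[].
  by rewrite enorm_gt0 eqxx.
have e0 : (0 < enorm x)%R by rewrite enorm_gt0.
rewrite /h /patch.
have -> : (inversion l x \in E) = (x \in pball l).
  apply/idP/idP; rewrite !inE /E /pball/= enorm_inversion// e0/= ltr_pdivlMr// expr2 ltr_pM2l//.
case: ifPn => _; last by rewrite !mul0e.
rewrite -muleA -EFinM; congr (_ * _%:E).
have le0 : (0 <= l / enorm x)%R by rewrite divr_ge0 ?(ltW l0) ?(ltW e0).
rewrite -(natrM R 2 n) powRN !powR_mulrn ?enorm_ge0// exprM -exprVn -exprMn.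
rewrite enorm_inversion//; congr (_ ^+ n)%R; field.
by rewrite gt_eqF.
Qed.

End kelvin.

(** * A mean value inequality for powers *)

(** As [t <= 1], the exponent may be raised to the integer [Num.bound p], for which induction gives
    Bernoulli's inequality. *)
Lemma one_sub_powR_le (R : realType) (p t : R) : 1 <= p -> 0 <= t <= 1 ->
  1 - t `^ p <= (Num.bound p)%:R * (1 - t).
Proof.
move=> p1 /andP[t0 t1].
have pk : p <= (Num.bound p)%:R by apply/ltW/archi_boundP; exact: le_trans p1.
have [->|tn0] := eqVneq t 0.
  rewrite powR0 ?gt_eqF ?(lt_le_trans ltr01)// !subr0 mulr1.
  exact: le_trans pk.
have {}t0 : 0 < t by rewrite lt_def tn0.
apply: (@le_trans _ _ (1 - t ^+ Num.bound p)).
  rewrite lerD2l lerN2 -powR_mulrn ?(ltW t0)//.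
  by apply: ger_powR => //; rewrite t0.
elim: (Num.bound p) => [|k IHk]; first by rewrite expr0 mul0r subrr.
rewrite exprS -natr1 mulrDl mul1r.
have : t * (1 - t ^+ k) <= 1 - t ^+ k.
  by rewrite ler_piMl// subr_ge0 exprn_ile1// ltW.
by rewrite mulrBr mulr1; lra.
Qed.

Lemma powR_sub_le (R : realType) (p s h : R) : 1 <= p -> 0 <= h -> h <= s ->
  s `^ p - h `^ p <= (Num.bound p)%:R * s `^ (p - 1) * (s - h).
Proof.
move=> p1 h0 hs; have s0 : 0 <= s by exact: le_trans hs.
have [s_0|s_0] := eqVneq s 0.
  have -> : h = 0 by apply/eqP; rewrite eq_le h0 andbT -s_0.
  by rewrite s_0 !subrr mulr0.
have {}s_0 : 0 < s by rewrite lt_def s_0.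
have t01 : 0 <= h / s <= 1 by rewrite divr_ge0//= ler_pdivrMr// mul1r.
have -> : h = h / s * s by rewrite divfK// gt_eqF.
set t := h / s in t01 *.
have /andP[t0 t1] := t01.
rewrite powRM//.
have -> : s `^ p = s `^ (p - 1) * s.
  by rewrite -[X in _ = _ * X]powRr1// -powRD_gt0// subrK.
have -> : s `^ (p - 1) * s - t `^ p * (s `^ (p - 1) * s) =
  (s `^ (p - 1) * s) * (1 - t `^ p) by ring.
have -> : (Num.bound p)%:R * s `^ (p - 1) * (s - t * s) =
  (s `^ (p - 1) * s) * ((Num.bound p)%:R * (1 - t)) by ring.
rewrite ler_pM2l ?mulr_gt0 ?powR_gt0//.
exact: one_sub_powR_le.
Qed.

(** * The Riesz kernel under inversion *)

Section kelvin_kernel.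
Context (R : realType) (n : nat) (g l : R).
Hypotheses (g0 : 0 < g) (l0 : 0 < l).
Implicit Types x y : 'rV[R]_n.

Definition kfac x : R := l / enorm x.

Lemma kfac_gt0 x : x != 0 -> 0 < kfac x.
Proof. by move=> x0; rewrite divr_gt0// enorm_gt0. Qed.

Lemma kfac_ge0 x : 0 <= kfac x.
Proof. by rewrite divr_ge0 ?enorm_ge0// ltW. Qed.

Lemma kfac_gt1 x : pball l x -> 1 < kfac x.
Proof.
by move=> /andP[x0 xl]; rewrite /kfac ltr_pdivlMr// mul1r.
Qed.

Lemma measurable_kfac : measurable_fun setT kfac.
Proof.
rewrite (_ : kfac = (fun x => l * enorm x `^ (-1))); last first.
  by apply/funext => x; rewrite /kfac powR_inv1// enorm_ge0.
apply: measurable_funM => //.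
exact: (measurable_fun_powR_base _ (@measurable_enorm R n)).
Qed.

Let powRVN (s : R) : 0 <= s -> s `^ g = s^-1 `^ (- g).
Proof. by move=> s0; rewrite -powR_inv1// -powRrM mulN1r opprK. Qed.

(** The kernel of the image point, as in the method of images. By [inversion_distC] it is symmetric
    off the origin, and [riesz g - kriesz] acts as a Green function of the ball. *)
Definition kriesz x y : R := kfac x `^ g * riesz g (inversion l x) y.

Lemma riesz_inversionr x y : x != 0 -> y != 0 ->
  riesz g x (inversion l y) = kfac y `^ (- g) * kriesz x y.
Proof.
move=> x0 y0; rewrite /kriesz /riesz powRVN ?kfac_ge0//.
rewrite -powRM ?enorm_ge0 ?invr_ge0 ?kfac_ge0// -powRM ?kfac_ge0 ?mulr_ge0 ?enorm_ge0 ?invr_ge0 ?kfac_ge0//.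
congr (_ `^ _); apply: (@mulfI _ (enorm y)); first by rewrite gt_eqF ?enorm_gt0.
rewrite -inversion_distC// /kfac; field.
by rewrite !gt_eqF ?enorm_gt0.
Qed.

Lemma riesz_inversion2 x y : x != 0 -> y != 0 ->
  kfac x `^ g * riesz g (inversion l x) (inversion l y) =
  kfac y `^ (- g) * riesz g x y.
Proof.
move=> x0 y0; rewrite /riesz (powRVN (kfac_ge0 x)).
rewrite -powRM ?enorm_ge0 ?invr_ge0 ?kfac_ge0//.
rewrite -[RHS]powRM; [|exact: kfac_ge0|exact: enorm_ge0].
congr (_ `^ _); apply: (@mulfI _ (enorm x * enorm y)).
  by rewrite mulf_neq0// gt_eqF ?enorm_gt0.
rewrite [LHS]mulrCA inversion_dist// /kfac; field.
by rewrite !gt_eqF ?enorm_gt0.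
Qed.

Lemma kriesz_ge0 x y : 0 <= kriesz x y.
Proof. by rewrite mulr_ge0 ?powR_ge0 ?riesz_ge0. Qed.

Lemma kriesz_lt x y : pball l x -> pball l y -> x != y -> kriesz x y < riesz g x y.
Proof.
move=> xl yl xy; have x0 := pball_neq0 xl.
have d0 : 0 < enorm (x - y) by rewrite enorm_gt0 subr_eq0.
have lt := inversion_dist_lt l0 x0 (proj2 (andP xl)) (proj2 (andP yl)).
rewrite /kriesz /riesz powRVN ?kfac_ge0// -powRM ?invr_ge0 ?kfac_ge0 ?enorm_ge0//.
have lt2 : enorm (x - y) < (kfac x)^-1 * enorm (inversion l x - y).
  by rewrite /kfac invf_div mulrAC ltr_pdivlMr// mulrC.
rewrite !powRN ltf_pV2 ?posrE ?powR_gt0 ?(lt_trans d0 lt2)//.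
by apply: gt0_ltr_powR; rewrite ?nnegrE ?(ltW d0) ?(ltW (lt_trans d0 lt2)).
Qed.

Lemma measurable_kriesz x : measurable_fun setT (kriesz x).
Proof. by apply: measurable_funM => //; exact: measurable_riesz. Qed.

End kelvin_kernel.

(** * Comparison with the Kelvin transform and strong maximum principle *)

Section comparison.
Context (R : realType) (n : nat) (g mu : R) (u : 'rV[R]_n -> \bar R).
Local Notation m := (lebesgue_rV R n).
Hypotheses (n0 : (0 < n)%N) (g0 : 0 < g) (mu1 : 1 <= mu).
Hypothesis kap0 : 0 < 2 * n%:R - g - g * mu.
Hypothesis su : regular_solution g mu u.
Variable l : R.
Hypothesis l0 : 0 < l.
Local Open Scope ereal_scope.
Local Notation P := (riesz g).
Local Notation Q := (kriesz g l).
Local Notation th := (kfac l).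

Let G y := fine (u y).
Let a y : R := (G y `^ mu)%R.
(** The density that represents the exterior inside the ball: [th^(2n)] comes from the change of
    variables and [th^-g] from the kernel. It equals [th^(2n - g - g mu) Gl^mu]. With [a] and [b]
    the formal difference [kelvin - u] is the integral of [(P - Q)(b - a)] over the ball. *)
Let b y : R := (th y `^ (2 * n%:R - g) * G (inversion l y) `^ mu)%R.

Definition kelvin x : \bar R := (th x `^ g)%:E * u (inversion l x).
Let Gl x : R := (th x `^ g * G (inversion l x))%R.

Let G_ge0 y : (0 <= G y)%R.
Proof. by have [_ _ upos _ _] := su; exact/fine_ge0/ltW. Qed.

Let a0 y : (0 <= a y)%R. Proof. exact: powR_ge0. Qed.
Let b0 y : (0 <= b y)%R. Proof. by rewrite mulr_ge0 ?powR_ge0. Qed.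

Let mG : measurable_fun setT G.
Proof.
by have [mu_ _ _ _ _] := su; exact: (measurableT_comp (fine_measurable measurableT) mu_).
Qed.

Let mGi : measurable_fun setT (fun y => G (inversion l y)).
Proof. exact: (measurableT_comp mG (@measurable_inversion R n l)). Qed.

Let ma : measurable_fun setT a.
Proof. exact: (measurable_fun_powR_base _ mG). Qed.

Let mth (p : R) : measurable_fun setT (fun y : 'rV[R]_n => (th y `^ p)%R).
Proof. exact: (measurable_fun_powR_base _ (@measurable_kfac R n l)). Qed.

Let mb : measurable_fun setT b.
Proof.
apply: measurable_funM; first exact: mth.
exact: (measurable_fun_powR_base _ mGi).
Qed.

Let mP : measurable (pball l : set 'rV[R]_n). Proof. exact: measurable_pball. Qed.

Let split_eq z : u z = \int[m]_(y in pball l)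
  (a y * P z y + G (inversion l y) `^ mu * P z (inversion l y) * th y `^ (2 * n%:R))%:E.
Proof.
have [_ _ _ _ uE] := su; rewrite [LHS]uE (integral_kelvin n0 l0)//.
- apply/measurable_EFinP; apply: measurable_funM; first exact: ma.
  exact: measurable_riesz.
- by move=> y; rewrite lee_fin mulr_ge0 ?powR_ge0.
Qed.

Let mPQ (f h : 'rV[R]_n -> R) D : measurable_fun setT f -> measurable_fun setT h ->
  measurable_fun D (fun y => (f y * h y)%R).
Proof. by move=> mf mh; apply: measurable_funTS; exact: measurable_funM. Qed.

Lemma solution_pball x : pball l x ->
  u x = \int[m]_(y in pball l) (P x y * a y + Q x y * b y)%:E.
Proof.
move=> xl; have x0 := pball_neq0 xl; rewrite split_eq.
apply: eq_integral => y; rewrite inE => yl; congr EFin.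
have y0 := pball_neq0 yl; have t0 := kfac_gt0 l0 y0.
rewrite (riesz_inversionr _ l0 x0 y0) /b (mulrC (a y)); congr (_ + _)%R.
by rewrite (powRD_gt0 (2 * n%:R) (- g) t0); ring.
Qed.

Lemma kelvin_pball x : pball l x ->
  kelvin x = \int[m]_(y in pball l) (Q x y * a y + P x y * b y)%:E.
Proof.
move=> xl; have x0 := pball_neq0 xl; rewrite /kelvin split_eq -ge0_integralZl.
- apply: eq_integral => y; rewrite inE => yl; rewrite -EFinM; congr EFin.
  have y0 := pball_neq0 yl; have t0 := kfac_gt0 l0 y0.
  rewrite mulrDr; congr (_ + _)%R; first by rewrite /kriesz; ring.
  transitivity ((th x `^ g * P (inversion l x) (inversion l y)) *
    (G (inversion l y) `^ mu * th y `^ (2 * n%:R)))%R; first by ring.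
  rewrite (riesz_inversion2 _ l0 x0 y0) /b (powRD_gt0 (2 * n%:R) (- g) t0).
  by ring.
- exact: mP.
- apply/measurable_EFinP; apply: measurable_funTS; apply: measurable_funD.
    by apply: measurable_funM; [exact: ma|exact: measurable_riesz].
  apply: measurable_funM; last exact: mth.
  apply: measurable_funM; first exact: (measurable_fun_powR_base _ mGi).
  exact: (measurableT_comp (@measurable_riesz R n g _) (@measurable_inversion R n l)).
- by move=> y _; rewrite lee_fin addr_ge0// !mulr_ge0 ?powR_ge0.
- by rewrite lee_fin powR_ge0.
Qed.

(** Subcriticality enters here: [th > 1] in the ball, and the surplus exponent [2n - g - g mu] is
    positive. *)
Let Gl_b y : pball l y -> (Gl y `^ mu <= b y)%R.
Proof.
move=> yl; have t1 := kfac_gt1 yl; have t0 := lt_trans ltr01 t1.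
rewrite /Gl /b powRM ?powR_ge0// -powRrM ler_wpM2r ?powR_ge0//.
by apply: ler_powR; [exact: ltW|rewrite -subr_ge0 ltW].
Qed.

Let Gl_b_lt y : pball l y -> (0 < Gl y)%R -> (Gl y `^ mu < b y)%R.
Proof.
move=> yl Gl0; have t1 := kfac_gt1 yl; have t0 := lt_trans ltr01 t1.
have Gi0 : (0 < G (inversion l y))%R.
  by move: Gl0; rewrite /Gl pmulr_rgt0// powR_gt0.
rewrite /Gl /b powRM ?powR_ge0// -powRrM ltr_pM2r ?powR_gt0//.
by rewrite /powR (gt_eqF t0) ltr_expR ltr_pM2r ?ln_gt0// -subr_gt0.
Qed.

Let mPQab x : measurable_fun (pball l) (fun y => (P x y * a y + Q x y * b y)%:E).
Proof.
apply/measurable_EFinP; apply: measurable_funD; apply: mPQ; [exact: measurable_riesz|exact: ma| |exact: mb].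
exact: measurable_kriesz.
Qed.

Let mQPab x : measurable_fun (pball l) (fun y => (Q x y * a y + P x y * b y)%:E).
Proof.
apply/measurable_EFinP; apply: measurable_funD; apply: mPQ; [exact: measurable_kriesz|exact: ma|exact: measurable_riesz|exact: mb].
Qed.

Let PQab0 x y : (0 <= (P x y * a y + Q x y * b y))%R.
Proof. by rewrite addr_ge0// mulr_ge0 ?riesz_ge0 ?kriesz_ge0. Qed.

Let QPab0 x y : (0 <= (Q x y * a y + P x y * b y))%R.
Proof. by rewrite addr_ge0// mulr_ge0 ?riesz_ge0 ?kriesz_ge0. Qed.

Let ae_neq x : {ae m, forall y, x != y}.
Proof.
exists [set x]; split; [exact: measurable_rV_set1|exact: lebesgue_rV_set1|].
by move=> y /= /negP/negPn/eqP.
Qed.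

Let Gl_ge0 y : (0 <= Gl y)%R. Proof. by rewrite mulr_ge0 ?powR_ge0. Qed.

(** The integrals over the ball see [u] only up to null sets but give its value at every point, so
    the inequality improves from almost everywhere to everywhere; the difference of the integrands
    is [(P - Q)(b - a) >= 0]. *)
Lemma ae_le_kelvin_le : {ae m, forall y, pball l y -> (G y <= Gl y)%R} ->
  forall x, pball l x -> u x <= kelvin x.
Proof.
move=> aeG x xl; rewrite (solution_pball xl) (kelvin_pball xl).
apply: ae_ge0_le_integral => //.
- by move=> y _; rewrite lee_fin.
- by move=> y _; rewrite lee_fin.
apply: filterS2 aeG (ae_neq x) => y Gy xy yl.
have ab : (a y <= b y)%R.
  apply: le_trans (Gl_b yl); apply: ler_powR2r => //; last exact: Gy.
  exact: le_trans ler01 mu1.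
have PQ := kriesz_lt g0 l0 xl yl xy.
rewrite lee_fin -subr_ge0.
have -> : (Q x y * a y + P x y * b y - (P x y * a y + Q x y * b y) =
  (P x y - Q x y) * (b y - a y))%R by ring.
by rewrite mulr_ge0// subr_ge0// ltW.
Qed.

(** Where [a > b], the excess [(P - Q)(a - b)] is at most [P (a - b)], then at most
    [P (G^mu - Gl^mu)], and [powR_sub_le] linearizes it. A sum on the right avoids subtracting
    values that may be infinite. *)
Lemma solution_le_kelvinD x : pball l x ->
  u x <= kelvin x + \int[m]_(y in pball l)
    (P x y * ((Num.bound mu)%:R * G y `^ (mu - 1) * Num.max (G y - Gl y) 0))%:E.
Proof.
move=> xl; rewrite (solution_pball xl) (kelvin_pball xl).
have mGl : measurable_fun setT Gl by apply: measurable_funM => //; exact: mth.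
have W0 y : (0 <= P x y * ((Num.bound mu)%:R * G y `^ (mu - 1) * Num.max (G y - Gl y) 0))%R.
  by rewrite !mulr_ge0 ?riesz_ge0 ?powR_ge0 ?ler0n// le_max lexx orbT.
have mW : measurable_fun (pball l) (fun y =>
    (P x y * ((Num.bound mu)%:R * G y `^ (mu - 1) * Num.max (G y - Gl y) 0))%:E).
  apply/measurable_EFinP; apply: mPQ; first exact: measurable_riesz.
  apply: measurable_funM; first apply: measurable_funM => //.
    exact: (measurable_fun_powR_base _ mG).
  by apply: measurable_maxr => //; exact: measurable_funB.
rewrite -ge0_integralD; last 5 first.
- exact: mP.
- by move=> y _; rewrite lee_fin.
- exact: mQPab.
- by move=> y _; rewrite lee_fin.
- exact: mW.
apply: ae_ge0_le_integral => //.
- by move=> y _; rewrite lee_fin.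
- by move=> y _; rewrite -EFinD lee_fin addr_ge0.
- exact: emeasurable_funD.
apply: filterS (ae_neq x) => y xy yl.
rewrite -EFinD lee_fin -lerBlDl.
have -> : (P x y * a y + Q x y * b y - (Q x y * a y + P x y * b y) =
  (P x y - Q x y) * (a y - b y))%R by ring.
have PQ := kriesz_lt g0 l0 xl yl xy.
have [ab|ba] := leP (a y) (b y).
  apply: le_trans (W0 y); rewrite -oppr_ge0 -mulrN opprB mulr_ge0// subr_ge0//.
  exact: ltW.
apply: (@le_trans _ _ (P x y * (a y - b y))%R).
  by rewrite ler_pM2r ?subr_gt0// gerBl kriesz_ge0.
rewrite ler_wpM2l ?riesz_ge0//.
have GlG : (Gl y < G y)%R.
  rewrite ltNge; apply/negP => GGl.
  have : (a y <= b y)%R.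
    apply: le_trans (Gl_b yl); apply: ler_powR2r => //.
    exact: le_trans ler01 mu1.
  by rewrite leNgt ba.
rewrite max_l; last by rewrite subr_ge0 ltW.
apply: le_trans (powR_sub_le mu1 (Gl_ge0 y) (ltW GlG)).
by rewrite lerD2l lerN2 Gl_b.
Qed.

(** Inversion preserves null sets: the indicator of [N] has integral zero for [|y|^-n dy], which
    inversion leaves invariant. The origin is excluded since its weight is [0]. *)
Lemma ae_inversion (A : 'rV[R]_n -> Prop) : {ae m, forall y, A y} ->
  {ae m, forall y, y != 0%R -> A (inversion l y)}.
Proof.
move=> [N [mN N0 AN]].
pose f y : \bar R := (\1_N y)%:E.
have mf : measurable_fun setT f by apply/measurable_EFinP; exact: measurable_indic.
have f0 y : 0 <= f y by rewrite lee_fin indicE.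
have mw : measurable_fun setT (fun y : 'rV[R]_n => (enorm y `^ (- n%:R))%:E).
  by apply/measurable_EFinP; exact: (measurable_fun_powR_base _ (@measurable_enorm R n)).
have I0 : \int[m]_y (f (inversion l y) * (enorm y `^ (- n%:R))%:E) = 0.
  rewrite (ge0_integral_inversion n0 l0 mf f0) (@ge0_ae_eq_integral _ _ _ _ _ _ (cst 0)).
  - by rewrite integral0.
  - exact: measurableT.
  - exact: emeasurable_funM.
  - exact: measurable_cst.
  - by move=> y _; rewrite mule_ge0// lee_fin powR_ge0.
  - by [].
  exists N; split => // y /= yN; apply: contrapT => nN; apply: yN => _.
  by rewrite /f indicE memNset// mul0e.
have mfi : measurable_fun setT (fun y => f (inversion l y) * (enorm y `^ (- n%:R))%:E).
  apply: emeasurable_funM => //.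
  exact: (measurableT_comp mf (@measurable_inversion R n l)).
have : \int[m]_y `|f (inversion l y) * (enorm y `^ (- n%:R))%:E| = 0.
  rewrite -I0; apply: eq_integral => y _.
  by rewrite gee0_abs// mule_ge0// lee_fin powR_ge0.
move=> /(ae_eq_integral_abs m measurableT mfi); apply: filterS => y /(_ Logic.I)/= fy y0.
apply: contrapT => nA; move/eqP: fy.
rewrite /f indicE mem_set ?mul1e ?eqe; last exact: AN.
by rewrite gt_eqF// powR_gt0// enorm_gt0.
Qed.

Let ae_fin : {ae m, forall y, u y \is a fin_num}.
Proof. by have [_ _ _ + _] := su. Qed.

Lemma ae_inversion_fin : {ae m, forall y, pball l y -> u (inversion l y) \is a fin_num}.
Proof.
by apply: filterS (ae_inversion ae_fin) => y + yl; apply; exact: pball_neq0 yl.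
Qed.

Lemma kelvinE y : u (inversion l y) \is a fin_num -> kelvin y = (Gl y)%:E.
Proof. by move=> uy; rewrite /kelvin -[X in _ * X]fineK. Qed.

Let pball_nonnull : {ae m, forall y, pball l y -> False} -> False.
Proof.
move=> [N [mN N0 pN]].
(* With this half-side the cube lies in the ball of radius [l / 2]. *)
pose r : R := (l / (2 * Num.sqrt n%:R))%R.
have sn0 : (0 < Num.sqrt n%:R :> R)%R by rewrite sqrtr_gt0 ltr0n.
have r0 : (0 < r)%R by rewrite divr_gt0// mulr_gt0.
have : m (cube r : set 'rV[R]_n) <= m (N `|` [set 0%R]).
  apply: (@le_measure _ _ _ m).
  - by rewrite inE; exact: measurable_cube.
  - by rewrite inE; apply: measurableU => //; exact: measurable_rV_set1.
  move=> y /cubeP yr; have [->|y0] := eqVneq y 0%R; first by right.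
  left; apply: pN => /=; apply.
  rewrite /pball/= enorm_gt0 y0/=.
  apply: le_lt_trans (enorm_le (ltW r0) yr) _.
  have -> : (Num.sqrt n%:R * r = l / 2)%R.
    by rewrite /r; field; rewrite gt_eqF.
  by rewrite ltr_pdivrMr// ltr_pMr// ltr1n.
have -> : m (N `|` [set 0%R]) = 0.
  rewrite -N0; exact: (measureU0 mN (measurable_rV_set1 0%R) (lebesgue_rV_set1 0%R n0)).
have -> : m (cube r : set 'rV[R]_n) = ((2 * r) ^+ n)%:E.
  exact: (lebesgue_rV_cube n (ltW r0)).
rewrite lee_fin leNgt exprn_gt0// mulr_gt0//.
Qed.

(** Equality at a point where [u] is finite would make the integral of [(P - Q)(b - a)] vanish; yet
    this integrand is positive almost everywhere, because [Gl_b_lt] gives [a < b] even where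
    [G = Gl]. *)
Lemma kelvin_strict : (forall x, pball l x -> u x <= kelvin x) ->
  forall x, pball l x -> u x < +oo -> u x < kelvin x.
Proof.
move=> H x xl ux; rewrite ltNge; apply/negP => le.
have [_ _ upos _ _] := su.
pose f1 y := (P x y * a y + Q x y * b y)%R.
pose f2 y := (Q x y * a y + P x y * b y)%R.
(* The difference is nonnegative only almost everywhere; truncation makes it nonnegative everywhere,
   so that additivity of the integral applies. *)
pose f3 y := Num.max (f2 y - f1 y)%R 0%R.
have f30 y : (0 <= f3 y)%R by rewrite le_max lexx orbT.
have mf3 : measurable_fun (pball l) (fun y => (f3 y)%:E).
  apply/measurable_EFinP; apply: measurable_maxr => //.
  by apply: measurable_funB; apply/measurable_EFinP; [exact: mQPab|exact: mPQab].
have f12 : {ae m, forall y, pball l y -> (f1 y < f2 y)%R}.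
  apply: filterS3 ae_fin ae_inversion_fin (ae_neq x) => y uy uiy xy yl.
  have G0 : (0 < G y)%R by rewrite fine_gt0// upos/= ltey_eq uy.
  have Gy : (G y <= Gl y)%R.
    have := H y yl; rewrite (kelvinE (uiy yl)) -[u y]fineK//.
  have ab : (a y < b y)%R.
    apply: le_lt_trans (Gl_b_lt yl (lt_le_trans G0 Gy)).
    by apply: ler_powR2r => //; exact: le_trans ler01 mu1.
  rewrite -subr_gt0 /f1 /f2.
  have -> : (Q x y * a y + P x y * b y - (P x y * a y + Q x y * b y) =
    (P x y - Q x y) * (b y - a y))%R by ring.
  by rewrite mulr_gt0 ?subr_gt0// kriesz_lt.
have E2 : kelvin x = u x + \int[m]_(y in pball l) (f3 y)%:E.
  rewrite (kelvin_pball xl) (solution_pball xl) -ge0_integralD; last 5 first.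
  - exact: mP.
  - by move=> y _; rewrite lee_fin.
  - exact: mPQab.
  - by move=> y _; rewrite lee_fin.
  - exact: mf3.
  apply: ge0_ae_eq_integral.
  - exact: mP.
  - exact: mQPab.
  - by apply: emeasurable_funD; [exact: mPQab|exact: mf3].
  - by move=> y _; rewrite lee_fin.
  - by move=> y _; rewrite -EFinD lee_fin addr_ge0.
  apply: filterS f12 => y lt yl; rewrite -EFinD; congr EFin.
  by rewrite /f3 max_l ?subr_ge0 ?(ltW (lt yl))// /f1 /f2; ring.
have uf : u x \is a fin_num by rewrite ge0_fin_numE// ltW.
have I0 : \int[m]_(y in pball l) `|(f3 y)%:E| = 0.
  have -> : \int[m]_(y in pball l) `|(f3 y)%:E| = \int[m]_(y in pball l) (f3 y)%:E.
    by apply: eq_integral => y _; rewrite gee0_abs// lee_fin.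
  apply/eqP; rewrite eq_le integral_ge0 ?andbT; last by move=> y _; rewrite lee_fin.
  move: le; rewrite E2 -{2}(adde0 (u x)) leeD2lE//.
apply: pball_nonnull.
move/(ae_eq_integral_abs m mP mf3) : I0 => f3_0.
apply: filterS2 f12 f3_0 => y lt /[swap] yl /(_ yl)/= [] /eqP.
by rewrite /f3 max_l ?subr_ge0 ?(ltW (lt yl))// subr_eq0 gt_eqF// lt.
Qed.

End comparison.

(** * Moving spheres *)

Section small.
Context (R : realType) (n : nat) (g mu : R) (u : 'rV[R]_n -> \bar R).
Local Notation m := (lebesgue_rV R n).
Hypotheses (n0 : (0 < n)%N) (g0 : 0 < g) (gn : g < n%:R) (mu1 : 1 < mu).
Hypotheses (mug : n%:R < mu * g) (kap0 : 0 < 2 * n%:R - g - g * mu).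
Hypothesis su : regular_solution g mu u.

Let G y := fine (u y).
Let q := n%:R * (mu - 1) / (n%:R - g).
(** With [g = n - alpha] this is [alpha / n], and [al * q = mu - 1]: the power [al] of [G^q] is
    [G^(mu - 1)]. *)
Let al := (n%:R - g) / n%:R.
Let K : R := (Num.bound mu)%:R.

Let nR0 : 0 < n%:R :> R. Proof. by rewrite ltr0n. Qed.
Let ng0 : 0 < n%:R - g. Proof. by rewrite subr_gt0. Qed.
Let al0 : 0 < al. Proof. by rewrite divr_gt0. Qed.
Let q0 : 0 < q. Proof. by rewrite divr_gt0// mulr_gt0// subr_gt0. Qed.
Let K0 : 0 <= K. Proof. exact: ler0n. Qed.

(** Equivalent to [mu g > n]. It yields [al + q^-1 < 1]; for [mu = n/g] this sum would be [1], the
    excluded endpoint. *)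
Let q_gt : n%:R / g < q.
Proof.
rewrite /q ltr_pdivlMr// mulrAC ltr_pdivrMr// -mulrA ltr_pM2l//.
by rewrite mulrBl mul1r ltrD2r.
Qed.

Let qV : q^-1 < g / n%:R.
Proof. by rewrite -(invf_div n%:R g) ltf_pV2// posrE divr_gt0. Qed.

Let gn1 : g / n%:R < 1. Proof. by rewrite ltr_pdivrMr// mul1r. Qed.

Let q1 : 1 < q.
Proof. by rewrite -(invf_lt1 q0); exact: lt_trans qV gn1. Qed.

Let alE : al = 1 - g / n%:R.
Proof. by rewrite /al mulrBl divff// gt_eqF. Qed.

Definition bad (l : R) : set 'rV[R]_n :=
  [set y | pball l y /\ (kelvin g u l y < u y)%E].

Local Open Scope ereal_scope.

Let mu_ : measurable_fun setT u. Proof. by case: su. Qed.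

Let mG : measurable_fun setT G.
Proof. exact: (measurableT_comp (fine_measurable measurableT) mu_). Qed.

Let G_ge0 y : (0 <= G y)%R.
Proof. by have [_ _ upos _ _] := su; exact/fine_ge0/ltW. Qed.

Lemma measurable_kelvin l : measurable_fun setT (kelvin g u l).
Proof.
apply: emeasurable_funM.
  by apply/measurable_EFinP; exact: (measurable_fun_powR_base _ (@measurable_kfac R n l)).
exact: (measurableT_comp mu_ (@measurable_inversion R n l)).
Qed.

Lemma measurable_bad l : measurable (bad l).
Proof.
have -> : bad l = pball l `&` [set y | kelvin g u l y < u y] by [].
apply: measurableI; first exact: measurable_pball.
rewrite -[X in measurable X]setTI.
by apply: measurable_lte => //; exact: measurable_kelvin.
Qed.

(** The first exponent turns [W^q] into [W^(q - 1)]; the second splits into [al] for [G^(mu - 1)]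
    and [q^-1] for one factor [W]; the third belongs to the kernel. *)
Let hls_params : [/\ (0 < 1 - q^-1)%R, (1 - q^-1 < 1)%R, (0 < al + q^-1)%R,
  (al + q^-1 < 1)%R & (1 - q^-1 + (al + q^-1) + g / n%:R = 2)%R].
Proof.
have qi0 : (0 < q^-1)%R by rewrite invr_gt0.
split.
- by rewrite subr_gt0 invf_lt1.
- by rewrite gtrBl.
- exact: addr_gt0.
- by rewrite alE -addrA gtrDl addrC subr_lt0.
- by rewrite alE; ring.
Qed.

Let hls : exists2 C : R, (0 <= C)%R &
  forall F H : 'rV[R]_n -> R, measurable_fun setT F -> measurable_fun setT H ->
  (forall x, 0 <= F x)%R -> (forall x, 0 <= H x)%R ->
  \int[m]_x \int[m]_y (F x `^ (1 - q^-1) * H y `^ (al + q^-1) * riesz g x y)%:E <=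
  (\int[m]_x (F x)%:E) * (\int[m]_y (H y)%:E) +
  C%:E * (\int[m]_x (F x)%:E + \int[m]_y (H y)%:E).
Proof.
have [h1 h2 h3 h4 h5] := hls_params.
have gn0 : (0 < g / n%:R)%R by rewrite divr_gt0.
have [C C0 HC] := hardy_littlewood_sobolev n0 h1 h2 h3 h4 gn0 gn1 h5.
have E : (n%:R * (g / n%:R) = g)%R by rewrite mulrC divfK// gt_eqF.
rewrite E in HC; exists C; [exact: C0|exact: HC].
Qed.

Section fixed_radius.
Variables (l eps : R).
Hypotheses (l0 : (0 < l)%R) (eps0 : (0 < eps)%R).

Let Gl x : R := (kfac l x `^ g * G (inversion l x))%R.

Let W y : R := ((\1_(pball l) y : R) * Num.max (G y - Gl y) 0)%R.

Let W0 y : (0 <= W y)%R.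
Proof. by rewrite mulr_ge0// ?indicE// le_max lexx orbT. Qed.

Let Gl0 y : (0 <= Gl y)%R. Proof. by rewrite mulr_ge0 ?powR_ge0. Qed.

Let WG y : (W y <= G y)%R.
Proof.
rewrite /W indicE; case: (_ \in _); last by rewrite mul0r.
by rewrite mul1r ge_max G_ge0 gerBl Gl0.
Qed.

Let mGl : measurable_fun setT Gl.
Proof.
apply: measurable_funM.
  exact: (measurable_fun_powR_base _ (@measurable_kfac R n l)).
exact: (measurableT_comp mG (@measurable_inversion R n l)).
Qed.

Let mW : measurable_fun setT W.
Proof.
apply: measurable_funM; first by apply: measurable_indic; exact: measurable_pball.
by apply: measurable_maxr => //; exact: measurable_funB.
Qed.

Let KGW0 x y : (0 <= riesz g x y * (K * G y `^ (mu - 1) * W y))%R.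
Proof.
apply: mulr_ge0; first exact: riesz_ge0.
by apply: mulr_ge0; [rewrite mulr_ge0 ?powR_ge0|exact: W0].
Qed.

Let T x := \int[m]_y (riesz g x y * (K * G y `^ (mu - 1) * W y))%:E.

Let T0 x : 0 <= T x.
Proof.
by apply: integral_ge0 => y _; rewrite lee_fin.
Qed.

Let ae_fin : {ae m, forall y, u y \is a fin_num}. Proof. by case: su. Qed.

Let ae_ifin : {ae m, forall y, pball l y -> u (inversion l y) \is a fin_num}.
Proof. exact: (ae_inversion_fin n0 su l0). Qed.

Let W_le_T : {ae m, forall x, (W x)%:E <= T x}.
Proof.
apply: filterS2 ae_fin ae_ifin => x ux uix.
have [xl|nxl] := pselect (pball l x); last first.
  by rewrite /W indicE memNset// mul0r.
rewrite /W indicE mem_set// mul1r.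
have [GGl|GlG] := leP (G x - Gl x)%R 0%R; first exact: T0.
have := solution_le_kelvinD n0 g0 (ltW mu1) kap0 su l0 xl.
rewrite (kelvinE _ (uix xl)) -(fineK ux) -/(G x).
have -> : \int[m]_(y in pball l) (riesz g x y * ((Num.bound mu)%:R * fine (u y) `^ (mu - 1) *
    Num.max (fine (u y) - kfac l y `^ g * fine (u (inversion l y))) 0))%:E = T x.
  rewrite integral_mkcond; apply: eq_integral => y _; rewrite /patch /W indicE.
  by case: ifPn => _; rewrite ?mul1r// mul0r !mulr0.
by rewrite -leeBlDl// -EFinB.
Qed.

Let Nq := \int[m]_x (W x `^ q)%:E.

Let mWq : measurable_fun setT (fun x => (W x `^ q)%:E).
Proof. by apply/measurable_EFinP; exact: (measurable_fun_powR_base _ mW). Qed.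

Let J (z : 'rV[R]_n * 'rV[R]_n) : \bar R :=
  (W z.1 `^ (q - 1) * (riesz g z.1 z.2 * (K * G z.2 `^ (mu - 1) * W z.2)))%:E.

Let mriesz2 : measurable_fun setT (fun z : 'rV[R]_n * 'rV[R]_n => riesz g z.1 z.2).
Proof. exact: (measurable_fun_powR_base _ (@measurable_enorm_sub2 R n)). Qed.

Let J0 z : 0 <= J z.
Proof. by rewrite lee_fin; apply: mulr_ge0; [exact: powR_ge0|exact: KGW0]. Qed.

Let mJ : measurable_fun setT J.
Proof.
apply/measurable_EFinP; apply: measurable_funM.
  exact: (measurable_fun_powR_base _ (measurableT_comp mW measurable_fst)).
apply: measurable_funM; first exact: mriesz2.
apply: measurable_funM; last exact: (measurableT_comp mW measurable_snd).
apply: measurable_funM => //.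
exact: (measurable_fun_powR_base _ (measurableT_comp mG measurable_snd)).
Qed.

(** Duality: [W <= T] is multiplied by [W^(q - 1)] and integrated. *)
Let Nq_le_J : Nq <= \int[m]_x \int[m]_y J (x, y).
Proof.
apply: ae_ge0_le_integral.
- exact: measurableT.
- by move=> x _; rewrite lee_fin powR_ge0.
- exact: mWq.
- by move=> x _; apply: integral_ge0 => y _; exact: J0.
- exact: (measurable_fun_fubini_tonelli_F J mJ J0).
apply: filterS W_le_T => x WT _.
have -> : \int[m]_y J (x, y) = (W x `^ (q - 1))%:E * T x.
  rewrite -ge0_integralZl.
  - by apply: eq_integral => y _; rewrite /J/= EFinM.
  - exact: measurableT.
  - apply/measurable_EFinP; apply: measurable_funM; first exact: measurable_riesz.
    apply: measurable_funM; last exact: mW.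
    by apply: measurable_funM => //; exact: (measurable_fun_powR_base _ mG).
  - by move=> y _; rewrite lee_fin.
  - by rewrite lee_fin powR_ge0.
have [->|Wn0] := eqVneq (W x) 0%R.
  by rewrite powR0 ?gt_eqF// mule_ge0 ?lee_fin ?powR_ge0.
have Wp : (0 < W x)%R by rewrite lt_def Wn0 W0.
have -> : (W x `^ q = W x `^ (q - 1) * W x)%R.
  by rewrite -[X in _ = (_ * X)%R]powRr1// -powRD_gt0// subrK.
by rewrite EFinM lee_pmul2l// ?lte_fin ?powR_gt0.
Qed.

Hypothesis badle : \int[m]_(y in bad l) (G y `^ q)%:E <= eps%:E.

Section normalized.
Variable N : R.
Hypotheses (N0 : (0 < N)%R) (NE : Nq = N%:E).

Let F x : R := (W x `^ q / N)%R.
(** A sum of two normalized densities, of total mass at most [2]. On the bad set it dominates both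
    [G^q / eps] and [W^q / N], so its power [al + q^-1] controls the product [G^(mu - 1) W]. The
    normalization is needed since the inequality to be applied is not homogeneous. *)
Let H y : R := ((\1_(bad l) y : R) * G y `^ q / eps + W y `^ q / N)%R.

Let F0 x : (0 <= F x)%R. Proof. by rewrite divr_ge0 ?powR_ge0// ltW. Qed.

Let H0 x : (0 <= H x)%R.
Proof.
by rewrite addr_ge0// divr_ge0 ?mulr_ge0 ?powR_ge0 ?indicE ?(ltW eps0) ?(ltW N0).
Qed.

Let mF : measurable_fun setT F.
Proof. by apply: measurable_funM => //; exact: (measurable_fun_powR_base _ mW). Qed.

Let mbG : measurable_fun setT (fun y => (\1_(bad l) y : R) * G y `^ q)%R.
Proof.
apply: measurable_funM; first by apply: measurable_indic; exact: measurable_bad.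
exact: (measurable_fun_powR_base _ mG).
Qed.

Let mH : measurable_fun setT H.
Proof. by apply: measurable_funD; [apply: measurable_funM|exact: mF]. Qed.

Let intF : \int[m]_x (F x)%:E = 1.
Proof.
rewrite /F; under eq_integral do rewrite mulrC EFinM.
rewrite ge0_integralZl.
- by rewrite -/Nq NE -EFinM mulVf// gt_eqF.
- exact: measurableT.
- exact: mWq.
- by move=> x _; rewrite lee_fin powR_ge0.
- by rewrite lee_fin invr_ge0 ltW.
Qed.

Let intH : \int[m]_y (H y)%:E <= 2%:E.
Proof.
rewrite /H; under eq_integral do rewrite EFinD.
rewrite ge0_integralD; last 5 first.
- exact: measurableT.
- move=> y _; rewrite lee_fin divr_ge0 ?(ltW eps0)//.
  by rewrite mulr_ge0 ?powR_ge0 ?indicE.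
- by apply/measurable_EFinP; apply: measurable_funM.
- by move=> y _; rewrite lee_fin; exact: F0.
- by apply/measurable_EFinP; exact: mF.
rewrite -/F intF (_ : 2%:E = 1 + 1); last by rewrite -EFinD.
rewrite leeD2r//.
under eq_integral do rewrite mulrC EFinM.
rewrite ge0_integralZl.
- rewrite (_ : \int[m]_y _ = \int[m]_(y in bad l) (G y `^ q)%:E); last first.
    rewrite [RHS]integral_mkcond; apply: eq_integral => y _; rewrite /patch indicE.
    by case: ifPn => _; rewrite ?mul1r ?mul0r.
  by rewrite muleC lee_pdivrMr// mul1e.
- exact: measurableT.
- exact/measurable_EFinP.
- by move=> y _; rewrite lee_fin mulr_ge0 ?powR_ge0 ?indicE.
- by rewrite lee_fin invr_ge0 ltW.
Qed.

Let W_bad : {ae m, forall y, W y != 0%R -> bad l y}.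
Proof.
apply: filterS2 ae_fin ae_ifin => y uy uiy.
have [yl|nyl] := pselect (pball l y); last first.
  by rewrite /W indicE memNset// mul0r eqxx.
rewrite /W indicE mem_set// mul1r.
have [GGl|GlG] := leP (G y - Gl y)%R 0%R; first by rewrite eqxx.
move=> _; split => //.
by rewrite (kelvinE _ (uiy yl)) -(fineK uy) lte_fin -subr_gt0.
Qed.

Let c0 : R := (K * (eps `^ al * N))%R.

(** In [c0], the factor [N] is [N^(1 - 1/q)] from [F] times [N^(1/q)] from [H], and [eps^al] comes
    from the bound on [G^(mu - 1)]. *)
Let J_le_hls : \int[m]_x \int[m]_y J (x, y) <= c0%:E *
  \int[m]_x \int[m]_y (F x `^ (1 - q^-1) * H y `^ (al + q^-1) * riesz g x y)%:E.
Proof.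
have c00 : (0 <= c0)%R by rewrite !mulr_ge0 ?powR_ge0// ltW.
pose L (z : 'rV[R]_n * 'rV[R]_n) : \bar R :=
  (F z.1 `^ (1 - q^-1) * H z.2 `^ (al + q^-1) * riesz g z.1 z.2)%:E.
have L0 z : 0 <= L z by rewrite lee_fin !mulr_ge0 ?powR_ge0 ?riesz_ge0.
have mL : measurable_fun setT L.
  apply/measurable_EFinP; apply: measurable_funM; last exact: mriesz2.
  apply: measurable_funM.
    exact: (measurable_fun_powR_base _ (measurableT_comp mF measurable_fst)).
  exact: (measurable_fun_powR_base _ (measurableT_comp mH measurable_snd)).
have mIL := measurable_fun_fubini_tonelli_F (m2 := m) L mL L0.
have IL0 x : 0 <= \int[m]_y L (x, y) by apply: integral_ge0 => y _; exact: L0.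
rewrite -ge0_integralZl; last 4 first.
- exact: measurableT.
- exact: mIL.
- by move=> x _; exact: IL0.
- by rewrite lee_fin.
apply: ge0_le_integral.
- exact: measurableT.
- by move=> x _; apply: integral_ge0 => y _; exact: J0.
- exact: (measurable_fun_fubini_tonelli_F J mJ J0).
- by apply: measurable_funeM; exact: mIL.
move=> x _.
rewrite -ge0_integralZl; last 4 first.
- exact: measurableT.
- exact: (measurableT_comp mL (pair1_measurable x)).
- by move=> y _; exact: (L0 (x, y)).
- by rewrite lee_fin.
apply: ae_ge0_le_integral.
- exact: measurableT.
- by move=> y _; exact: J0.
- exact: (measurableT_comp mJ (pair1_measurable x)).
- by move=> y _; rewrite mule_ge0//; exact: (L0 (x, y)).
- by apply: measurable_funeM; exact: (measurableT_comp mL (pair1_measurable x)).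
apply: filterS W_bad => y Wbad _; rewrite /J /L/= -EFinM lee_fin.
have NF : (W x `^ (q - 1) = N `^ (1 - q^-1) * F x `^ (1 - q^-1))%R.
  rewrite -powRM ?(ltW N0)// /F mulrC divfK ?gt_eqF// -powRrM; congr (_ `^ _)%R.
  by rewrite mulrBr mulr1 divff// gt_eqF.
have key : (G y `^ (mu - 1) * W y <= eps `^ al * N `^ q^-1 * H y `^ (al + q^-1))%R.
  have [->|Wn0] := eqVneq (W y) 0%R; first by rewrite mulr0 !mulr_ge0 ?powR_ge0.
  have Wp : (0 < W y)%R by rewrite lt_def Wn0 W0.
  have Hge1 : (G y `^ q <= eps * H y)%R.
    rewrite /H indicE mem_set ?mul1r; last exact: Wbad.
    rewrite mulrDr mulrC divfK ?gt_eqF// lerDl.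
    by rewrite mulr_ge0 ?divr_ge0 ?powR_ge0 ?(ltW eps0) ?(ltW N0).
  have Hge2 : (W y `^ q <= N * H y)%R.
    rewrite /H mulrDr [(N * (_ / N))%R]mulrC divfK ?gt_eqF// lerDr.
    rewrite mulr_ge0 ?(ltW N0)// divr_ge0 ?(ltW eps0)//.
    by rewrite mulr_ge0 ?powR_ge0 ?indicE.
  have Hp : (0 < H y)%R.
    by rewrite -(pmulr_rgt0 _ N0); apply: lt_le_trans Hge2; rewrite powR_gt0.
  have -> : (G y `^ (mu - 1) = (G y `^ q) `^ al)%R.
    rewrite -powRrM; congr (_ `^ _)%R; rewrite /q /al; field.
    by rewrite !gt_eqF.
  have -> : (W y = (W y `^ q) `^ q^-1)%R.
    by rewrite -powRrM divff ?gt_eqF// powRr1.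
  rewrite (powRD_gt0 al q^-1 Hp).
  have -> : (eps `^ al * N `^ q^-1 * (H y `^ al * H y `^ q^-1) =
    (eps * H y) `^ al * (N * H y) `^ q^-1)%R.
    by rewrite !powRM ?(ltW eps0) ?(ltW N0)//; ring.
  apply: ler_pM; rewrite ?powR_ge0//.
    by apply: ler_powR2r => //; [exact: ltW|exact: powR_ge0].
  by apply: ler_powR2r => //; [rewrite invr_ge0 ltW|exact: powR_ge0].
have N1 : (N = N `^ (1 - q^-1) * N `^ q^-1)%R.
  by rewrite -powRD_gt0// subrK powRr1// ltW.
rewrite NF.
have -> : (c0 * (F x `^ (1 - q^-1) * H y `^ (al + q^-1) * riesz g x y) =
  (N `^ (1 - q^-1) * F x `^ (1 - q^-1) * riesz g x y * K) *
  (eps `^ al * N `^ q^-1 * H y `^ (al + q^-1)))%R.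
  by rewrite /c0 {1}N1; ring.
have -> : (N `^ (1 - q^-1) * F x `^ (1 - q^-1) * (riesz g x y * (K * G y `^ (mu - 1) * W y)) =
  (N `^ (1 - q^-1) * F x `^ (1 - q^-1) * riesz g x y * K) * (G y `^ (mu - 1) * W y))%R.
  by ring.
by apply: ler_wpM2l => //; rewrite !mulr_ge0 ?powR_ge0 ?riesz_ge0.
Qed.

(** The masses [1] and at most [2] give [N <= c0 (2 + 3 C)]; since [c0] is proportional to [N],
    division by [N] leaves a condition on [eps] alone, which a small [eps] violates. *)
Lemma moving_sphere_estimate (C : R) : (0 <= C)%R ->
  (forall F H : 'rV[R]_n -> R, measurable_fun setT F -> measurable_fun setT H ->
  (forall x, 0 <= F x)%R -> (forall x, 0 <= H x)%R ->
  \int[m]_x \int[m]_y (F x `^ (1 - q^-1) * H y `^ (al + q^-1) * riesz g x y)%:E <=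
  (\int[m]_x (F x)%:E) * (\int[m]_y (H y)%:E) +
  C%:E * (\int[m]_x (F x)%:E + \int[m]_y (H y)%:E)) ->
  (1 <= K * eps `^ al * (2 + 3 * C))%R.
Proof.
move=> C0 hC.
have c00 : (0 <= c0)%R by rewrite !mulr_ge0 ?powR_ge0// ltW.
have := le_trans (le_trans Nq_le_J J_le_hls) (lee_wpmul2l _ (hC F H mF mH F0 H0)).
rewrite lee_fin => /(_ c00); rewrite intF NE mul1e => NL.
have : N%:E <= c0%:E * (2%:E + C%:E * (1 + 2%:E)).
  apply: le_trans NL _; rewrite lee_wpmul2l ?lee_fin// leeD// lee_wpmul2l ?lee_fin//.
  by rewrite leeD2l.
rewrite -!(EFinD, EFinM) lee_fin /c0 => NL2.
rewrite -(ler_pM2l N0) mulr1; apply: le_trans NL2 _.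
by rewrite le_eqVlt; apply/orP; left; apply/eqP; ring.
Qed.

End normalized.

(** Finiteness of the integral over the ball makes [Nq] finite, because [W <= G]; the estimate then
    excludes [Nq > 0], so [W] vanishes almost everywhere. *)
Lemma small_bad_ae_le (C : R) : (0 <= C)%R ->
  (forall F H : 'rV[R]_n -> R, measurable_fun setT F -> measurable_fun setT H ->
  (forall x, 0 <= F x)%R -> (forall x, 0 <= H x)%R ->
  \int[m]_x \int[m]_y (F x `^ (1 - q^-1) * H y `^ (al + q^-1) * riesz g x y)%:E <=
  (\int[m]_x (F x)%:E) * (\int[m]_y (H y)%:E) +
  C%:E * (\int[m]_x (F x)%:E + \int[m]_y (H y)%:E)) ->
  (K * eps `^ al * (2 + 3 * C) < 1)%R ->
  \int[m]_(y in pball l) (G y `^ q)%:E < +oo ->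
  {ae m, forall y, pball l y -> (G y <= Gl y)%R}.
Proof.
move=> C0 HC small fin.
have Nq0 : 0 <= Nq by apply: integral_ge0 => x _; rewrite lee_fin powR_ge0.
have Nqfin : Nq < +oo.
  apply: le_lt_trans fin; rewrite [leRHS]integral_mkcond.
  apply: ge0_le_integral.
  - exact: measurableT.
  - by move=> x _; rewrite lee_fin powR_ge0.
  - exact: mWq.
  - apply/(measurable_restrictT _ (@measurable_pball R n l)).
    apply: measurable_funTS; apply/measurable_EFinP.
    exact: (measurable_fun_powR_base _ mG).
  move=> x _; rewrite /patch; case: ifPn => [_|xl].
    rewrite lee_fin; apply: ler_powR2r; [exact: ltW|exact: W0|exact: WG].
  by rewrite /W indicE (negbTE xl) mul0r powR0// gt_eqF.
have Nq_0 : Nq = 0.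
  apply/eqP; rewrite eq_le Nq0 andbT leNgt; apply/negP => Nqp.
  have NE : Nq = (fine Nq)%:E by rewrite fineK// ge0_fin_numE.
  have N0 : (0 < fine Nq)%R by rewrite fine_gt0// Nqp.
  by have := moving_sphere_estimate N0 NE C0 HC; rewrite leNgt small.
have : \int[m]_x `|(W x `^ q)%:E| = 0.
  rewrite -Nq_0; apply: eq_integral => x _.
  by rewrite gee0_abs// lee_fin powR_ge0.
move/(ae_eq_integral_abs m measurableT mWq); apply: filterS => y /(_ Logic.I)/= [] /eqP.
rewrite powR_eq0 => /andP[/eqP + _] yl.
rewrite /W indicE mem_set// mul1r => W_0.
by rewrite -subr_le0 -W_0 le_max lexx.
Qed.

End fixed_radius.

Lemma kelvin_small : exists2 eps : R, (0 < eps)%R & forall l, (0 < l)%R ->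
  \int[m]_(y in pball l) (G y `^ q)%:E < +oo ->
  \int[m]_(y in bad l) (G y `^ q)%:E <= eps%:E ->
  forall x, pball l x -> u x <= kelvin g u l x.
Proof.
have [C C0 HC] := hls.
(* With [eps^al = 1 / D] the quantity to be kept below [1] is [K / (2 (K + 1))]. No radius occurs in
   this choice, so one [eps] serves for all [l]. *)
pose D : R := (2 * (K + 1) * (2 + 3 * C))%R.
have K1 : (0 < K + 1)%R by rewrite ltr_wpDl.
have C1 : (0 < 2 + 3 * C)%R by rewrite ltr_pwDl// mulr_ge0.
have D0 : (0 < D)%R by rewrite mulr_gt0// mulr_gt0.
exists (D^-1 `^ al^-1)%R; first by rewrite powR_gt0 ?invr_gt0.
set eps := (_ `^ _)%R; move=> l l0 fin badle.
have eps0 : (0 < eps)%R by rewrite powR_gt0 ?invr_gt0.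
apply: (ae_le_kelvin_le n0 g0 (ltW mu1) kap0 su l0).
apply: (small_bad_ae_le l0 eps0 badle C0 HC _ fin).
have -> : (eps `^ al = D^-1)%R.
  by rewrite /eps -powRrM mulVf ?gt_eqF// powRr1// invr_ge0 ltW.
rewrite mulrAC ltr_pdivrMr// mul1r /D ltr_pM2r//.
apply: (@lt_le_trans _ _ (K + 1)%R); first by rewrite ltrDl.
by rewrite ler_peMl ?addr_ge0// ler1n.
Qed.

End small.

Lemma continuous_scale_rV (R : realType) (n : nat) (x : 'rV[R]_n) :
  continuous (fun t : R => t *: x).
Proof.
move=> a; apply/cvg_ballP => e e0.
have x1 : 0 < enorm x + 1 by rewrite ltr_wpDl ?enorm_ge0.
exists (e / (enorm x + 1)) => [|t /= at_]; first exact: divr_gt0.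
split=> // i j; rewrite (ord1 i).
rewrite /ball/= !mxE -mulrBl normrM.
move: at_; rewrite ltr_pdivlMr//; apply: le_lt_trans.
by rewrite ler_wpM2l// (le_trans (enorm_coord _ _))// lerDl.
Qed.

(** * The continuity argument in the radius *)

Section spheres.
Context (R : realType) (n : nat) (g mu : R) (u : 'rV[R]_n -> \bar R).
Local Notation m := (lebesgue_rV R n).
Hypotheses (n0 : (0 < n)%N) (g0 : 0 < g) (gn : g < n%:R) (mu1 : 1 < mu).
Hypotheses (mug : n%:R < mu * g) (kap0 : 0 < 2 * n%:R - g - g * mu).
Hypothesis su : regular_solution g mu u.

Let q := n%:R * (mu - 1) / (n%:R - g).
Local Open Scope ereal_scope.

Hypothesis locq : forall r, (0 < r)%R ->
  \int[m]_(y in cube r) (fine (u y) `^ q)%:E < +oo.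

Let mGq : measurable_fun setT (fun y => (fine (u y) `^ q)%:E).
Proof.
apply/measurable_EFinP; have [mu_ _ _ _ _] := su.
apply: (measurable_fun_powR_base q).
exact: (measurableT_comp (fine_measurable measurableT) mu_).
Qed.

Let Gq0 y : 0 <= (fine (u y) `^ q)%:E.
Proof. by rewrite lee_fin powR_ge0. Qed.

Lemma pball_sub_cube (l : R) : (pball l : set 'rV[R]_n) `<=` cube l.
Proof.
move=> x /andP[_ xl]; apply/cubeP => i.
exact: le_trans (enorm_coord _ _) (ltW xl).
Qed.

Let mcube (r : R) : measurable (cube r : set 'rV[R]_n).
Proof. exact: measurable_cube. Qed.

(** Dominated convergence, with the locally integrable function [u^q] as dominating function. *)
Lemma integral_vanishing (r eps : R) (E : nat -> set 'rV[R]_n) :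
  (0 < r)%R -> (0 < eps)%R ->
  (forall k, measurable (E k)) -> (forall k, E k `<=` cube r) ->
  {ae m, forall y, \forall k \near \oo, ~ E k y} ->
  exists k, \int[m]_(y in E k) (fine (u y) `^ q)%:E < eps%:E.
Proof.
move=> r0 eps0 mE Er aeE; apply: contrapT => nE.
pose h := fun y => (fine (u y) `^ q)%:E.
pose f k := h \_ (E k).
have mf k : measurable_fun (cube r : set 'rV[R]_n) (f k).
  by apply: measurable_funTS; apply/(measurable_restrictT _ (mE k)); exact: measurable_funTS.
have cf : {ae m, forall y, cube r y -> f ^~ y @ \oo --> (cst 0 : 'rV[R]_n -> \bar R) y}.
  apply: filterS aeE => y Ey _; apply: (@cvg_near_cst _ _ (0 : \bar R)).
  apply: filterS Ey => k Eky; apply/eqP; rewrite /f /patch.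
  by case: ifPn => //; rewrite inE.
have ih : m.-integrable (cube r) h.
  apply/integrableP; split; first exact: measurable_funTS.
  rewrite (eq_integral h) ?locq// => y _; exact: (gee0_abs (Gq0 y)).
have fh : {ae m, forall y k, cube r y -> `|f k y| <= h y}.
  apply: aeW => y k _; rewrite /f /patch; case: ifPn => _; last by rewrite abse0; exact: Gq0.
  by rewrite (gee0_abs (Gq0 y)).
have [_ _] := dominated_convergence (mcube r) mf (measurable_cst _) cf ih fh.
rewrite integral0 => c0.
have : eps%:E <= 0.
  rewrite -(cvg_lim _ c0)//; apply: lime_ge; first by apply/cvg_ex; exists 0.
  apply: nearW => k; rewrite leNgt; apply/negP => kE; apply: nE; exists k.
  rewrite (_ : \int[m]_(y in E k) _ = \int[m]_(y in cube r) f k y)//.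
  by rewrite /f -integral_mkcondr setIidr//; exact: Er.
by rewrite lee_fin leNgt eps0.
Qed.

Definition sphere_comparison (l : R) := forall x, pball l x -> u x <= kelvin g u l x.

Lemma inversion_scale (l t : R) (x : 'rV[R]_n) : (0 < l)%R -> (0 < t)%R -> x != 0%R ->
  inversion (t * l) (t ^+ 2 *: x)%R = inversion l x.
Proof.
move=> l0 t0 x0; rewrite /inversion scalerA; congr (_ *: _).
rewrite enormZ ger0_norm ?exprn_ge0 ?(ltW t0)//; field.
by rewrite !gt_eqF ?enorm_gt0.
Qed.

(** Letting only the radius tend to [L] would require upper semicontinuity of [u] at the moving
    reflected point. Instead radius [t L] is paired with the point [t^2 x], whose reflected point is
    that of [x] by [inversion_scale]. Comparison gives [u (t^2 x) <= t^-g kelvin], with [kelvin]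
    taken at [L] and [x], and lower semicontinuity at [x] suffices as [t] increases to [1]. *)
Lemma sphere_comparison_closed (L : R) : (0 < L)%R ->
  (forall l, (0 < l)%R -> (l < L)%R -> sphere_comparison l) -> sphere_comparison L.
Proof.
move=> L0 H x xL; rewrite leNgt; apply/negP => kx.
have [_ lu upos _ _] := su; have x0 := pball_neq0 xL; have e0 := enorm_gt0 x.
have th0 := kfac_gt0 L0 x0.
have /andP[_ xL'] := xL.
have c0 : 0 < kelvin g u L x by rewrite mule_gt0 ?lte_fin ?powR_gt0.
have cf : kelvin g u L x \is a fin_num.
  by rewrite ge0_fin_numE ?(ltW c0)//; apply: lt_le_trans kx _; exact: leey.
set c := fine (kelvin g u L x).
have cE : kelvin g u L x = c%:E by rewrite /c fineK.
have {}c0 : (0 < c)%R by rewrite -lte_fin -cE.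
have [c' cc' c'u] : exists2 c' : R, (c < c')%R & c'%:E < u x.
  move: kx; rewrite cE; case: (u x) => [v| |]//.
    by rewrite lte_fin => cv; exists ((c + v) / 2)%R; rewrite ?lte_fin ?midf_lt.
  by move=> _; exists (c + 1)%R; rewrite ?ltrDl ?ltry.
have [V nV Vu] := lu x c' c'u.
have cts : (fun t : R => t ^+ 2 *: x)%R @ (1:R)%R --> x.
  rewrite [X in _ --> X](_ : x = (1 ^+ 2 *: x)%R); last by rewrite expr1n scale1r.
  apply: (@continuous_comp _ _ _ (fun t : R => t ^+ 2)%R (fun t : R => t *: x)%R).
    exact: exprn_continuous.
  exact: continuous_scale_rV.
have nV1 : \forall t \near (1:R)%R, V (t ^+ 2 *: x)%R by exact: cts.
have ctg : (fun t : R => t `^ (- g) * c)%R @ (1:R)%R --> c.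
  rewrite [X in _ --> X](_ : c = (1 `^ (- g) * c)%R); last by rewrite powR1 mul1r.
  by apply: cvgM; [exact: continuous_powR_gt0|exact: cvg_cst].
have nc : \forall t \near (1:R)%R, (t `^ (- g) * c < c')%R.
  exact: (cvgr_lt _ ctg).
have : \forall t \near (1:R)%R^'-, False; last first.
  by move=> /filter_ex[].
have n0t : \forall t \near (1:R)%R^'-, (0 < t)%R.
  by apply: nbhs_left_gt.
near=> t.
have t0 : (0 < t)%R by near: t.
have t1 : (t < 1)%R by near: t; exact: nbhs_left_lt.
have /Vu : V (t ^+ 2 *: x)%R.
  by near: t; exact: cvg_at_left_filter nV1.
apply/negP; rewrite -leNgt.
have tL : pball (t * L) (t ^+ 2 *: x)%R.
  rewrite /pball/= enormZ ger0_norm ?exprn_ge0 ?(ltW t0)//.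
  rewrite mulr_gt0 ?exprn_gt0 ?enorm_gt0//= expr2 -mulrA ltr_pM2l//.
  by apply: lt_trans xL'; rewrite gtr_pMl// enorm_gt0.
apply: le_trans (H (t * L)%R _ _ _ tL) _.
- by rewrite mulr_gt0.
- by rewrite gtr_pMl.
rewrite /kelvin inversion_scale//.
have -> : kfac (t * L) (t ^+ 2 *: x) = (t^-1 * kfac L x)%R.
  rewrite /kfac enormZ ger0_norm ?exprn_ge0 ?(ltW t0)//; field.
  by rewrite !gt_eqF ?enorm_gt0.
rewrite powRM ?invr_ge0 ?(ltW t0) ?(ltW th0)// EFinM -muleA.
rewrite -/(kelvin g u L x) cE -EFinM lee_fin.
rewrite -(powR_inv1 (ltW t0)) -powRrM mulN1r; apply/ltW.
by near: t; exact: cvg_at_left_filter nc.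
Unshelve. all: by end_near. Qed.

Lemma ae_enorm_neq (L : R) : (0 <= L)%R -> {ae m, forall y, enorm y != L}.
Proof.
move=> L0; exists [set y | enorm y = L]; split.
- exact: measurable_sphere.
- move: L0; rewrite le_eqVlt => /predU1P[<-|L0]; last exact: lebesgue_rV_sphere.
  rewrite (_ : mkset _ = [set 0%R]); first exact: lebesgue_rV_set1.
  by apply/seteqP; split=> y /= /eqP; [rewrite enorm_eq0 => /eqP|rewrite -enorm_eq0 => /eqP].
- by move=> y /= /negP/negPn/eqP.
Qed.

(** If radii [l_ k] with failing comparison decreased to [L], almost every [y] would eventually
    leave the bad sets, whose [u^q]-mass would then be small for some [k], and [kelvin_small] would
    give comparison at [l_ k]. For [L = 0] the assumption is void and the result starts the argument
    with small spheres. *)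
Lemma sphere_comparison_open (L : R) : (0 <= L)%R ->
  ((0 < L)%R -> sphere_comparison L) ->
  exists2 d : R, (0 < d)%R &
    forall l, (L < l)%R -> (l < L + d)%R -> sphere_comparison l.
Proof.
move=> L0 HL; apply: contrapT => nd.
have [eps eps0 small] := kelvin_small n0 g0 gn mu1 mug kap0 su.
have /choice[l_ l_P] : forall k, exists l : R,
    [/\ (L < l)%R, (l < L + k.+1%:R^-1)%R & ~ sphere_comparison l].
  move=> k; apply: contrapT => nk; apply: nd; exists (k.+1%:R^-1)%R.
    by rewrite invr_gt0.
  move=> l Ll lL; apply: contrapT => nl; apply: nk; by exists l.
have l0 k : (0 < l_ k)%R by have [h _ _] := l_P k; exact: le_lt_trans L0 h.
have lcvg : l_ @ \oo --> L.
  apply/cvgrPdist_lt => e e0; near=> k.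
  have [h1 h2 _] := l_P k.
  rewrite distrC ger0_norm; last by rewrite subr_ge0 ltW.
  rewrite ltrBlDl; apply: lt_trans h2 _; rewrite ltrD2l.
  by near: k; exact: (near_infty_natSinv_lt (PosNum e0)).
have L1 : (0 < L + 1)%R by rewrite ltr_wpDl.
have lL1 k : (l_ k <= L + 1)%R.
  have [_ h2 _] := l_P k; rewrite ltW// (lt_le_trans h2)// lerD2l.
  by rewrite invf_le1// ler1n.
have ballc k : (pball (l_ k) : set 'rV[R]_n) `<=` cube (L + 1)%R.
  by apply: subset_trans (@pball_sub_cube _) _; exact: sub_cube.
have aeE : {ae m, forall y, \forall k \near \oo, ~ bad g u (l_ k) y}.
  have [_ lu _ ufin _] := su.
  apply: filterS2 ufin (ae_enorm_neq L0) => y uy yL.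
  have [{}yL|Ly] := ltP (enorm y) L; last first.
    have {yL}Ly : (L < enorm y)%R by rewrite lt_neqAle eq_sym yL.
    have : \forall k \near \oo, (l_ k < enorm y)%R by exact: (cvgr_lt _ lcvg).
    by apply: filterS => k lk [/andP[_ /(lt_trans lk)]]; rewrite ltxx.
  have [->|y0] := eqVneq y 0%R.
    by apply: nearW => k [/pball_neq0]; rewrite eqxx.
  have e0 : (0 < enorm y)%R by rewrite enorm_gt0.
  have {}L0 : (0 < L)%R by exact: lt_trans e0 yL.
  have yLb : pball L y by rewrite /pball/= e0.
  have uyoo : u y < +oo by rewrite ltey_eq uy.
  have := kelvin_strict n0 g0 (ltW mu1) kap0 su L0 (HL L0) yLb uyoo.
  have th0 := kfac_gt0 L0 y0.
  have thg : (0 < kfac L y `^ g)%R by rewrite powR_gt0.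
  (* The strict inequality is put as a lower bound on [u] at the reflected point, where lower
     semicontinuity preserves it; the factor [kfac] only grows with the radius. *)
  rewrite -[u y]fineK// /kelvin -lte_pdivrMl// -EFinM => /lu[V nV Vu].
  have ci : inversion (l_ k) y @[k --> \oo] --> inversion L y.
    have cl : (l_ k ^+ 2 / enorm y ^+ 2)%R @[k --> \oo] --> (L ^+ 2 / enorm y ^+ 2)%R.
      by apply: cvgM; [apply: cvgM|exact: cvg_cst].
    exact: cvg_comp cl (@continuous_scale_rV R n y _).
  have : \forall k \near \oo, V (inversion (l_ k) y) by exact: ci.
  apply: filterS => k /Vu Vk [_]; apply/negP; rewrite -leNgt /kelvin.
  apply: (@le_trans _ _ ((kfac L y `^ g)%:E * u (inversion (l_ k) y))).
    by apply/ltW; rewrite -[u y]fineK// -lte_pdivrMl// -EFinM.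
  have [_ _ upos _ _] := su.
  rewrite lee_wpmul2r ?(ltW (upos _))// lee_fin; apply: ler_powR2r; [exact: ltW|exact: ltW|].
  have [h1 _ _] := l_P k.
  by rewrite /kfac ler_pM2r ?invr_gt0// ltW.
have [k] := integral_vanishing L1 eps0 (fun k => measurable_bad su (l_ k))
  (fun k => subset_trans (fun x (h : bad g u (l_ k) x) => h.1) (@ballc k)) aeE.
move=> /ltW/(small _ (l0 k)) h; have [_ _] := l_P k; apply; apply: h.
apply: le_lt_trans (locq L1); apply: ge0_subset_integral.
- exact: measurable_pball.
- exact: mcube.
- exact: measurable_funTS.
- by move=> y _; exact: Gq0.
- exact: ballc.
Unshelve. all: by end_near. Qed.

(** A failing radius would bound [S]; comparison holds at [sup S] by closedness, and openness then
    pushes [S] past its supremum. *)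
Lemma sphere_comparison_all (l : R) : (0 < l)%R -> sphere_comparison l.
Proof.
move=> l0; apply: contrapT => nl.
pose S := [set L : R | (0 <= L)%R /\ forall s, (0 < s)%R -> (s <= L)%R -> sphere_comparison s].
have S0 : S 0%R by split=> // s s0 /(lt_le_trans s0); rewrite ltxx.
have Sub : has_ubound S.
  exists l => L [L0 HL]; rewrite leNgt; apply/negP => lL; apply: nl.
  exact: HL l0 (ltW lL).
have supS : has_sup S by split => //; exists 0%R.
set L := sup S.
have L0 : (0 <= L)%R by exact: ub_le_sup.
have HltL s : (0 < s)%R -> (s < L)%R -> sphere_comparison s.
  move=> s0 sL; have [t [t0 Ht] st] : exists2 t, S t & (s < t)%R.
    have /sup_adherent/(_ supS)[t St] : (0 < L - s)%R by rewrite subr_gt0.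
    by rewrite /L subKr => st; exists t.
  exact: Ht s0 (ltW st).
have HL : (0 < L)%R -> sphere_comparison L by move=> Lp; exact: sphere_comparison_closed.
have [d d0 Hd] := sphere_comparison_open L0 HL.
have : S (L + d / 2)%R.
  split=> [|s s0 sd]; first by rewrite addr_ge0// divr_ge0// ltW.
  have [sL|Ls|sL] := ltgtP s L; first exact: HltL.
    apply: Hd Ls _; apply: le_lt_trans sd _.
    by rewrite ltrD2l ltr_pdivrMr// ltr_pMr// ltr1n.
  by rewrite sL; apply: HL; rewrite -sL.
move/(ub_le_sup Sub); rewrite leNgt => /negP; apply.
by rewrite ltrDl divr_gt0.
Qed.

Lemma moving_spheres_contradiction x0 : u x0 < +oo -> False.
Proof.
move=> ux0; have mu0 := lt_trans ltr01 mu1.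
have [c c0 uc] := solution_bounded_below n0 g0 su ux0.
have [_ _ upos _ _] := su.
pose s : R := Num.sqrt n%:R.
have s1 : (1 <= s)%R by rewrite -[leLHS]sqrtr1 ler_wsqrtr// ler1n.
have s0 : (0 < s)%R := lt_le_trans ltr01 s1.
have mug2 : (mu * g < 2 * n%:R - g)%R by rewrite -subr_gt0 (mulrC mu).
apply: (serrin_supercritical n0 g0 mu0 su ux0 (c := (c * s `^ (- (g / 2)))%R) mu1 mug2).
  by rewrite mulr_gt0// powR_gt0.
move=> r x r1 xr; have r0 := lt_le_trans ltr01 r1.
have sr1 : (1 <= s * r)%R by rewrite mulr_ege1.
have sr0 := lt_le_trans ltr01 sr1.
have g20 : (0 < g / 2)%R by rewrite divr_gt0.
suff : c%:E <= ((s * r) `^ (g / 2))%:E * u x.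
  rewrite -lee_pdivrMl ?powR_gt0// -EFinM; apply: le_trans.
  by rewrite lee_fin -mulrA -powRM ?(ltW s0) ?(ltW r0)// powRN mulrC.
have xs : (enorm x <= s * r)%R by apply: enorm_le; [exact: ltW|exact/cubeP].
have [x1|x1] := leP (enorm x) 1%R.
  apply: (@le_trans _ _ (u x)).
    by apply: uc; apply/cubeP => i; exact: le_trans (enorm_coord _ _) x1.
  rewrite -[leLHS]mul1e lee_wpmul2r ?(ltW (upos _))// lee_fin.
  by rewrite -[leLHS](powRr0 (s * r)) ler_powR// ltW.
have e0 : (0 < enorm x)%R := lt_trans ltr01 x1.
(* The unit vector [y] along [x] lies inside the sphere of radius [l = sqrt |x| > 1], and its
   reflected point is [x]. Comparison at [y] reads [c <= u y <= |x|^(g/2) u x], where [c] is the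
   lower bound on the unit cube. *)
pose l : R := Num.sqrt (enorm x).
pose y := ((enorm x)^-1 *: x)%R.
have y1 : enorm y = 1%R by rewrite enormZ ger0_norm ?invr_ge0 ?(ltW e0)// mulVf// gt_eqF.
have l0 : (0 < l)%R by rewrite sqrtr_gt0.
have yl : pball l y by rewrite /pball/= y1 ltr01/= -[ltLHS]sqrtr1 ltr_sqrt.
have yx : inversion l y = x.
  by rewrite /inversion y1 expr1n divr1 sqr_sqrtr ?(ltW e0)// scalerA mulfV ?scale1r// gt_eqF.
have cy : c%:E <= u y.
  by apply: uc; apply/cubeP => i; rewrite -y1; exact: enorm_coord.
apply: le_trans cy _; apply: le_trans (sphere_comparison_all l0 yl) _.
rewrite /kelvin yx lee_wpmul2r ?(ltW (upos _))// lee_fin /kfac y1 divr1 /l.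
rewrite -powR12_sqrt ?(ltW e0)// -powRrM mulrC.
by apply: ler_powR2r; [exact: ltW|exact: ltW|].
Qed.

End spheres.

(** * Local integrability and conclusion *)

Section positive_solutions.
Context (R : realType) (n : nat) (alpha mu : R) (u : 'rV[R]_n -> \bar R).
Local Notation m := (lebesgue_rV R n).
Hypotheses (n0 : (0 < n)%N) (mu0 : 0 < mu) (su : positive_solution alpha mu u).
Local Open Scope ereal_scope.

Lemma positive_solution_regular x0 : u x0 < +oo ->
  regular_solution (n%:R - alpha) mu u.
Proof.
move=> ux0; split.
- exact: (solution_measurable n0 su).
- exact: (solution_lsc n0 su).
- by have [_ upos _] := su.
- exact: (solution_ae_fin n0 mu0 su ux0).
- exact: (solutionE n0 mu0 su ux0).
Qed.

Variable p : R.
Hypotheses (p0 : (0 < p)%R) (Lp : Lp_loc p u).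

Let Lp_cube (r : R) : \int[m]_(x in cube r) (`|u x| `^ p) < +oo.
Proof.
have [_ /(_ (cube r))] := Lp; rewrite integral_completed_lebesgue_rV.
- apply; apply: (@rV_compact R n (fun=> `[(- r)%R, r]%classic)) => i.
  exact: segment_compact.
- exact: measurable_cube.
- apply: measurable_funTS; apply: measurable_fun_poweR.
  by apply: measurableT_comp; [exact: abse_measurable|exact: (solution_measurable n0 su)].
- by move=> x _; exact: poweR_ge0.
Qed.

(** Local integrability excludes [u = +oo] everywhere, since the unit cube has positive measure;
    this supplies the finite point required by the reduction. *)
Lemma Lp_loc_finite_point : exists x0, u x0 < +oo.
Proof.
apply: contrapT => nx; have := Lp_cube 1.
rewrite (eq_integral (cst +oo)); last first.
  move=> x _; have -> : u x = +oo.
    by apply/eqP; rewrite -leye_eq leNgt; apply/negP => ux; apply: nx; exists x.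
  by rewrite poweRyr// gt_eqF.
rewrite integral_cst//; last exact: measurable_cube.
rewrite [X in _ * X](_ : _ = ((2 * 1) ^+ n)%:E); last exact: lebesgue_rV_cube.
by rewrite gt0_mulye// lte_fin exprn_gt0// mulr_gt0.
Qed.

Lemma Lp_loc_fine (r : R) : \int[m]_(x in cube r) (fine (u x) `^ p)%:E < +oo.
Proof.
apply: le_lt_trans (Lp_cube r); have mu_ := solution_measurable n0 su.
apply: ge0_le_integral.
- exact: measurable_cube.
- by move=> x _; rewrite lee_fin powR_ge0.
- apply: measurable_funTS; apply/measurable_EFinP; apply: (measurable_fun_powR_base p).
  exact: (measurableT_comp (fine_measurable measurableT) mu_).
- apply: measurable_funTS; apply: measurable_fun_poweR.
  by apply: measurableT_comp; [exact: abse_measurable|exact: mu_].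
move=> x _; have [_ /(_ x)/ltW + _] := su.
by case: (u x) => [v| |]//= v0; rewrite ?poweRyr ?gt_eqF ?leey// ger0_norm.
Qed.

End positive_solutions.

Theorem theorem1p4 (R : realType) (n : nat) (alpha : R) (hn : (1 <= n)%N)
    (halpha0 : 0 < alpha) (halphan : alpha < n%:R) :
  (forall mu : R, 0 < mu -> mu < n%:R / (n%:R - alpha) ->
     forall u : 'rV[R]_n -> \bar R, positive_solution alpha mu u ->
       forall x : 'rV[R]_n, u x = +oo%E) /\
  (forall mu : R, n%:R / (n%:R - alpha) <= mu ->
     mu < (n%:R + alpha) / (n%:R - alpha) ->
     ~ exists u : 'rV[R]_n -> \bar R, positive_solution alpha mu u /\
         Lp_loc (n%:R * (mu - 1) / alpha) u).
Proof.
have g0 : 0 < n%:R - alpha by rewrite subr_gt0.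
have gn : n%:R - alpha < n%:R by rewrite gtrBl.
split=> [mu mu0 mug u su x|mu mug mun [u [su Lp]]].
  apply/eqP; rewrite -leye_eq leNgt; apply/negP => ux.
  have ru := positive_solution_regular hn mu0 su ux.
  exact: (serrin_subcritical hn g0 gn mu0 ru ux mug).
have mu1 : 1 < mu by apply: lt_le_trans mug; rewrite ltr_pdivlMr// mul1r.
have mu0 := lt_trans ltr01 mu1.
have p0 : 0 < n%:R * (mu - 1) / alpha.
  by rewrite divr_gt0// mulr_gt0 ?subr_gt0// ltr0n.
have [x0 ux0] := Lp_loc_finite_point hn su p0 Lp.
have ru := positive_solution_regular hn mu0 su ux0.
move: mug; rewrite le_eqVlt => /predU1P[muE|mug].
  exact: (serrin_critical hn g0 gn mu0 ru ux0 (esym muE)).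
have mug' : n%:R < mu * (n%:R - alpha) by rewrite -ltr_pdivrMr.
(* This is [(n + alpha) - (n - alpha) mu > 0], the upper bound on [mu]. *)
have kap0 : 0 < 2 * n%:R - (n%:R - alpha) - (n%:R - alpha) * mu.
  rewrite -(mulrC mu) subr_gt0; move: mun; rewrite ltr_pdivlMr//.
  by congr (_ < _); ring.
apply: (moving_spheres_contradiction hn g0 gn mu1 mug' kap0 ru _ ux0) => r r0.
by rewrite opprB addrCA subrr addr0; exact: (Lp_loc_fine hn su p0 Lp).
Qed.
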